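(* For every $\mathcal O$ with $\emptyset\neq\mathcal O\subseteq\{\cup,\cap\}$: (i) $\mathrm{MC}(\mathcal O\cup\{\times,/\})\le^{\mathrm P}_m\mathrm{MC}^*(\mathcal O\cup\{+,-\})$; and (ii) $\mathrm{MC}(\mathcal O\cup\{\overline{\phantom{c}},\times,/\})\le^{\mathrm{PSPACE}}_m\mathrm{MC}^*(\mathcal O\cup\{\overline{\phantom{c}},+,-\})$.
   Context: Natural numbers include $0$. For $A,B\subseteq\mathbb N$: $A\cup B$, $A\cap B$ are the usual operations, $\overline{A}=\mathbb N\setminus A$, $A\times B=\{a\cdot b: a\in A, b\in B\}$, and $A/B=\{c\in\mathbb N:\exists a\in A\ \exists b\in B\setminus\{0\}: a=c\cdot b\}$ (exact integer division). For a set $\mathcal O$ of operations, an $\mathcal O$-circuit $C=(V,E,g_C,\alpha)$ over $\mathbb N$ is a finite acyclic directed multigraph with gate set $V\subseteq\mathbb N$, every gate having indegree $0$, $1$ or $2$, a designated output gate $g_C$, and a labeling $\alpha$: input gates (indegree $0$) are labeled by natural numbers, indegree-$1$ gates by $\overline{\phantom{c}}$ (only if $\overline{\phantom{c}}\in\mathcal O$), indegree-$2$ gates by an operation in $\mathcal O\setminus\{\overline{\phantom{c}}\}$. Result sets: $I(g)=\{\alpha(g)\}$ for input gates, $I(g)=\mathbb N\setminus I(p)$ for complement gates with predecessor $p$, $I(g)=I(g_1)\sigma I(g_2)$ for gates labeled $\sigma$ with predecessors $g_1\le g_2$; $I(C)=I(g_C)$. Circuits are encoded as bit strings listing gates in reverse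 topological order with their labels and predecessor lists, numbers in binary. $\mathrm{MC}(\mathcal O)=\{(C,b): C$ an $\mathcal O$-circuit, $b\in\mathbb N$, $b\in I(C)\}$. For $k\ge1$ let $\mathbb N_\infty^k=\mathbb N^k\cup\{\infty\}$. Addition on $\mathbb N^k$ is componentwise, and $\infty+m=m+\infty=\infty+\infty=\infty$ for $m\in\mathbb N^k$. Subtraction is partial: for $a,b\in\mathbb N^k$, $a-b$ is defined (componentwise) iff $a_i-b_i\in\mathbb N$ for all $i\in\{1,\dots,k\}$; $\infty-m=\infty$ for $m\in\mathbb N^k$; $m-\infty$ and $\infty-\infty$ are undefined. For $A,B\subseteq\mathbb N_\infty^k$: $A+B=\{a+b:a\in A,b\in B\}$, $A-B=\{a-b: a\in A,b\in B, a-b \text{ defined}\}$, $\overline A=\mathbb N_\infty^k\setminus A$. For $\emptyset\ne\mathcal O\subseteq\{\cup,\cap,\overline{\phantom{c}},+,-\}$, an $\mathcal O$-circuit over $\mathbb N_\infty^k$ is defined exactly like an $\mathcal O$-circuit over $\mathbb N$ except that input gates are labeled by elements of $\mathbb N_\infty^k$ (components in binary) and result sets are subsets of $\mathbb N_\infty^k$. $\mathrm{MC}^*(\mathcal O)$ is the set of all $(C,b)$ such that for some $k\ge1$, $C$ is an $\mathcal O$-circuit over $\mathbb N_\infty^k$, $b\in\mathbb N_\infty^k$, and $b\in I(C)$. $A\le^{\mathrm P}_m B$ means many-one reducibility via a polynomial-time computable function; $A\le^{\mathrm{PSPACE}}_m B$ means many-one reducibility via a function computable in polynomial space. *)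

(* Defs.v *)
From Stdlib Require Import List Arith NArith.
Import ListNotations.

Inductive op := OCup | OCap | OCompl | OAdd | OSub | OMul | ODiv.

Inductive label (V : Type) :=
| LIn (v : V)
| LNeg (p : nat)
| LBin (o : op) (p1 p2 : nat).
Arguments LIn {V} v.
Arguments LNeg {V} p.
Arguments LBin {V} o p1 p2.

(* A circuit: the list of its gates (gate number, label), in reverse
   topological order (every predecessor of a gate occurs later in the
   list), together with the output gate. *)
Record circuit (V : Type) := Circuit { gates : list (nat * label V); outg : nat }.
Arguments Circuit {V} gates outg.
Arguments gates {V} c.
Arguments outg {V} c.

Definition label_ok {V} (O : op -> Prop) (okv : V -> Prop)
    (l : label V) (rest : list (nat * label V)) : Prop :=
  match l with
  | LIn v => okv v
  | LNeg p => O OCompl /\ In p (map fst rest)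
  | LBin o p1 p2 => o <> OCompl /\ O o /\ In p1 (map fst rest) /\ In p2 (map fst rest)
  end.

Fixpoint gates_ok {V} (O : op -> Prop) (okv : V -> Prop) (gs : list (nat * label V)) : Prop :=
  match gs with
  | [] => True
  | (n, l) :: rest => ~ In n (map fst rest) /\ label_ok O okv l rest /\ gates_ok O okv rest
  end.

Definition circuit_ok {V} (O : op -> Prop) (okv : V -> Prop) (C : circuit V) : Prop :=
  gates_ok O okv (gates C) /\ In (outg C) (map fst (gates C)).

(* Generic semantics: result sets of all gates. Binary gates with
   predecessors g1 <= g2 compute I(g1) sigma I(g2). *)
Section Sem.
Variables (V T : Type) (single : V -> T -> Prop)
          (compl : (T -> Prop) -> T -> Prop)
          (bin : op -> (T -> Prop) -> (T -> Prop) -> T -> Prop).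

Definition interp (l : label V) (e : nat -> T -> Prop) : T -> Prop :=
  match l with
  | LIn v => single v
  | LNeg p => compl (e p)
  | LBin o p1 p2 => bin o (e (Nat.min p1 p2)) (e (Nat.max p1 p2))
  end.

Fixpoint sem (gs : list (nat * label V)) : nat -> T -> Prop :=
  match gs with
  | [] => fun _ _ => False
  | (n, l) :: rest =>
      let e := sem rest in fun m => if Nat.eqb m n then interp l e else e m
  end.
End Sem.

Definition binN (o : op) (A B : nat -> Prop) : nat -> Prop :=
  fun x =>
    match o with
    | OCup => A x \/ B x
    | OCap => A x /\ B x
    | OMul => exists a b, A a /\ B b /\ x = a * b
    | ODiv => exists a b, A a /\ B b /\ b <> 0 /\ a = x * b
    | _ => False (* not used: only ops in {cup,cap,compl,mul,div} occur *)
    end.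

Definition semN (C : circuit nat) : nat -> Prop :=
  sem nat nat (fun v x => x = v) (fun A x => ~ A x) binN (gates C) (outg C).

(* --- Circuits over N_oo^k.  Elements: None = infinity,
       Some l = the vector l (of length k). --- *)
Definition elt := option (list nat).

Definition dim (k : nat) (t : elt) : Prop :=
  match t with None => True | Some l => length l = k end.

Definition addE (a b : elt) : elt :=
  match a, b with
  | Some x, Some y => Some (map (fun p => fst p + snd p) (combine x y))
  | _, _ => None
  end.

(* Partial subtraction: Some r = defined with result r, None = undefined. *)
Definition subE (a b : elt) : option elt :=
  match a, b with
  | Some x, Some y =>
      if forallb (fun p => Nat.leb (snd p) (fst p)) (combine x y)
      then Some (Some (map (fun p => fst p - snd p) (combine x y)))
      else None
  | None, Some _ => Some None
  | _, None => None
  end.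

Definition binS (o : op) (A B : elt -> Prop) : elt -> Prop :=
  fun x =>
    match o with
    | OCup => A x \/ B x
    | OCap => A x /\ B x
    | OAdd => exists a b, A a /\ B b /\ x = addE a b
    | OSub => exists a b, A a /\ B b /\ subE a b = Some x
    | _ => False (* not used: only ops in {cup,cap,compl,add,sub} occur *)
    end.

Definition semS (k : nat) (C : circuit elt) : elt -> Prop :=
  sem elt elt (fun v x => x = v) (fun A x => dim k x /\ ~ A x) binS (gates C) (outg C).

Fixpoint pos_bits (p : positive) : list bool :=
  match p with
  | xH => [true]
  | xO q => pos_bits q ++ [false]
  | xI q => pos_bits q ++ [true]
  end.

Definition nat_bits (n : nat) : list bool :=
  match N.of_nat n with N0 => [false] | Npos p => pos_bits p end.

Definition code_nat (n : nat) : list bool :=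
  flat_map (fun b => [b; b]) (nat_bits n) ++ [false; true].

Definition code_list (l : list nat) : list bool := flat_map code_nat l.

Definition op_code (o : op) : nat :=
  match o with
  | OCup => 0 | OCap => 1 | OCompl => 2 | OAdd => 3 | OSub => 4 | OMul => 5 | ODiv => 6
  end.

Definition label_nats {V} (vn : V -> list nat) (l : label V) : list nat :=
  match l with
  | LIn v => 0 :: vn v
  | LNeg p => [1; p]
  | LBin o p1 p2 => [2; op_code o; p1; p2]
  end.

Definition circ_nats {V} (vn : V -> list nat) (C : circuit V) : list nat :=
  outg C :: length (gates C) :: flat_map (fun g => fst g :: label_nats vn (snd g)) (gates C).

Definition encN (C : circuit nat) (b : nat) : list bool :=
  code_list (circ_nats (fun v => [v]) C ++ [b]).

Definition elt_nats (t : elt) : list nat :=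
  match t with None => [0] | Some l => 1 :: l end.

Definition encS (k : nat) (C : circuit elt) (b : elt) : list bool :=
  code_list (k :: circ_nats elt_nats C ++ elt_nats b).

Definition MC (O : op -> Prop) (x : list bool) : Prop :=
  exists (C : circuit nat) (b : nat),
    x = encN C b /\ circuit_ok O (fun _ => True) C /\ semN C b.

Definition MCstar (O : op -> Prop) (x : list bool) : Prop :=
  exists (k : nat) (C : circuit elt) (b : elt),
    1 <= k /\ x = encS k C b /\ circuit_ok O (dim k) C /\ dim k b /\ semS k C b.

(* Turing machines (single tape, two-way infinite, blank = None)       *)

Inductive move := MLeft | MRight | MStay.

Record TM := {
  tm_nstates : nat;
  tm_delta : nat -> option bool -> nat * option bool * move;
  tm_start : nat;
  tm_halt : nat }.

Definition tm_wf (M : TM) : Prop :=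
  tm_start M < tm_nstates M /\ tm_halt M < tm_nstates M /\
  forall q s, q < tm_nstates M -> fst (fst (tm_delta M q s)) < tm_nstates M.

(* left part stored reversed (nearest cell first) *)
Record config := Config {
  c_state : nat; c_left : list (option bool); c_cur : option bool;
  c_right : list (option bool) }.

Definition step (M : TM) (c : config) : config :=
  if Nat.eqb (c_state c) (tm_halt M) then c else
  match tm_delta M (c_state c) (c_cur c) with
  | (q', w, MStay) => Config q' (c_left c) w (c_right c)
  | (q', w, MLeft) =>
      match c_left c with
      | [] => Config q' [] None (w :: c_right c)
      | s :: l => Config q' l s (w :: c_right c)
      end
  | (q', w, MRight) =>
      match c_right c with
      | [] => Config q' (w :: c_left c) None []
      | s :: r => Config q' (w :: c_left c) s r
      end
  end.

Definition init (M : TM) (x : list bool) : config :=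
  match x with
  | [] => Config (tm_start M) [] None []
  | b :: r => Config (tm_start M) [] (Some b) (map Some r)
  end.

Definition run (M : TM) (t : nat) (x : list bool) : config :=
  Nat.iter t (step M) (init M x).

(* number of tape cells visited so far (never decreases) *)
Definition tape_len (c : config) : nat := length (c_left c) + 1 + length (c_right c).

Fixpoint read_bits (l : list (option bool)) : list bool :=
  match l with Some b :: r => b :: read_bits r | _ => [] end.

Definition output (c : config) : list bool := read_bits (c_cur c :: c_right c).

Definition halted (M : TM) (c : config) : Prop := c_state c = tm_halt M.

Definition poly_time_computable (f : list bool -> list bool) : Prop :=
  exists (M : TM) (a d : nat), tm_wf M /\
    forall x, exists t, t <= a * length x ^ d + a /\
      halted M (run M t x) /\ output (run M t x) = f x.

Definition poly_space_computable (f : list bool -> list bool) : Prop :=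
  exists (M : TM) (a d : nat), tm_wf M /\
    forall x, exists t, halted M (run M t x) /\ output (run M t x) = f x /\
      tape_len (run M t x) <= a * length x ^ d + a.

Definition red_P (A B : list bool -> Prop) : Prop :=
  exists f, poly_time_computable f /\ forall x, A x <-> B (f x).

Definition red_PSPACE (A B : list bool -> Prop) : Prop :=
  exists f, poly_space_computable f /\ forall x, A x <-> B (f x).

(* Main.v *)
Require Import Defs.
From Stdlib Require Import List Arith NArith ZArith Lia Bool FunctionalExtensionality.
Import ListNotations.

(* Fix a finite list [B] of pairwise coprime numbers and replace a number by its vector
   of exponents with respect to [B], and 0 by infinity: products become sums and exact
   quotients become differences. One further coordinate measures the cofactor left over.

   For (i), [B] is a coprime basis of the numbers occurring in the input. It is found in
   polynomial time by replacing any [a], [b] with [g = gcd a b > 1] by [g], [a / g], [b / g].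
   Every result set is contained in 0 and the monoid generated by [B], on which
   divisibility is the componentwise order of the exponents; the last coordinate is 0.

   For (ii), complements force the coordinates to cover all of [nat]. Now [B] consists of
   the primes dividing an input, found by trial division, and the last coordinate is the
   number of the remaining prime factors with multiplicity. A sum or difference of
   coordinates lifts to a factorization of any number having these coordinates, so by
   induction every result set is a union of fibres of the coordinate map.

   The resource bounds come from a class of functions on binary trees, closed under pairing,
   case distinction, and loops through values of polynomially bounded size whose number of
   rounds is polynomial (or, for space, merely finite). Trees are kept in prefix notation on
   one of five stacks interleaved on the tape of the Turing machine. *)

(** * Structured programs for a Turing machine *)

(** With complements, result sets can be infinite and have prime factors outside every finite [B]. A
    circuit cannot tell apart primes that divide none of its inputs, so it is enough to count them.
    Three facts make the count work: the prime factors of a number can be distributed in any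
    proportion; every count is attained, because some prime lies outside [B]; and 1 is the only
    cofactor with count 0, so an input is alone in its fibre. Infinity is never a subtrahend, just
    as 0 is never a divisor.

    A coprime basis does not serve (ii): for [B = [6]] the number 2 is not a power of 6 times a
    number prime to 6. Trial division tries exponentially many candidates, which is why (ii) is
    bounded in space only; yet the primes kept are few, because their product divides the product of
    the nonzero numbers given.

    In (i) the additional coordinate lets both parts share one reduction and keeps the dimension
    positive when [B] is empty. The equivalence concerns all words, including ill-formed ones, so
    the encoding of the image circuits has to be shown injective. *)

Definition dz (m : move) : Z :=
  match m with MLeft => -1 | MRight => 1 | MStay => 0 end%Z.

Definition tape := Z -> option bool.

Definition upd (f : tape) (z : Z) (w : option bool) : tape :=
  fun y => if Z.eqb y z then w else f y.

(* Every program has two exits, told apart by the Boolean it returns;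
   [Loop p] repeats [p] as long as it leaves through the exit [true]. *)
Inductive prog :=
| Act (g : option bool -> option bool * move * bool)
| Bind (p q0 q1 : prog)
| Loop (p : prog).

(** The head never leaves the cells from [lo] to [hi], which later bounds the visited part of the
    tape. The last argument counts machine steps exactly: each [Act] is one transition, and control
    flow is free because it is compiled into the targets of the transitions. *)
Inductive exec (lo hi : Z) : prog -> tape -> Z -> tape -> Z -> bool -> nat -> Prop :=
| exec_act g f h w m b :
    g (f h) = (w, m, b) -> (lo <= h + dz m <= hi)%Z ->
    exec lo hi (Act g) f h (upd f h w) (h + dz m) b 1
| exec_bind p q0 q1 f h f1 h1 c t1 f2 h2 b t2 :
    exec lo hi p f h f1 h1 c t1 ->
    exec lo hi (if c then q1 else q0) f1 h1 f2 h2 b t2 ->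
    exec lo hi (Bind p q0 q1) f h f2 h2 b (t1 + t2)
| exec_stop p f h f1 h1 t :
    exec lo hi p f h f1 h1 false t -> exec lo hi (Loop p) f h f1 h1 false t
| exec_loop p f h f1 h1 t1 f2 h2 b t2 :
    exec lo hi p f h f1 h1 true t1 ->
    exec lo hi (Loop p) f1 h1 f2 h2 b t2 ->
    exec lo hi (Loop p) f h f2 h2 b (t1 + t2).

Definition entry := option bool -> nat * option bool * move.

Fixpoint psize (p : prog) : nat :=
  match p with
  | Act _ => 1
  | Bind p q0 q1 => psize p + (psize q0 + psize q1)
  | Loop p => psize p
  end.

(** The transition table of [p], laid out from state [s] on; [e0] and [e1] are the states entered
    through the exits [false] and [true]. A loop is closed by using its own first state as the
    target of the exit [true]. *)
Fixpoint comp (p : prog) (s e0 e1 : nat) : list entry :=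
  match p with
  | Act g => [fun x => let '(w, m, b) := g x in ((if b : bool then e1 else e0), w, m)]
  | Bind p q0 q1 =>
      comp p s (s + psize p) (s + psize p + psize q0) ++
      comp q0 (s + psize p) e0 e1 ++ comp q1 (s + psize p + psize q0) e0 e1
  | Loop p => comp p s e0 s
  end.

Lemma comp_length p : forall s e0 e1, length (comp p s e0 e1) = psize p.
Proof.
  induction p; intros; simpl; rewrite ?length_app, ?IHp, ?IHp1, ?IHp2, ?IHp3; lia.
Qed.

(** State [psize p], the first one behind the table, is the halting state, and both exits lead to
    it. *)
Definition prog_TM (p : prog) : TM :=
  {| tm_nstates := S (psize p);
     tm_delta := fun q x =>
       nth q (comp p 0 (psize p) (psize p)) (fun x => (psize p, x, MStay)) x;
     tm_start := 0;
     tm_halt := psize p |}.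

Lemma psize_pos p : 0 < psize p.
Proof. induction p; simpl; lia. Qed.

Lemma comp_targets p : forall s e0 e1 n x,
  s + psize p <= n -> e0 < n -> e1 < n ->
  Forall (fun e : entry => fst (fst (e x)) < n) (comp p s e0 e1).
Proof.
  induction p; intros; simpl in *.
  - constructor; [|constructor]. destruct (g x) as [[w m] []]; simpl; lia.
  - pose proof (psize_pos p1). pose proof (psize_pos p2). pose proof (psize_pos p3).
    apply Forall_app; split; [|apply Forall_app; split];
      [apply IHp1|apply IHp2|apply IHp3]; lia.
  - pose proof (psize_pos p). apply IHp; lia.
Qed.

Lemma prog_TM_wf p : tm_wf (prog_TM p).
Proof.
  pose proof (psize_pos p).
  split; [simpl; lia|split; [simpl; lia|]]. intros q s Hq. cbn [prog_TM tm_delta tm_nstates] in *.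
  pose proof (comp_targets p 0 (psize p) (psize p) (S (psize p)) s) as HF.
  rewrite Forall_forall in HF.
  destruct (Nat.lt_ge_cases q (psize p)).
  - apply HF; try lia. apply nth_In. now rewrite comp_length.
  - rewrite nth_overflow by (rewrite comp_length; lia). simpl; lia.
Qed.

Fixpoint seg (f : tape) (a d : Z) (n : nat) : list (option bool) :=
  match n with 0 => [] | S n => f a :: seg f (a + d) d n end.

Lemma seg_ext f g a d n :
  (forall i, (0 <= i < Z.of_nat n)%Z -> f (a + i * d)%Z = g (a + i * d)%Z) ->
  seg f a d n = seg g a d n.
Proof.
  revert a. induction n; intros a H; simpl; auto. f_equal.
  - specialize (H 0%Z). rewrite Z.mul_0_l, Z.add_0_r in H. apply H; lia.
  - apply IHn. intros i Hi. specialize (H (i + 1)%Z).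
    replace (a + d + i * d)%Z with (a + (i + 1) * d)%Z by ring. apply H; lia.
Qed.

Lemma seg_length f a d n : length (seg f a d n) = n.
Proof. revert a. induction n; intros; simpl; auto. Qed.

(** A configuration stores only the visited cells, whereas a [tape] is total. The unvisited cells
    are blank, and the visited ones lie between [lo] and [hi], whence the bound on [tape_len]. *)
Definition represents (lo hi : Z) (c : config) (f : tape) (h : Z) : Prop :=
  exists nl nr : nat,
    c_left c = seg f (h - 1) (-1) nl /\ c_cur c = f h /\
    c_right c = seg f (h + 1) 1 nr /\
    (forall z, (z < h - Z.of_nat nl \/ z > h + Z.of_nat nr)%Z -> f z = None) /\
    (lo <= h - Z.of_nat nl)%Z /\ (h + Z.of_nat nr <= hi)%Z.

Lemma represents_tape_len lo hi c f h :
  represents lo hi c f h -> (Z.of_nat (tape_len c) <= hi - lo + 1)%Z.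
Proof.
  intros (nl & nr & Hl & _ & Hr & _ & H1 & H2). unfold tape_len.
  rewrite Hl, Hr, !seg_length. lia.
Qed.

Definition in_state (lo hi : Z) (q : nat) (f : tape) (h : Z) (c : config) : Prop :=
  c_state c = q /\ represents lo hi c f h.

Lemma upd_same f z w : upd f z w z = w.
Proof. unfold upd. now rewrite Z.eqb_refl. Qed.

Lemma upd_other f z w y : y <> z -> upd f z w y = f y.
Proof. intros H. unfold upd. destruct (Z.eqb_spec y z); congruence. Qed.

(** The subcases follow [step]: a move beyond the stored part enters a fresh cell, which is blank by
    the clause on unvisited cells. *)
Lemma step_represents M lo hi q f h c q' w m :
  in_state lo hi q f h c -> q <> tm_halt M ->
  tm_delta M q (f h) = (q', w, m) -> (lo <= h + dz m <= hi)%Z ->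
  in_state lo hi q' (upd f h w) (h + dz m) (step M c).
Proof.
  intros [Hq (nl & nr & Hl & Hc & Hr & Hout & H1 & H2)] Hh Hd Hb.
  unfold step. rewrite Hq. destruct (Nat.eqb_spec q (tm_halt M)); [congruence|].
  rewrite Hc, Hd.
  assert (El : seg (upd f h w) (h - 1) (-1) nl = c_left c).
  { rewrite Hl. apply seg_ext. intros. apply upd_other. lia. }
  assert (Er : seg (upd f h w) (h + 1) 1 nr = c_right c).
  { rewrite Hr. apply seg_ext. intros. apply upd_other. lia. }
  destruct m; simpl in Hb; simpl dz.
  - destruct nl as [|nl].
    + simpl in Hl. rewrite Hl. split; [reflexivity|].
      exists 0, (S nr). simpl. repeat split; try lia.
      * rewrite upd_other by lia. symmetry. apply Hout. lia.
      * replace (h + -1 + 1)%Z with h by ring. now rewrite upd_same, Er.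
      * intros z Hz. rewrite upd_other by lia. apply Hout. lia.
    + destruct (c_left c) as [|x l]; [discriminate|]. cbn [seg] in El. injection El as E1 E2.
      split; [reflexivity|].
      exists nl, (S nr). simpl. repeat split; try lia.
      * symmetry. replace (h + -1 - 1)%Z with (h - 1 + -1)%Z by ring. exact E2.
      * symmetry. exact E1.
      * replace (h + -1 + 1)%Z with h by ring. now rewrite upd_same, Er.
      * intros z Hz. rewrite upd_other by lia. apply Hout. lia.
  - destruct nr as [|nr].
    + simpl in Hr. rewrite Hr. split; [reflexivity|].
      exists (S nl), 0. simpl. repeat split; try lia.
      * replace (h + 1 - 1)%Z with h by ring. change (h + -1)%Z with (h - 1)%Z. now rewrite upd_same, El.
      * rewrite upd_other by lia. symmetry. apply Hout. lia.
      * intros z Hz. rewrite upd_other by lia. apply Hout. lia.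
    + destruct (c_right c) as [|x l]; [discriminate|]. cbn [seg] in Er. injection Er as E1 E2.
      split; [reflexivity|].
      exists (S nl), nr. simpl. repeat split; try lia.
      * replace (h + 1 - 1)%Z with h by ring. change (h + -1)%Z with (h - 1)%Z. now rewrite upd_same, El.
      * symmetry. exact E1.
      * symmetry. exact E2.
      * intros z Hz. rewrite upd_other by lia. apply Hout. lia.
  - split; [reflexivity|]. exists nl, nr. simpl. rewrite Z.add_0_r. repeat split; auto.
    + now rewrite upd_same.
    + intros z Hz. rewrite upd_other by lia. apply Hout. lia.
Qed.

(** The code of [p] may occur anywhere in the table, its first state being the length of what
    precedes it. This form survives the induction, since the parts of a [Bind] are consecutive
    pieces of its code. *)
Lemma exec_steps M code lo hi p f h f' h' b t :
  (forall q x, q < length code -> tm_delta M q x = nth q code (fun x => (0, x, MStay)) x) ->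
  tm_halt M = length code ->
  exec lo hi p f h f' h' b t ->
  forall pre post e0 e1 c,
    code = pre ++ comp p (length pre) e0 e1 ++ post ->
    in_state lo hi (length pre) f h c ->
    in_state lo hi (if b then e1 else e0) f' h' (Nat.iter t (step M) c).
Proof.
  intros HM Hh H. induction H; intros pre post e0 e1 cf Hcode Hc.
  - assert (L : length pre < length code).
    { rewrite Hcode, !length_app. simpl. lia. }
    change (Nat.iter 1 (step M) cf) with (step M cf).
    eapply step_represents; eauto; [lia|].
    rewrite HM by assumption. rewrite Hcode, app_nth2 by lia.
    rewrite Nat.sub_diag. simpl. rewrite H. reflexivity.
  - simpl in Hcode. rewrite Nat.add_comm, Nat.iter_add.
    rewrite <- !app_assoc in Hcode.
    specialize (IHexec1 _ _ _ _ _ Hcode Hc).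
    destruct c.
    + eapply (IHexec2 (pre ++ comp p (length pre) (length pre + psize p)
        (length pre + psize p + psize q0) ++ comp q0 (length pre + psize p) e0 e1) post).
      * rewrite Hcode, !length_app, !comp_length, <- !app_assoc.
        rewrite !Nat.add_assoc. reflexivity.
      * rewrite !length_app, !comp_length, Nat.add_assoc. exact IHexec1.
    + eapply (IHexec2 (pre ++ comp p (length pre) (length pre + psize p)
        (length pre + psize p + psize q0)) _).
      * rewrite Hcode, !length_app, !comp_length, <- !app_assoc. reflexivity.
      * rewrite !length_app, !comp_length. exact IHexec1.
  - simpl in Hcode. exact (IHexec _ _ _ _ _ Hcode Hc).
  - rewrite Nat.add_comm, Nat.iter_add.
    eapply IHexec2; [exact Hcode|].
    simpl in Hcode. exact (IHexec1 _ _ _ _ _ Hcode Hc).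
Qed.

Definition input_tape (x : list bool) : tape :=
  fun z => if Z.ltb z 0 then None else nth_error x (Z.to_nat z).

Lemma seg_map_nth_error x : forall f a,
  (forall i, f (a + Z.of_nat i)%Z = nth_error x i) ->
  seg f a 1 (length x) = map Some x.
Proof.
  induction x as [|b x IH]; intros f a H; simpl; auto. f_equal.
  - specialize (H 0). simpl in H. now rewrite Z.add_0_r in H.
  - apply IH. intros i. rewrite <- Z.add_assoc, Z.add_comm with (n := 1%Z).
    change 1%Z with (Z.of_nat 1). rewrite <- Nat2Z.inj_add, Nat.add_1_r. apply (H (S i)).
Qed.

Lemma init_represents M x lo hi :
  (lo <= 0)%Z -> (Z.of_nat (length x) <= hi)%Z ->
  in_state lo hi (tm_start M) (input_tape x) 0 (init M x).
Proof.
  intros Hlo Hhi. unfold init. destruct x as [|b x]; split; try reflexivity.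
  - exists 0, 0. simpl in *. repeat split; try lia.
    intros z Hz. unfold input_tape. destruct (Z.ltb_spec z 0); auto. now rewrite nth_error_nil.
  - exists 0, (length x). cbn [length] in Hhi. repeat split; try (simpl; lia).
    + symmetry. simpl c_right. apply seg_map_nth_error. intros i. unfold input_tape.
      destruct (Z.ltb_spec (0 + 1 + Z.of_nat i) 0); [lia|].
      replace (Z.to_nat (0 + 1 + Z.of_nat i)) with (S i) by lia. reflexivity.
    + intros z Hz. unfold input_tape. destruct (Z.ltb_spec z 0); auto.
      apply nth_error_None. simpl. lia.
Qed.

Lemma output_represents lo hi c f y :
  represents lo hi c f 0 -> (forall i, f (Z.of_nat i) = nth_error y i) -> output c = y.
Proof.
  intros (nl & nr & _ & Hc & Hr & Hout & _ & _) Hy. unfold output. rewrite Hc, Hr. clear Hc Hr.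
  change (f 0%Z :: seg f (0 + 1) 1 nr) with (seg f 0 1 (S nr)).
  assert (HL : length y < S (S nr)).
  { destruct (Nat.lt_ge_cases (length y) (S (S nr))); auto.
    assert (nth_error y (S nr) = None) by (rewrite <- Hy; apply Hout; lia).
    apply nth_error_None in H0. lia. }
  apply Nat.lt_succ_r in HL. clear Hout. revert HL.
  assert (Hy' : forall i, f (0 + Z.of_nat i)%Z = nth_error y i) by (intros; now rewrite Z.add_0_l).
  clear Hy. revert Hy'. generalize 0%Z as a. generalize (S nr) as n. clear.
  induction y as [|b y IH]; intros n a Hy HL.
  - destruct n; auto. specialize (Hy 0). simpl in *. rewrite Z.add_0_r in Hy. now rewrite Hy.
  - destruct n; simpl in HL; [lia|]. simpl.
    pose proof (Hy 0) as H0. simpl in H0. rewrite Z.add_0_r in H0. rewrite H0. f_equal.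
    apply IH; [|lia]. intros i. rewrite <- Z.add_assoc, Z.add_comm with (n := 1%Z).
    change 1%Z with (Z.of_nat 1). rewrite <- Nat2Z.inj_add, Nat.add_1_r. apply (Hy (S i)).
Qed.

Lemma prog_TM_correct p lo hi x y f' b t :
  (lo <= 0)%Z -> (Z.of_nat (length x) <= hi)%Z ->
  exec lo hi p (input_tape x) 0 f' 0 b t ->
  (forall i, f' (Z.of_nat i) = nth_error y i) ->
  let c := run (prog_TM p) t x in
  halted (prog_TM p) c /\ output c = y /\ (Z.of_nat (tape_len c) <= hi - lo + 1)%Z.
Proof.
  intros Hlo Hhi He Hy c.
  assert (Hc : in_state lo hi (psize p) f' 0 c).
  {     replace (psize p) with (if b then psize p else psize p) by (now destruct b).
    refine (exec_steps (prog_TM p) (comp p 0 (psize p) (psize p)) lo hi _ _ _ _ _ _ _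
      _ _ He [] [] (psize p) (psize p) (init _ x) _ _).
    - intros q s Hq. simpl. now rewrite (nth_indep _ _ (fun x => (0, x, MStay)) Hq).
    - simpl. now rewrite comp_length.
    - simpl. now rewrite app_nil_r.
    - now apply (init_represents (prog_TM p)). }
  destruct Hc as [Hs Hr]. repeat split.
  - exact Hs.
  - eapply output_represents; eauto.
  - eapply represents_tape_len; eauto.
Qed.

(** * Stacks on the tape *)

Inductive reg := IO | RM | RA | RB | RC.

Lemma reg_eq_dec (r r' : reg) : {r = r'} + {r <> r'}.
Proof. decide equality. Qed.

Record stacks := Stacks { s_io : list bool; s_m : list bool; s_a : list bool;
                          s_b : list bool; s_c : list bool }.

Definition get (r : reg) (s : stacks) : list bool :=
  match r with IO => s_io s | RM => s_m s | RA => s_a s | RB => s_b s | RC => s_c s end.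

Definition set (r : reg) (l : list bool) (s : stacks) : stacks :=
  match s with Stacks i m a b c =>
    match r with
    | IO => Stacks l m a b c | RM => Stacks i l a b c | RA => Stacks i m l b c
    | RB => Stacks i m a l c | RC => Stacks i m a b l
    end
  end.

Definition ssize (s : stacks) : nat :=
  length (s_io s) + length (s_m s) + length (s_a s) + length (s_b s) + length (s_c s).

Lemma get_set_same r l s : get r (set r l s) = l.
Proof. now destruct s, r. Qed.

Lemma get_set_other r r' l s : r' <> r -> get r' (set r l s) = get r' s.
Proof. destruct s, r, r'; congruence || reflexivity. Qed.

Lemma length_get r s : length (get r s) <= ssize s.
Proof. unfold ssize. destruct s, r; simpl; lia. Qed.

Inductive sp :=
| SPush (r : reg) (b : bool)
| SPop (r : reg)
| STst (r : reg)
| SRet (b : bool)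
| SBind (p q0 q1 : sp)
| SLoop (p : sp).

(** [S] bounds the total length of all stacks throughout the run. The last argument counts stack
    operations, each of which costs a number of machine steps linear in [S]. [SPop] leaves through
    the bit that it removes, [STst] through the exit [true] if the stack is nonempty. *)
Inductive sx (S : nat) : sp -> stacks -> stacks -> bool -> nat -> Prop :=
| sx_push r b s :
    ssize (set r (b :: get r s) s) <= S ->
    sx S (SPush r b) s (set r (b :: get r s) s) false 1
| sx_pop r s :
    ssize s <= S -> sx S (SPop r) s (set r (tl (get r s)) s) (hd false (get r s)) 1
| sx_tst r s :
    ssize s <= S ->
    sx S (STst r) s s (match get r s with [] => false | _ => true end) 1
| sx_ret b s : ssize s <= S -> sx S (SRet b) s s b 1
| sx_bind p q0 q1 s s1 c t1 s2 b t2 :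
    sx S p s s1 c t1 -> sx S (if c then q1 else q0) s1 s2 b t2 ->
    sx S (SBind p q0 q1) s s2 b (t1 + t2)
| sx_stop p s s1 t : sx S p s s1 false t -> sx S (SLoop p) s s1 false t
| sx_loop p s s1 t1 s2 b t2 :
    sx S p s s1 true t1 -> sx S (SLoop p) s1 s2 b t2 -> sx S (SLoop p) s s2 b (t1 + t2).

(* The stack [IO] occupies the cells 0, 1, 2, ..., bottom first; the other four
   stacks are interleaved on the negative cells. Every stack is preceded by a
   blank cell [base r], so that its two ends can be found by scanning for a blank. *)
Definition off (r : reg) : nat :=
  match r with IO => 1 | RM => 1 | RA => 2 | RB => 3 | RC => 4 end.
Definition outward (r : reg) : move := match r with IO => MRight | _ => MLeft end.
Definition inward (r : reg) : move := match r with IO => MLeft | _ => MRight end.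
Definition stride (r : reg) : nat := match r with IO => 1 | _ => 4 end.
Definition base (r : reg) : Z := (- Z.of_nat (off r))%Z.
Definition pos (r : reg) (i : nat) : Z :=
  (base r + (Z.of_nat i + 1) * (Z.of_nat (stride r) * dz (outward r)))%Z.

Definition layout (f : tape) (s : stacks) : Prop :=
  (forall r i, f (pos r i) = nth_error (rev (get r s)) i) /\ (forall r, f (base r) = None).

Lemma pos_inj r i r' i' : pos r i = pos r' i' -> r = r' /\ i = i'.
Proof.
  intros H. destruct r, r'; unfold pos, base in H;
    cbn [dz stride outward off] in H; split; (reflexivity || lia).
Qed.

Lemma pos_base r i r' : pos r i <> base r'.
Proof. destruct r, r'; unfold pos, base; cbn [dz stride outward inward off]; lia. Qed.

Definition seqp (p q : prog) : prog := Bind p q q.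
Definition ret (b : bool) : prog := Act (fun x => (x, MStay, b)).
Definition nonblank : prog :=
  Act (fun x => (x, MStay, match x with None => false | _ => true end)).
Definition write (w : option bool) : prog := Act (fun _ => (w, MStay, false)).
Definition erase : prog :=
  Act (fun x => (None, MStay, match x with Some true => true | _ => false end)).

Fixpoint mvn (m : move) (n : nat) : prog :=
  match n with 0 => ret false | S n => seqp (Act (fun x => (x, m, false))) (mvn m n) end.

Definition scan (m : move) (k : nat) : prog := Loop (seqp (mvn m k) nonblank).

Lemma upd_id f h : upd f h (f h) = f.
Proof.
  extensionality y. unfold upd. destruct (Z.eqb_spec y h); congruence.
Qed.

Section TapeRules.
Context (lo hi : Z).

Lemma exec_seqp p q f h f1 h1 c t1 f2 h2 b t2 :
  exec lo hi p f h f1 h1 c t1 -> exec lo hi q f1 h1 f2 h2 b t2 ->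
  exec lo hi (seqp p q) f h f2 h2 b (t1 + t2).
Proof. intros H1 H2. eapply exec_bind; [exact H1|]. now destruct c. Qed.

Lemma exec_stay f h b : (lo <= h <= hi)%Z -> exec lo hi (ret b) f h f h b 1.
Proof.
  intros H. pose proof (exec_act lo hi (fun x => (x, MStay, b)) f h (f h) MStay b eq_refl) as E.
  simpl dz in E. rewrite upd_id, Z.add_0_r in E. auto.
Qed.

Lemma exec_nonblank f h :
  (lo <= h <= hi)%Z ->
  exec lo hi nonblank f h f h (match f h with None => false | _ => true end) 1.
Proof.
  intros H. pose proof (exec_act lo hi (fun x => (x, MStay, match x with None => false | _ => true end))
    f h (f h) MStay _ eq_refl) as E.
  simpl dz in E. rewrite upd_id, Z.add_0_r in E. auto.
Qed.

Lemma exec_write f h w : (lo <= h <= hi)%Z -> exec lo hi (write w) f h (upd f h w) h false 1.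
Proof.
  intros H. pose proof (exec_act lo hi (fun _ => (w, MStay, false)) f h w MStay _ eq_refl) as E.
  simpl dz in E. rewrite Z.add_0_r in E. auto.
Qed.

Lemma exec_erase f h b :
  (lo <= h <= hi)%Z -> f h = Some b -> exec lo hi erase f h (upd f h None) h b 1.
Proof.
  intros H Hb. pose proof (exec_act lo hi
    (fun x => (None, MStay, match x with Some true => true | _ => false end))
    f h None MStay _ eq_refl) as E.
  simpl dz in E. rewrite Z.add_0_r, Hb in E. destruct b; auto.
Qed.

Lemma exec_mvn m n : forall f h,
  (lo <= h <= hi)%Z -> (lo <= h + Z.of_nat n * dz m <= hi)%Z ->
  exec lo hi (mvn m n) f h f (h + Z.of_nat n * dz m) false (S n).
Proof.
  induction n; intros f h H0 H1.
  - simpl. rewrite Z.add_0_r. now apply exec_stay.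
  - change (S (S n)) with (1 + S n). apply exec_seqp with (f1 := f) (h1 := (h + dz m)%Z) (c := false).
    + rewrite <- (upd_id f h) at 2. eapply exec_act; [reflexivity|destruct m; simpl in *; lia].
    + replace (h + Z.of_nat (S n) * dz m)%Z with (h + dz m + Z.of_nat n * dz m)%Z by lia.
      apply IHn; destruct m; simpl in *; lia.
Qed.

(** A round takes [k + 2] steps: [k] moves, the [ret] that closes [mvn], and the test. *)
Lemma exec_scan m k n : forall f h,
  (lo <= h <= hi)%Z ->
  (lo <= h + (Z.of_nat n + 1) * (Z.of_nat k * dz m) <= hi)%Z ->
  (forall i, i < n -> f (h + (Z.of_nat i + 1) * (Z.of_nat k * dz m))%Z <> None) ->
  f (h + (Z.of_nat n + 1) * (Z.of_nat k * dz m))%Z = None ->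
  exec lo hi (scan m k) f h f (h + (Z.of_nat n + 1) * (Z.of_nat k * dz m)) false
    ((n + 1) * (k + 2)).
Proof.
  induction n; intros f h H0 H1 Hs He.
  - replace (h + (Z.of_nat 0 + 1) * (Z.of_nat k * dz m))%Z
      with (h + Z.of_nat k * dz m)%Z in * by lia.
    apply exec_stop. replace ((0 + 1) * (k + 2)) with (S k + 1) by lia.
    eapply exec_seqp; [apply exec_mvn; auto|].
    pose proof (exec_nonblank f (h + Z.of_nat k * dz m)%Z H1) as E. now rewrite He in E.
  - assert (B : (lo <= h + Z.of_nat k * dz m <= hi)%Z).
    { clear - H0 H1. rewrite Nat2Z.inj_succ in H1.
      pose proof (Z.mul_nonneg_nonneg (Z.of_nat n) (Z.of_nat k) ltac:(lia) ltac:(lia)).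
      destruct m; cbn [dz] in *; lia. }
    replace ((S n + 1) * (k + 2)) with ((S k + 1) + (n + 1) * (k + 2)) by lia.
    apply exec_loop with (f1 := f) (h1 := (h + Z.of_nat k * dz m)%Z).
    + eapply exec_seqp; [apply exec_mvn; auto|].
      pose proof (exec_nonblank f (h + Z.of_nat k * dz m)%Z B) as E.
      specialize (Hs 0 ltac:(lia)). 
      replace (h + (Z.of_nat 0 + 1) * (Z.of_nat k * dz m))%Z
        with (h + Z.of_nat k * dz m)%Z in Hs by lia.
      destruct (f (h + Z.of_nat k * dz m)%Z); congruence.
    + replace (h + (Z.of_nat (S n) + 1) * (Z.of_nat k * dz m))%Z
        with (h + Z.of_nat k * dz m + (Z.of_nat n + 1) * (Z.of_nat k * dz m))%Z in * by lia.
      apply IHn; auto. intros i Hi. specialize (Hs (S i) ltac:(lia)).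
      replace (h + (Z.of_nat (S i) + 1) * (Z.of_nat k * dz m))%Z
        with (h + Z.of_nat k * dz m + (Z.of_nat i + 1) * (Z.of_nat k * dz m))%Z in Hs by lia.
      exact Hs.
Qed.
End TapeRules.

Definition to_base (r : reg) : prog := mvn MLeft (off r).
Definition to_home (r : reg) : prog := mvn MRight (off r).

(** Between operations the head rests on cell 0. A scan outward from [base r] stops at the first
    blank behind the top of the stack, a scan inward stops at [base r] again. *)
Definition push (r : reg) (b : bool) : prog :=
  seqp (to_base r) (seqp (scan (outward r) (stride r)) (seqp (write (Some b))
    (seqp (scan (inward r) (stride r)) (to_home r)))).

(** On an empty stack, the step back from the first blank arrives at the blank [base r], and nothing
    is removed. Otherwise [erase] keeps the bit in its exit, and the code for the way home is
    duplicated to remember it. *)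
Definition pop (r : reg) : prog :=
  seqp (to_base r) (seqp (scan (outward r) (stride r)) (seqp (mvn (inward r) (stride r))
    (Bind nonblank (to_home r)
      (Bind erase
        (seqp (scan (inward r) (stride r)) (seqp (to_home r) (ret false)))
        (seqp (scan (inward r) (stride r)) (seqp (to_home r) (ret true))))))).

Definition test (r : reg) : prog :=
  seqp (to_base r) (seqp (mvn (outward r) (stride r))
    (Bind nonblank
      (seqp (mvn (inward r) (stride r)) (seqp (to_home r) (ret false)))
      (seqp (mvn (inward r) (stride r)) (seqp (to_home r) (ret true))))).

Fixpoint tape_prog (p : sp) : prog :=
  match p with
  | SPush r b => push r b
  | SPop r => pop r
  | STst r => test r
  | SRet b => ret b
  | SBind p q0 q1 => Bind (tape_prog p) (tape_prog q0) (tape_prog q1)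
  | SLoop p => Loop (tape_prog p)
  end.

(** The outermost cell is [pos RC S], which is [-4 - 4 * (S + 1)]. *)
Definition lo_bound (S : nat) : Z := (- (4 * Z.of_nat S + 8))%Z.
Definition hi_bound (S : nat) : Z := (Z.of_nat S + 1)%Z.

Section StackRules.
Context (S : nat).
Local Notation ex := (exec (lo_bound S) (hi_bound S)).

Lemma base_bounds r : (lo_bound S <= base r <= hi_bound S)%Z.
Proof. unfold lo_bound, hi_bound, base. destruct r; cbn [off dz]; lia. Qed.

Lemma pos_bounds r i : i <= S -> (lo_bound S <= pos r i <= hi_bound S)%Z.
Proof. unfold lo_bound, hi_bound, pos, base. destruct r; cbn [dz stride outward inward off]; lia. Qed.

Lemma exec_to_base r f : ex (to_base r) f 0 f (base r) false (1 + off r).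
Proof.
  pose proof (base_bounds r) as B.
  replace (base r) with (0 + Z.of_nat (off r) * dz MLeft)%Z in *
    by (unfold base; cbn [dz]; lia).
  apply exec_mvn; auto. unfold lo_bound, hi_bound. lia.
Qed.

Lemma exec_to_home r f : ex (to_home r) f (base r) f 0 false (1 + off r).
Proof.
  pose proof (base_bounds r) as B.
  replace 0%Z with (base r + Z.of_nat (off r) * dz MRight)%Z
    by (unfold base; cbn [dz]; lia).
  apply exec_mvn; auto. unfold lo_bound, hi_bound, base. destruct r; cbn [off dz]; lia.
Qed.

Lemma exec_scan_out r f s :
  layout f s -> length (get r s) <= S ->
  ex (scan (outward r) (stride r)) f (base r) f (pos r (length (get r s))) false
     ((length (get r s) + 1) * (stride r + 2)).
Proof.
  intros [L1 L2] HS. apply exec_scan.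
  - apply base_bounds.
  - now apply pos_bounds.
  - intros i Hi. fold (pos r i). rewrite L1. apply nth_error_Some. now rewrite length_rev.
  - fold (pos r (length (get r s))). rewrite L1. apply nth_error_None. now rewrite length_rev.
Qed.

Lemma pos_inward r n i : 
  (i < n)%nat ->
  (pos r n + (Z.of_nat i + 1) * (Z.of_nat (stride r) * dz (inward r)))%Z = pos r (n - i - 1).
Proof. unfold pos, base. destruct r; cbn [dz stride outward inward off]; lia. Qed.

Lemma pos_inward_base r n :
  (pos r n + (Z.of_nat n + 1) * (Z.of_nat (stride r) * dz (inward r)))%Z = base r.
Proof. unfold pos, base. destruct r; cbn [dz stride outward inward off]; lia. Qed.

Lemma exec_scan_in r f s n :
  layout f s -> n <= length (get r s) -> n <= S ->
  ex (scan (inward r) (stride r)) f (pos r n) f (base r) false ((n + 1) * (stride r + 2)).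
Proof.
  intros [L1 L2] Hn HS. rewrite <- (pos_inward_base r n). apply exec_scan.
  - now apply pos_bounds.
  - rewrite pos_inward_base. apply base_bounds.
  - intros i Hi. rewrite pos_inward, L1 by assumption.
    apply nth_error_Some. rewrite length_rev. lia.
  - now rewrite pos_inward_base.
Qed.

Lemma layout_push f s r b :
  layout f s -> layout (upd f (pos r (length (get r s))) (Some b)) (set r (b :: get r s) s).
Proof.
  intros [L1 L2]. split.
  - intros r' i. destruct (Z.eq_dec (pos r' i) (pos r (length (get r s)))) as [E|E].
    + rewrite E, upd_same. apply pos_inj in E. destruct E as [-> ->].
      rewrite get_set_same. simpl. rewrite nth_error_app2; rewrite length_rev; auto.
      now rewrite Nat.sub_diag.
    + rewrite upd_other by assumption. rewrite L1.
      destruct (reg_eq_dec r' r) as [->|N].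
      * rewrite get_set_same. simpl.
        destruct (Nat.lt_trichotomy i (length (get r s))) as [H|[->|H]].
        -- now rewrite nth_error_app1 by (now rewrite length_rev).
        -- congruence.
        -- rewrite (proj2 (nth_error_None _ _)) by (rewrite length_rev; lia).
           symmetry. apply nth_error_None. rewrite length_app, length_rev. simpl. lia.
      * now rewrite get_set_other.
  - intros r'. rewrite upd_other; auto. intros E. symmetry in E. now apply pos_base in E.
Qed.

Lemma layout_pop f s r b l :
  layout f s -> get r s = b :: l -> layout (upd f (pos r (length l)) None) (set r l s).
Proof.
  intros [L1 L2] E0. split.
  - intros r' i. destruct (Z.eq_dec (pos r' i) (pos r (length l))) as [E|E].
    + rewrite E, upd_same. apply pos_inj in E. destruct E as [-> ->].
      rewrite get_set_same. symmetry. apply nth_error_None. now rewrite length_rev.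
    + rewrite upd_other by assumption. rewrite L1.
      destruct (reg_eq_dec r' r) as [->|N].
      * rewrite get_set_same, E0. simpl.
        destruct (Nat.lt_trichotomy i (length l)) as [H|[->|H]].
        -- now rewrite nth_error_app1 by (now rewrite length_rev).
        -- congruence.
        -- symmetry. rewrite (proj2 (nth_error_None _ _)) by (rewrite length_rev; lia).
           symmetry. apply nth_error_None. rewrite length_app, length_rev. simpl. lia.
      * now rewrite get_set_other.
  - intros r'. rewrite upd_other; auto. intros E. symmetry in E. now apply pos_base in E.
Qed.

Lemma stride_le r : stride r <= 4.
Proof. destruct r; simpl; lia. Qed.

Lemma off_le r : off r <= 4.
Proof. destruct r; simpl; lia. Qed.

Lemma length_set_cons r b s : length (get r s) < ssize (set r (b :: get r s) s).
Proof.
  pose proof (length_get r (set r (b :: get r s) s)) as H.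
  rewrite get_set_same in H. exact H.
Qed.

(** Two scans with at most six steps per entry and a few single moves stay well below
    [40 * (S + 2)]; the constant is chosen to cover all three operations. *)
Lemma exec_push f s r b :
  layout f s -> ssize (set r (b :: get r s) s) <= S ->
  exists f' t, ex (push r b) f 0 f' 0 false t /\ layout f' (set r (b :: get r s) s) /\
    t <= 40 * (S + 2).
Proof.
  intros L HS. pose proof (length_set_cons r b s).
  do 2 eexists. split; [|split].
  - unfold push. eapply exec_seqp; [apply exec_to_base|].
    eapply exec_seqp; [apply exec_scan_out; [exact L|lia]|].
    eapply exec_seqp; [apply exec_write; apply pos_bounds; lia|].
    eapply exec_seqp; [|apply exec_to_home].
    eapply exec_scan_in; [now apply layout_push| |lia].
    rewrite get_set_same. simpl. lia.
  - now apply layout_push.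
  - pose proof (stride_le r). pose proof (off_le r). nia.
Qed.

Lemma exec_pop f s r :
  layout f s -> ssize s <= S ->
  exists f' t, ex (pop r) f 0 f' 0 (hd false (get r s)) t /\
    layout f' (set r (tl (get r s)) s) /\ t <= 40 * (S + 2).
Proof.
  intros L HS. pose proof (length_get r s).
  pose proof (stride_le r). pose proof (off_le r).
  pose proof (pos_bounds r (length (get r s)) ltac:(lia)) as B.
  destruct (get r s) as [|b l] eqn:E.
  - pose proof (pos_inward_base r 0) as P. cbn [length] in *.
    do 2 eexists. split; [|split].
    + unfold pop. eapply exec_seqp; [apply exec_to_base|].
      eapply exec_seqp; [apply exec_scan_out; [exact L|rewrite E; simpl; lia]|]. rewrite E. cbn [length].
      eapply exec_seqp.
      * apply exec_mvn; auto. replace (pos r _ + _)%Z with (base r) by lia.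
        apply base_bounds.
      * replace (pos r _ + _)%Z with (base r) by lia.
        eapply exec_bind; [apply exec_nonblank; apply base_bounds|].
        rewrite (proj2 L). apply exec_to_home.
    + simpl. replace (set r [] s) with s; [exact L|].
      destruct s, r; simpl in E; subst; reflexivity.
    + rewrite E. simpl. nia.
  - cbn [hd tl length] in *.
    assert (P : (pos r (Datatypes.S (length l)) + Z.of_nat (stride r) * dz (inward r))%Z
                = pos r (length l)).
    { pose proof (pos_inward r (Datatypes.S (length l)) 0 ltac:(lia)) as P.
      replace (Datatypes.S (length l) - 0 - 1) with (length l) in P by lia. rewrite <- P. lia. }
    assert (V : f (pos r (length l)) = Some b).
    { rewrite (proj1 L), E. simpl. rewrite nth_error_app2; rewrite length_rev; auto.
      now rewrite Nat.sub_diag. }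
    pose proof (layout_pop f s r b l L E) as L'.
    do 2 eexists. split; [|split; [exact L'|]].
    + unfold pop. eapply exec_seqp; [apply exec_to_base|].
      eapply exec_seqp; [apply exec_scan_out; [exact L|rewrite E; simpl; lia]|]. rewrite E.
      cbn [length].
      eapply exec_seqp.
      * apply exec_mvn; auto. rewrite P. apply pos_bounds; lia.
      * rewrite P. eapply exec_bind; [apply exec_nonblank; apply pos_bounds; lia|].
        rewrite V. eapply exec_bind; [apply exec_erase; [apply pos_bounds; lia|exact V]|].
        assert (SI : ex (scan (inward r) (stride r)) (upd f (pos r (length l)) None)
          (pos r (length l)) (upd f (pos r (length l)) None) (base r) false
          ((length l + 1) * (stride r + 2))).
        { eapply exec_scan_in; [exact L'| |lia]. now rewrite get_set_same. }
        assert (S0 : (lo_bound S <= 0 <= hi_bound S)%Z) by (unfold lo_bound, hi_bound; lia).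
        instantiate (1 := (length l + 1) * (stride r + 2) + ((1 + off r) + 1)).
        destruct b; (eapply exec_seqp; [exact SI|]; eapply exec_seqp; [apply exec_to_home|];
          now apply exec_stay).
    + rewrite E. simpl. nia.
Qed.

Lemma exec_test f s r :
  layout f s ->
  exists t, ex (test r) f 0 f 0 (match get r s with [] => false | _ => true end) t /\
    t <= 40 * (S + 2).
Proof.
  intros L. pose proof (stride_le r). pose proof (off_le r).
  assert (P : (base r + Z.of_nat (stride r) * dz (outward r))%Z = pos r 0)
    by (unfold pos; lia).
  pose proof (pos_inward_base r 0) as P'.
  pose proof (pos_bounds r 0 ltac:(lia)) as B.
  exists ((1 + off r) + ((1 + stride r) + (1 + ((1 + stride r) + ((1 + off r) + 1))))).
  split; [|nia].
  unfold test. eapply exec_seqp; [apply exec_to_base|].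
  eapply exec_seqp; [apply exec_mvn; [apply base_bounds|now rewrite P]|].
  rewrite P. eapply exec_bind; [now apply exec_nonblank|].
  assert (M : ex (mvn (inward r) (stride r)) f (pos r 0) f (base r) false (1 + stride r)).
  { replace (base r) with (pos r 0 + Z.of_nat (stride r) * dz (inward r))%Z by lia.
    apply exec_mvn; auto. replace (pos r 0 + _)%Z with (base r) by lia. apply base_bounds. }
  assert (S0 : (lo_bound S <= 0 <= hi_bound S)%Z) by (unfold lo_bound, hi_bound; lia).
  rewrite (proj1 L). destruct (get r s) as [|b l] eqn:E; simpl rev.
  - simpl nth_error. eapply exec_seqp; [exact M|]. eapply exec_seqp; [apply exec_to_home|].
    now apply exec_stay.
  - destruct (nth_error (rev l ++ [b]) 0) eqn:N.
    + eapply exec_seqp; [exact M|]. eapply exec_seqp; [apply exec_to_home|].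
      now apply exec_stay.
    + apply nth_error_None in N. rewrite length_app in N. simpl in N. lia.
Qed.

Lemma sx_exec p s s' b t :
  sx S p s s' b t -> forall f, layout f s ->
  exists f' t', ex (tape_prog p) f 0 f' 0 b t' /\ layout f' s' /\ t' <= t * (40 * (S + 2)).
Proof.
  induction 1; intros f L; cbn [tape_prog].
  - destruct (exec_push f s r b L H) as (f' & t & ? & ? & ?). exists f', t. rewrite Nat.mul_1_l. auto.
  - destruct (exec_pop f s r L H) as (f' & t & ? & ? & ?). exists f', t. rewrite Nat.mul_1_l. auto.
  - destruct (exec_test f s r L) as (t & ? & ?). exists f, t. rewrite Nat.mul_1_l. auto.
  - exists f, 1. split; [|split]; auto; [|lia]. apply exec_stay. unfold lo_bound, hi_bound. lia.
  - destruct (IHsx1 f L) as (f1 & u1 & ? & L1 & ?). destruct (IHsx2 f1 L1) as (f2 & u2 & ? & ? & ?).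
    exists f2, (u1 + u2). split; [|split]; auto; [|lia].
    eapply exec_bind; [eassumption|]. now destruct c.
  - destruct (IHsx f L) as (f1 & u1 & ? & L1 & ?). exists f1, u1. split; [|split]; auto.
    now apply exec_stop.
  - destruct (IHsx1 f L) as (f1 & u1 & ? & L1 & ?). destruct (IHsx2 f1 L1) as (f2 & u2 & ? & ? & ?).
    exists f2, (u1 + u2). split; [|split]; auto; [|lia].
    eapply exec_loop; eassumption.
Qed.
End StackRules.

Lemma layout_input x : layout (input_tape x) (Stacks (rev x) [] [] [] []).
Proof.
  split; intros r; [intros i|]; unfold input_tape, pos, base;
    destruct r; cbn [off outward stride dz get s_io s_m s_a s_b s_c];
    rewrite ?rev_involutive, ?nth_error_nil;
    match goal with |- context [Z.ltb ?z 0] => destruct (Z.ltb_spec z 0) end;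
    (reflexivity || lia || (f_equal; lia)).
Qed.

(** There are [5 * S + 10] cells from [lo_bound S] to [hi_bound S]. The bottom of [IO] is at cell 0,
    so the stack lists a word from its last letter. *)
Lemma stacks_TM_correct p x s' b t S :
  length x <= S ->
  sx S p (Stacks (rev x) [] [] [] []) s' b t ->
  exists t', t' <= t * (40 * (S + 2)) /\
    let c := run (prog_TM (tape_prog p)) t' x in
    halted (prog_TM (tape_prog p)) c /\ output c = rev (s_io s') /\ tape_len c <= 5 * S + 10.
Proof.
  intros HS H. destruct (sx_exec S p _ _ _ _ H _ (layout_input x)) as (f' & t' & E & L & Ht).
  exists t'. split; auto.
  destruct (prog_TM_correct _ (lo_bound S) (hi_bound S) x (rev (s_io s')) _ _ _
    ltac:(unfold lo_bound; lia) ltac:(unfold hi_bound; lia) E) as (H1 & H2 & H3).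
  - intros i. change (s_io s') with (get IO s'). rewrite <- (proj1 L IO i). f_equal. unfold pos, base. cbn [off outward stride dz]. lia.
  - split; [exact H1|split; [exact H2|]]. unfold lo_bound, hi_bound in H3. lia.
Qed.

(** * Trees on a stack *)

(** Since the base [n + 2] is at least 2, constants and sums are absorbed by the exponent.
    Monotonicity is demanded because bounds are composed and applied to estimates of sizes. *)
Definition poly (q : nat -> nat) : Prop :=
  (forall m n, m <= n -> q m <= q n) /\ exists c, forall n, q n <= (n + 2) ^ c.

Lemma pow_ge_1 n c : 1 <= (n + 2) ^ c.
Proof. induction c; simpl; nia. Qed.

Lemma poly_const k : poly (fun _ => k).
Proof.
  split; [auto|]. exists k. intros n.
  pose proof (Nat.pow_gt_lin_r 2 k ltac:(lia)).
  pose proof (Nat.pow_le_mono_l 2 (n + 2) k ltac:(lia)). lia.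
Qed.

Lemma poly_id : poly (fun n => n).
Proof. split; [auto|]. exists 1. intros n. simpl. lia. Qed.

Lemma poly_add p q : poly p -> poly q -> poly (fun n => p n + q n).
Proof.
  intros [Mp [c Hc]] [Mq [d Hd]]. split.
  - intros m n H. specialize (Mp _ _ H). specialize (Mq _ _ H). lia.
  - exists (c + d + 1). intros n. specialize (Hc n). specialize (Hd n).
    pose proof (pow_ge_1 n c). pose proof (pow_ge_1 n d).
    rewrite !Nat.pow_add_r, Nat.pow_1_r. nia.
Qed.

Lemma poly_mul p q : poly p -> poly q -> poly (fun n => p n * q n).
Proof.
  intros [Mp [c Hc]] [Mq [d Hd]]. split.
  - intros m n H. specialize (Mp _ _ H). specialize (Mq _ _ H). nia.
  - exists (c + d). intros n. specialize (Hc n). specialize (Hd n).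
    rewrite !Nat.pow_add_r. nia.
Qed.

Lemma poly_comp p q : poly p -> poly q -> poly (fun n => p (q n)).
Proof.
  intros [Mp [c Hc]] [Mq [d Hd]]. split.
  - intros m n H. auto.
  - exists ((d + 2) * c). intros n. specialize (Hc (q n)). specialize (Hd n).
    rewrite Nat.pow_mul_r. etransitivity; [exact Hc|]. apply Nat.pow_le_mono_l.
    rewrite Nat.pow_add_r. pose proof (pow_ge_1 n d). simpl. nia.
Qed.

Lemma poly_bound q : poly q -> exists a d, forall n, q n <= a * n ^ d + a.
Proof.
  intros [_ [c Hc]]. exists (4 ^ c), c. intros n. etransitivity; [apply Hc|].
  destruct (Nat.le_gt_cases n 2).
  - pose proof (Nat.pow_le_mono_l (n + 2) 4 c ltac:(lia)). lia.
  - pose proof (Nat.pow_le_mono_l (n + 2) (4 * n) c ltac:(lia)) as P.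
    rewrite Nat.pow_mul_l in P. lia.
Qed.

Ltac solve_poly :=
  repeat first [ assumption | apply poly_const | apply poly_id
               | apply poly_add | apply poly_mul
               | match goal with H : poly ?q |- poly (fun n => ?q _) =>
                   apply (poly_comp q _ H) end ].

Inductive tree := Lf | Nd (l r : tree).

Fixpoint bits (t : tree) : list bool :=
  match t with Lf => [false] | Nd l r => true :: bits l ++ bits r end.

Definition tsize (t : tree) : nat := length (bits t).

Lemma tsize_pos t : 1 <= tsize t.
Proof. destruct t; unfold tsize; simpl; lia. Qed.

Lemma tsize_Nd l r : tsize (Nd l r) = 1 + tsize l + tsize r.
Proof. unfold tsize. simpl. rewrite length_app. lia. Qed.

Definition sseq (p q : sp) : sp := SBind p q q.

Lemma sx_sseq S p q s s1 c t1 s2 b t2 :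
  sx S p s s1 c t1 -> sx S q s1 s2 b t2 -> sx S (sseq p q) s s2 b (t1 + t2).
Proof. intros H1 H2. eapply sx_bind; [exact H1|]. now destruct c. Qed.

Lemma sx_mono S S' p s s' b t : sx S p s s' b t -> S <= S' -> sx S' p s s' b t.
Proof.
  intros H HS. induction H.
  - apply sx_push; lia.
  - apply sx_pop; lia.
  - apply sx_tst; lia.
  - apply sx_ret; lia.
  - eapply sx_bind; eauto.
  - now apply sx_stop.
  - eapply sx_loop; eauto.
Qed.

Lemma ssize_tl r s : ssize (set r (tl (get r s)) s) <= ssize s.
Proof.
  destruct s as [i m a b c], r; unfold ssize; simpl;
    match goal with |- context [tl ?l] => destruct l; simpl; lia end.
Qed.

Lemma sx_ssize S p s s' b t : sx S p s s' b t -> ssize s' <= S.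
Proof.
  induction 1; auto. etransitivity; [apply ssize_tl|assumption].
Qed.

Ltac size := unfold ssize, tsize in *; simpl in *;
  rewrite ?length_app, ?length_rev in *; simpl in *;
  rewrite ?length_app, ?length_rev in *; simpl in *; lia.

Lemma sx_push' S r b s s' :
  s' = set r (b :: get r s) s -> ssize s' <= S -> sx S (SPush r b) s s' false 1.
Proof. intros -> H. now apply sx_push. Qed.

Lemma sx_pop' S r s s' b :
  s' = set r (tl (get r s)) s -> b = hd false (get r s) -> ssize s <= S ->
  sx S (SPop r) s s' b 1.
Proof. intros -> -> H. now apply sx_pop. Qed.

Lemma sx_tst' S r s b :
  b = (match get r s with [] => false | _ => true end) -> ssize s <= S ->
  sx S (STst r) s s b 1.
Proof. intros -> H. now apply sx_tst. Qed.

Ltac sx_prim :=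
  cbv iota;
  first [ eapply sx_push'; [simpl; reflexivity|size]
        | eapply sx_pop'; [simpl; reflexivity|simpl; reflexivity|size]
        | eapply sx_tst'; [simpl; reflexivity|size]
        | apply sx_ret; size ].

Ltac sx_branch := cbv iota; eapply sx_bind; [sx_prim|]; cbv iota.
Ltac sx_then := cbv iota; eapply sx_sseq; [sx_prim|]; cbv iota.

(* [RC] counts in unary the subtrees still to be read. *)
Definition take_tree (d : reg) : sp :=
  sseq (SPush RC true)
    (SLoop (SBind (STst RC) (SRet false)
      (SBind (SPop RM)
        (sseq (SPop RC) (sseq (SPush d false) (SRet true)))
        (sseq (SPush RC true) (sseq (SPush d true) (SRet true)))))).

(** Lets the targets [RA] and [RB] of [take_tree] share one proof: [l] is the content of the target,
    [o] that of the other stack. *)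
Definition two (d : bool) io m l o c : stacks :=
  if d then Stacks io m l o c else Stacks io m o l c.

(** Stated with an arbitrary continuation of the loop, so that reading the right subtree can be the
    continuation of reading the left one. A leaf removes one mark from the counter [RC], a node adds
    one. *)
Lemma take_loop S (d : bool) v : forall io m l o c s' b t,
  length io + length m + length l + length o + length c + 3 * tsize v + 3 <= S ->
  let P := SLoop (SBind (STst RC) (SRet false)
      (SBind (SPop RM)
        (sseq (SPop RC) (sseq (SPush (if d then RA else RB) false) (SRet true)))
        (sseq (SPush RC true) (sseq (SPush (if d then RA else RB) true) (SRet true))))) in
  sx S P (two d io m (rev (bits v) ++ l) o c) s' b t ->
  sx S P (two d io (bits v ++ m) l o (true :: c)) s' b (5 * tsize v + t).
Proof.
  induction v as [|v1 IH1 v2 IH2]; intros io m l o c s' b t HS P H.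
  - apply sx_loop with (s1 := two d io m (false :: l) o c) (t1 := 5); [|exact H].
    change 5 with (1 + (1 + (1 + (1 + 1)))).
    destruct d; sx_branch; sx_branch; sx_then; sx_then; sx_prim.
  - rewrite tsize_Nd in *.
    replace (5 * (1 + tsize v1 + tsize v2) + t)
      with (5 + (5 * tsize v1 + (5 * tsize v2 + t))) by lia.
    apply sx_loop with (s1 := two d io (bits v1 ++ bits v2 ++ m) (true :: l) o (true :: true :: c)).
    + change 5 with (1 + (1 + (1 + (1 + 1)))).
      destruct d; sx_branch; sx_branch; sx_then;
        (eapply sx_sseq; [eapply sx_push'; [simpl; rewrite <- app_assoc; reflexivity|size]|]; sx_prim).
    + apply IH1; [size|]. apply IH2; [size|].
      simpl in H. rewrite rev_app_distr, <- !app_assoc in H. exact H.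
Qed.

Lemma sx_take S (d : bool) v io m o :
  length io + length m + length o + 4 * tsize v + 10 <= S ->
  sx S (take_tree (if d then RA else RB)) (two d io (bits v ++ m) [] o [])
       (two d io m (rev (bits v)) o []) false (1 + (5 * tsize v + 2)).
Proof.
  intros HS. pose proof (tsize_pos v).
  destruct d; sx_then; (eapply (take_loop S true) || eapply (take_loop S false)); try size;
    simpl; rewrite app_nil_r; apply sx_stop; change 2 with (1 + 1); sx_branch; sx_prim.
Qed.

Definition move_all (src : reg) (push : bool -> sp) : sp :=
  SLoop (SBind (STst src) (SRet false)
    (SBind (SPop src) (sseq (push false) (SRet true)) (sseq (push true) (SRet true)))).

Definition a_to_m := move_all RA (SPush RM).
Definition b_to_m := move_all RB (SPush RM).
Definition b_to_a := move_all RB (SPush RA).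
Definition a_to_mb := move_all RA (fun b => sseq (SPush RM b) (SPush RB b)).
Definition clear_a := move_all RA SRet.

Ltac sx_done :=
  apply sx_stop;
  match goal with |- sx ?S ?p ?s ?s' ?b _ => change (sx S p s s' b (1 + 1)) end;
  sx_branch; sx_prim.

Ltac sx_move l next :=
  induction l as [|x l IH]; intros m b c HS; [sx_done|];
  replace (4 * length (x :: l) + 2) with ((1 + (1 + (1 + 1))) + (4 * length l + 2)) by (simpl; lia);
  let mid := eval cbv beta in (next x m l b c) in
  eapply sx_loop with (s1 := mid); [sx_branch; sx_branch; destruct x; sx_then; sx_prim|];
  simpl rev; rewrite <- ?app_assoc; apply IH; size.

Lemma sx_a_to_m S io l : forall m b c,
  length io + length m + length l + length b + length c <= S ->
  sx S a_to_m (Stacks io m l b c) (Stacks io (rev l ++ m) [] b c) false (4 * length l + 2).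
Proof. sx_move l (fun (x : bool) m l b c => Stacks io (x :: m) l b c). Qed.

Lemma sx_b_to_m S io l : forall m a c,
  length io + length m + length l + length a + length c <= S ->
  sx S b_to_m (Stacks io m a l c) (Stacks io (rev l ++ m) a [] c) false (4 * length l + 2).
Proof. sx_move l (fun (x : bool) m l b c => Stacks io (x :: m) b l c). Qed.

Lemma sx_b_to_a S io l : forall m a c,
  length io + length m + length l + length a + length c <= S ->
  sx S b_to_a (Stacks io m a l c) (Stacks io m (rev l ++ a) [] c) false (4 * length l + 2).
Proof. sx_move l (fun (x : bool) m l b c => Stacks io m (x :: b) l c). Qed.

Lemma sx_a_to_mb S io l : forall m b c,
  length io + length m + 2 * length l + length b + length c <= S ->
  sx S a_to_mb (Stacks io m l b c) (Stacks io (rev l ++ m) [] (rev l ++ b) c) false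
     (5 * length l + 2).
Proof.
  induction l as [|x l IH]; intros m b c HS; [sx_done|].
  replace (5 * length (x :: l) + 2)
    with ((1 + (1 + ((1 + 1) + 1))) + (5 * length l + 2)) by (simpl; lia).
  eapply sx_loop with (s1 := Stacks io (x :: m) l (x :: b) c).
  - sx_branch. sx_branch.
    destruct x; (eapply sx_sseq; [sx_then; sx_prim|]; sx_prim).
  - simpl rev. rewrite <- !app_assoc. apply IH. size.
Qed.

Lemma sx_clear_a S io l : forall m b c,
  length io + length m + length l + length b + length c <= S ->
  sx S clear_a (Stacks io m l b c) (Stacks io m [] b c) false (4 * length l + 2).
Proof. sx_move l (fun (x : bool) m l b c => Stacks io m l b c). Qed.

Definition values (io m : list bool) : stacks := Stacks io m [] [] [].

(** Every transfer between stacks reverses its content. [take_tree] leaves a tree reversed, so one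
    transfer to [RM] restores it; the second copy made by [dup] arrives on [RB] in the right order
    and needs the detour through [RA]. *)
Definition dup : sp := sseq (take_tree RA) (sseq a_to_mb (sseq b_to_a a_to_m)).
Definition swap : sp := sseq (take_tree RA) (sseq (take_tree RB) (sseq a_to_m b_to_m)).
Definition drop : sp := sseq (take_tree RA) clear_a.

Lemma sx_dup S io v m :
  length io + length m + 10 * tsize v + 10 <= S ->
  exists t, sx S dup (values io (bits v ++ m)) (values io (bits v ++ bits v ++ m)) false t /\
    t <= 30 * tsize v.
Proof.
  intros HS. pose proof (tsize_pos v). eexists. split.
  - eapply sx_sseq; [apply (sx_take S true v io m []); simpl; lia|]. simpl two.
    eapply sx_sseq; [apply sx_a_to_mb; size|].
    rewrite rev_involutive, app_nil_r.
    eapply sx_sseq; [apply sx_b_to_a; size|]. rewrite app_nil_r.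
    pose proof (sx_a_to_m S io (rev (bits v)) (bits v ++ m) [] []) as E.
    rewrite rev_involutive in E. apply E. size.
  - rewrite !length_rev. fold (tsize v). lia.
Qed.

Lemma sx_swap S io v w m :
  length io + length m + 10 * tsize v + 10 * tsize w + 10 <= S ->
  exists t, sx S swap (values io (bits v ++ bits w ++ m)) (values io (bits w ++ bits v ++ m)) false t /\
    t <= 30 * (tsize v + tsize w).
Proof.
  intros HS. pose proof (tsize_pos v). pose proof (tsize_pos w). eexists. split.
  - eapply sx_sseq; [apply (sx_take S true v io (bits w ++ m) []); size|]. simpl two.
    eapply sx_sseq; [apply (sx_take S false w io m (rev (bits v))); size|]. simpl two.
    eapply sx_sseq; [apply sx_a_to_m; size|].
    pose proof (sx_b_to_m S io (rev (bits w)) (bits v ++ m) [] []) as E.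
    rewrite !rev_involutive in *. apply E. size.
  - rewrite !length_rev. fold (tsize v) (tsize w). lia.
Qed.

Lemma sx_drop S io v m :
  length io + length m + 10 * tsize v + 10 <= S ->
  exists t, sx S drop (values io (bits v ++ m)) (values io m) false t /\ t <= 30 * tsize v.
Proof.
  intros HS. pose proof (tsize_pos v). eexists. split.
  - eapply sx_sseq; [apply (sx_take S true v io m []); simpl; lia|]. simpl two.
    apply sx_clear_a; size.
  - rewrite !length_rev. fold (tsize v). lia.
Qed.

(** * Polynomial bounds and combinators *)

(* On the indices satisfying [D], some program turns the tree [i x] on top of the stack
   into [o x], in polynomial space and, if [m = true], also in polynomial time. *)
Definition computes (m : bool) {I} (D : I -> Prop) (i o : I -> tree) : Prop :=
  exists p q, poly q /\ forall x, D x -> forall io rest, exists t b,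
    sx (length io + length rest + q (tsize (i x))) p
       (values io (bits (i x) ++ rest)) (values io (bits (o x) ++ rest)) b t /\
    (m = true -> t <= q (tsize (i x))).

Section Combinators.
Context {m : bool}.

(** The output lies on the stack at the end, so the space bound also bounds its size. Without such a
    bound neither programs nor their estimates could be composed. *)
Lemma computes_size {I} (D : I -> Prop) i o :
  computes m D i o ->
  exists q, poly q /\ forall x, D x -> tsize (o x) <= q (tsize (i x)).
Proof.
  intros (p & q & Hq & H). exists q. split; auto. intros x Dx.
  destruct (H x Dx [] []) as (t & b & E & _). apply sx_ssize in E. size.
Qed.

Lemma computes_weaken {I J} (D : I -> Prop) (E : J -> Prop) i o i' o' :
  computes m D i o ->
  (forall y, E y -> exists x, D x /\ i' y = i x /\ o' y = o x) ->
  computes m E i' o'.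
Proof.
  intros (p & q & Hq & H) HE. exists p, q. split; auto. intros y Ey.
  destruct (HE y Ey) as (x & Dx & -> & ->). auto.
Qed.

Lemma computes_id {I} (D : I -> Prop) i : computes m D i i.
Proof.
  exists (SRet false), (fun n => n + 1). split; [solve_poly|]. intros x _ io rest. exists 1, false. split.
  - apply sx_ret. size.
  - lia.
Qed.

Lemma computes_comp {I J} (D : I -> Prop) (E : J -> Prop) i o j k r :
  computes m D i o -> computes m E j k ->
  (forall x, D x -> exists y, E y /\ o x = j y /\ r x = k y) ->
  computes m D i r.
Proof.
  intros Ho (p2 & q2 & Hq2 & H2) HE.
  destruct (computes_size _ _ _ Ho) as (q0 & Hq0 & H0).
  destruct Ho as (p1 & q1 & Hq1 & H1).
  exists (sseq p1 p2), (fun n => q1 n + q2 (q0 n)). split; [solve_poly|].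
  intros x Dx io rest. destruct (H1 x Dx io rest) as (t1 & b1 & E1 & T1).
  destruct (HE x Dx) as (y & Ey & Eo & Er).
  destruct (H2 y Ey io rest) as (t2 & b2 & E2 & T2).
  specialize (H0 x Dx). rewrite Eo in *.
  pose proof (proj1 Hq2 _ _ H0) as M. rewrite Er.
  exists (t1 + t2), b2. split.
  - eapply sx_sseq; eapply sx_mono; eauto; lia.
  - intros Hm. specialize (T1 Hm). specialize (T2 Hm). lia.
Qed.

Lemma computes_pair {I} (D : I -> Prop) i o1 o2 :
  computes m D i o1 -> computes m D i o2 -> computes m D i (fun x => Nd (o1 x) (o2 x)).
Proof.
  intros Ho1 Ho2.
  destruct (computes_size _ _ _ Ho1) as (r1 & Hr1 & R1).
  destruct (computes_size _ _ _ Ho2) as (r2 & Hr2 & R2).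
  destruct Ho1 as (p1 & q1 & Hq1 & H1). destruct Ho2 as (p2 & q2 & Hq2 & H2).
  exists (sseq dup (sseq p1 (sseq swap (sseq p2 (sseq swap (SPush RM true)))))).
  exists (fun n => 100 * (n + q1 n + q2 n + r1 n + r2 n) + 100). split; [solve_poly|].
  intros x Dx io rest. cbv beta.
  destruct (H1 x Dx io (bits (i x) ++ rest)) as (t1 & b1 & E1 & T1).
  destruct (H2 x Dx io (bits (o1 x) ++ rest)) as (t2 & b2 & E2 & T2).
  specialize (R1 x Dx). specialize (R2 x Dx). rewrite length_app in E1, E2.
  fold (tsize (i x)) in E1. fold (tsize (o1 x)) in E2.
  set (n := tsize (i x)) in *.
  set (S := length io + length rest + _).
  destruct (sx_dup S io (i x) rest) as (td & Ed & Td); [subst S; fold n; lia|].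
  destruct (sx_swap S io (o1 x) (i x) rest) as (ts & Es & Ts); [subst S; fold n; lia|].
  destruct (sx_swap S io (o2 x) (o1 x) rest) as (tz & Ez & Tz); [subst S; lia|].
  fold n in Td, Ts.
  exists (td + (t1 + (ts + (t2 + (tz + 1))))), false. split.
  - eapply sx_sseq; [exact Ed|].
    eapply sx_sseq; [eapply sx_mono; [exact E1|subst S; lia]|].
    eapply sx_sseq; [exact Es|].
    eapply sx_sseq; [eapply sx_mono; [exact E2|subst S; lia]|].
    eapply sx_sseq; [exact Ez|].
    eapply sx_push'; [unfold values; simpl; rewrite <- app_assoc; reflexivity|].
    subst S. unfold values, ssize. simpl. rewrite !length_app.
    fold (tsize (o1 x)) (tsize (o2 x)). lia.
  - intros Hm. specialize (T1 Hm). specialize (T2 Hm). lia.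
Qed.

Lemma computes_proj (pr : tree -> tree -> tree) p {I} (D : I -> Prop) i o1 o2 :
  (forall S io l r rest, length io + length rest + 100 * (tsize l + tsize r) <= S -> exists t,
    sx S p (values io (bits l ++ bits r ++ rest)) (values io (bits (pr l r) ++ rest)) false t /\
    t <= 60 * (tsize l + tsize r)) ->
  computes m D i (fun x => Nd (o1 x) (o2 x)) -> computes m D i (fun x => pr (o1 x) (o2 x)).
Proof.
  intros Hp H. refine (computes_comp D D i _ (fun x => Nd (o1 x) (o2 x)) (fun x => pr (o1 x) (o2 x)) _ H _ _).
  2: { intros x Dx. exists x. auto. }
  exists (sseq (SPop RM) p), (fun n => 100 * n + 100). split; [solve_poly|].
  intros x Dx io rest. rewrite tsize_Nd. set (S := length io + length rest + _).
  destruct (Hp S io (o1 x) (o2 x) rest) as (t & E & T); [subst S; lia|].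
  exists (1 + t), false. split; [|lia]. eapply sx_sseq.
  - eapply sx_pop'; [simpl; reflexivity|reflexivity|].
    subst S. unfold values, ssize. simpl. rewrite !length_app.
    fold (tsize (o1 x)) (tsize (o2 x)). lia.
  - rewrite <- app_assoc. exact E.
Qed.

Lemma computes_fst {I} (D : I -> Prop) i o1 o2 :
  computes m D i (fun x => Nd (o1 x) (o2 x)) -> computes m D i o1.
Proof.
  apply (computes_proj (fun l _ => l) (sseq swap drop)). intros S io l r rest HS.
  pose proof (tsize_pos l). pose proof (tsize_pos r).
  destruct (sx_swap S io l r rest) as (ts & Es & Ts); [lia|].
  destruct (sx_drop S io r (bits l ++ rest)) as (td & Ed & Td).
  { rewrite length_app. fold (tsize l). lia. }
  exists (ts + td). split; [|lia]. eapply sx_sseq; [exact Es|exact Ed].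
Qed.

Lemma computes_snd {I} (D : I -> Prop) i o1 o2 :
  computes m D i (fun x => Nd (o1 x) (o2 x)) -> computes m D i o2.
Proof.
  apply (computes_proj (fun _ r => r) drop). intros S io l r rest HS.
  pose proof (tsize_pos l). pose proof (tsize_pos r).
  destruct (sx_drop S io l (bits r ++ rest)) as (td & Ed & Td).
  { rewrite length_app. fold (tsize r). lia. }
  exists td. split; [exact Ed|lia].
Qed.

Fixpoint push_all (l : list bool) : sp :=
  match l with [] => SRet false | b :: l => sseq (push_all l) (SPush RM b) end.

Lemma sx_push_all S io l rest :
  length io + length l + length rest <= S ->
  sx S (push_all l) (values io rest) (values io (l ++ rest)) false (length l + 1).
Proof.
  induction l as [|b l IH]; intros HS.
  - apply sx_ret. size.
  - replace (length (b :: l) + 1) with ((length l + 1) + 1) by (simpl; lia).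
    eapply sx_sseq; [apply IH; simpl in HS; lia|]. eapply sx_push'; [reflexivity|size].
Qed.

Lemma computes_const {I} (D : I -> Prop) i c : computes m D i (fun _ => c).
Proof.
  exists (sseq drop (push_all (bits c))), (fun n => 30 * n + (tsize c + 10)). split; [solve_poly|].
  intros x _ io rest. set (S := length io + length rest + _).
  destruct (sx_drop S io (i x) rest) as (td & Ed & Td); [subst S; lia|].
  exists (td + (length (bits c) + 1)), false. split.
  - eapply sx_sseq; [exact Ed|]. apply sx_push_all. subst S. unfold tsize. lia.
  - unfold tsize in *. lia.
Qed.

Definition tbool (b : bool) : tree := if b then Nd Lf Lf else Lf.

(** The leading bit of the code of a Boolean is the Boolean itself; for [true] two more bits have to
    be removed. *)
Definition branch (p0 p1 : sp) : sp :=
  SBind (SPop RM) p0 (sseq (SPop RM) (sseq (SPop RM) p1)).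

Lemma sx_branch_tbool S io rest (b : bool) p0 p1 s' b' t :
  length io + length rest + 3 <= S ->
  sx S (if b then p1 else p0) (values io rest) s' b' t ->
  sx S (branch p0 p1) (values io (bits (tbool b) ++ rest)) s' b' (if b then 3 + t else 1 + t).
Proof.
  intros HS H. destruct b.
  - change (3 + t) with (1 + (1 + (1 + t))).
    eapply sx_bind; [eapply sx_pop'; [simpl; reflexivity|simpl; reflexivity|size]|]. cbv iota.
    eapply sx_sseq; [eapply sx_pop'; [simpl; reflexivity|simpl; reflexivity|size]|].
    eapply sx_sseq; [eapply sx_pop'; [simpl; reflexivity|simpl; reflexivity|size]|]. exact H.
  - eapply sx_bind; [eapply sx_pop'; [reflexivity|reflexivity|size]|]. exact H.
Qed.

(** The purpose of the domain [D]: each branch has to be correct only where its test succeeds, so it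
    may rely on the shape of the code. *)
Lemma computes_if {I} (D : I -> Prop) i (c : I -> bool) o :
  computes m D i (fun x => tbool (c x)) ->
  computes m (fun x => D x /\ c x = true) i o ->
  computes m (fun x => D x /\ c x = false) i o ->
  computes m D i o.
Proof.
  intros (pc & qc & Hqc & Hc) (p1 & q1 & Hq1 & H1) (p0 & q0 & Hq0 & H0).
  exists (sseq dup (sseq pc (branch p0 p1))), (fun n => 50 * n + 50 + qc n + q1 n + q0 n).
  split; [solve_poly|]. intros x Dx io rest. cbv beta.
  destruct (Hc x Dx io (bits (i x) ++ rest)) as (tc & bc & Ec & Tc).
  rewrite length_app in Ec. fold (tsize (i x)) in Ec. pose proof (tsize_pos (i x)).
  set (n := tsize (i x)) in *.
  set (S := length io + length rest + _).
  destruct (sx_dup S io (i x) rest) as (td & Ed & Td); [subst S; fold n; lia|]. fold n in Td.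
  assert (B : exists t b, sx S (if c x then p1 else p0) (values io (bits (i x) ++ rest))
    (values io (bits (o x) ++ rest)) b t /\ (m = true -> t <= q1 n + q0 n)).
  { destruct (c x) eqn:Ex.
    - destruct (H1 x (conj Dx Ex) io rest) as (t & b & E & T). exists t, b. split.
      + eapply sx_mono; [exact E|]. subst S. fold n. lia.
      + intros Hm. specialize (T Hm). fold n in T. lia.
    - destruct (H0 x (conj Dx Ex) io rest) as (t & b & E & T). exists t, b. split.
      + eapply sx_mono; [exact E|]. subst S. fold n. lia.
      + intros Hm. specialize (T Hm). fold n in T. lia. }
  destruct B as (t & b & E & T).
  exists (td + (tc + (if c x then 3 + t else 1 + t))), b. split.
  - eapply sx_sseq; [exact Ed|]. eapply sx_sseq; [eapply sx_mono; [exact Ec|subst S; lia]|].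
    apply sx_branch_tbool; [|exact E].
    subst S. rewrite length_app. fold (tsize (i x)). fold n. lia.
  - intros Hm. specialize (T Hm). specialize (Tc Hm). destruct (c x); lia.
Qed.

(** The number of rounds [k] is not computed, the test [c] ends the loop. Sizes need to be bounded
    only along the actual orbit. All rounds work in the same space, so [k] enters the time bound
    alone. *)
Lemma computes_while {I X} (D : I -> Prop) (i : I -> tree) (e : X -> tree)
    (c : X -> bool) (f : X -> X) (s : I -> X) (k : I -> nat) (Q N : nat -> nat) :
  computes m D i (fun x => e (s x)) ->
  computes m (fun _ => True) e (fun y => tbool (c y)) ->
  computes m (fun _ => True) e (fun y => e (f y)) ->
  poly Q -> poly N ->
  (forall x j, D x -> j < k x -> c (Nat.iter j f (s x)) = true) ->
  (forall x, D x -> c (Nat.iter (k x) f (s x)) = false) ->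
  (forall x j, D x -> j <= k x -> tsize (e (Nat.iter j f (s x))) <= Q (tsize (i x))) ->
  (m = true -> forall x, D x -> k x <= N (tsize (i x))) ->
  computes m D i (fun x => e (Nat.iter (k x) f (s x))).
Proof.
  intros Hs (pc & qc & Hqc & Hc) (pf & qf & Hqf & Hf) HQ HN Ctrue Cfalse CQ CN.
  destruct Hs as (ps & qs & Hqs & Hs).
  set (body := sseq dup (sseq pc (branch (SRet false) (sseq pf (SRet true))))).
  exists (sseq ps (SLoop body)).
  exists (fun n => qs n + (N n + 1) * (50 * Q n + 50 + qc (Q n) + qf (Q n))). split; [solve_poly|].
  intros x Dx io rest. cbv beta. set (n := tsize (i x)).
  destruct (Hs x Dx io rest) as (ts & bs & Es & Ts). fold n in Es, Ts.
  set (W := 50 * Q n + 50 + qc (Q n) + qf (Q n)).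
  set (S := length io + length rest + _).
  assert (HS : length io + length rest + W <= S) by (subst S; nia).
  assert (STEP : forall j, j <= k x ->
    exists t, sx S body (values io (bits (e (Nat.iter j f (s x))) ++ rest))
      (values io (bits (e (if c (Nat.iter j f (s x)) then Nat.iter (1 + j) f (s x)
                           else Nat.iter j f (s x))) ++ rest)) (c (Nat.iter j f (s x))) t /\
      (m = true -> t <= W)).
  { intros j Hj. specialize (CQ x j Dx Hj). fold n in CQ.
    set (y := Nat.iter j f (s x)) in *.
    pose proof (proj1 Hqc _ _ CQ). pose proof (proj1 Hqf _ _ CQ). pose proof (tsize_pos (e y)).
    destruct (Hc y Logic.I io (bits (e y) ++ rest)) as (tc & bc & Ec & Tc).
    destruct (Hf y Logic.I io rest) as (tf & bf & Ef & Tf).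
    rewrite length_app in Ec. fold (tsize (e y)) in Ec.
    destruct (sx_dup S io (e y) rest) as (td & Ed & Td); [lia|].
    exists (td + (tc + (if c y then 3 + (tf + 1) else 1 + 1))). split.
    - eapply sx_sseq; [exact Ed|].
      eapply sx_sseq; [eapply sx_mono; [exact Ec|lia]|].
      destruct (c y) eqn:Ey.
      + apply (sx_branch_tbool S io (bits (e y) ++ rest) true).
        * rewrite length_app. fold (tsize (e y)). lia.
        * simpl Nat.iter. fold y. eapply sx_sseq; [eapply sx_mono; [exact Ef|lia]|].
          apply sx_ret. apply sx_ssize in Ef. lia.
      + apply (sx_branch_tbool S io (bits (e y) ++ rest) false).
        * rewrite length_app. fold (tsize (e y)). lia.
        * apply sx_ret. size.
    - intros Hm. specialize (Tc Hm). specialize (Tf Hm). destruct (c y); lia. }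
  assert (LOOP : forall d j, j + d = k x ->
    exists t, sx S (SLoop body) (values io (bits (e (Nat.iter j f (s x))) ++ rest))
      (values io (bits (e (Nat.iter (k x) f (s x))) ++ rest)) false t /\
      (m = true -> t <= (d + 1) * W)).
  { induction d; intros j Hj.
    - rewrite Nat.add_0_r in Hj. subst j. destruct (STEP (k x) ltac:(lia)) as (t & E & T).
      rewrite (Cfalse x Dx) in E. exists t. split; [now apply sx_stop|]. intros Hm.
      specialize (T Hm). lia.
    - destruct (STEP j ltac:(lia)) as (t & E & T). rewrite (Ctrue x j Dx ltac:(lia)) in E.
      destruct (IHd (1 + j) ltac:(lia)) as (t' & E' & T'). exists (t + t'). split.
      + eapply sx_loop; [exact E|exact E'].
      + intros Hm. specialize (T Hm). specialize (T' Hm). lia. }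
  destruct (LOOP (k x) 0 ltac:(lia)) as (t & E & T).
  exists (ts + t), false. split.
  - eapply sx_sseq; [eapply sx_mono; [exact Es|subst S; lia]|exact E].
  - intros Hm. specialize (T Hm). specialize (Ts Hm). specialize (CN Hm x Dx). fold n in CN. nia.
Qed.
End Combinators.

(** * Encoded types *)

Structure encType := EncType { carrier :> Type; enc : carrier -> tree }.
Arguments enc {e} x.

Definition enc_list {X : encType} : list X -> tree :=
  fix f l := match l with [] => Lf | x :: l => Nd (enc x) (f l) end.

Definition enc_prod {X Y : encType} (p : X * Y) : tree := Nd (enc (fst p)) (enc (snd p)).

Canonical bool_encType := EncType bool tbool.
Canonical prod_encType (X Y : encType) :=
  EncType (X * Y) enc_prod.
Canonical list_encType (X : encType) := EncType (list X) enc_list.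
Definition sz {X : encType} (x : X) : nat := tsize (enc x).
Arguments sz {X} x : simpl never.

Definition CF (m : bool) {X Y : encType} (f : X -> Y) : Prop :=
  computes m (fun _ => True) enc (fun x => enc (f x)).

(** The way back to [computes] after [CF] has been made opaque. *)
Lemma CF_computes m {X Y : encType} (f : X -> Y) :
  CF m f <-> computes m (fun _ => True) enc (fun x => enc (f x)).
Proof. reflexivity. Qed.

Lemma sz_pos {X : encType} (x : X) : 1 <= sz x.
Proof. apply tsize_pos. Qed.

Lemma sz_pair {X Y : encType} (x : X) (y : Y) : sz (x, y) = 1 + sz x + sz y.
Proof. exact (tsize_Nd _ _). Qed.

Lemma sz_nil (X : encType) : sz (@nil X) = 1.
Proof. reflexivity. Qed.

Lemma sz_cons {X : encType} (x : X) l : sz (x :: l) = 1 + sz x + sz l.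
Proof. exact (tsize_Nd _ _). Qed.

Lemma sz_bool (b : bool) : sz b <= 3.
Proof. destruct b; unfold sz, tsize; simpl; lia. Qed.

Lemma sz_enc {X : encType} (x : X) : sz x = tsize (enc x).
Proof. reflexivity. Qed.

#[global] Opaque sz.

Ltac sz_simpl :=
  repeat match goal with
  | |- context [@sz (list_encType ?X) (@nil ?A)] =>
      let E := fresh in
      assert (E : @sz (list_encType X) (@nil A) = 1) by exact (sz_nil X); rewrite E; clear E
  | |- context [@sz (list_encType ?X) (@cons ?A ?a ?l)] =>
      let E := fresh in
      assert (E : @sz (list_encType X) (@cons A a l) = 1 + sz (X := X) a + sz (X := list_encType X) l)
        by exact (sz_cons a l);
      rewrite E; clear E
  | |- context [@sz (prod_encType ?X ?Y) (@pair ?A ?B ?a ?b)] =>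
      let E := fresh in
      assert (E : @sz (prod_encType X Y) (@pair A B a b) = 1 + sz (X := X) a + sz (X := Y) b)
        by exact (sz_pair a b);
      rewrite E; clear E
  end.

Lemma sz_app {X : encType} (l1 l2 : list X) : sz (l1 ++ l2) + 1 = sz l1 + sz l2.
Proof.
  induction l1 as [|x l1 IH]; cbn [app]; [rewrite (sz_nil X); lia|]. rewrite !sz_cons. lia.
Qed.

Lemma sz_length {X : encType} (l : list X) : length l <= sz l.
Proof. induction l; cbn [length]; [lia|]. rewrite sz_cons. lia. Qed.

Section Functions.
Context {m : bool}.
Local Notation CF := (CF m).

Lemma CF_ext {X Y : encType} (f g : X -> Y) :
  (forall x, f x = g x) -> CF f -> CF g.
Proof.
  intros E C. eapply computes_weaken; [exact C|]. intros y _. exists y. now rewrite E.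
Qed.

(** Functions into different types are realized by the same program if their values have the same
    code. Thus [nbits], [op_code] and the constructors of labels cost nothing. *)
Lemma CF_coerce {X Y Z : encType} (f : X -> Y) (g : X -> Z) :
  (forall x, enc (g x) = enc (f x)) -> CF f -> CF g.
Proof.
  intros E C. eapply computes_weaken; [exact C|]. intros y _. exists y. now rewrite E.
Qed.

Lemma CF_size {X Y : encType} (f : X -> Y) :
  CF f -> exists q, poly q /\ forall x, sz (f x) <= q (sz x).
Proof.
  intros C. destruct (computes_size _ _ _ C) as (q & Hq & Q).
  exists q. split; auto. intros x. exact (Q x Logic.I).
Qed.

Lemma CF_id {X : encType} : CF (fun x : X => x).
Proof. apply computes_id. Qed.

Lemma CF_const {X Y : encType} (y : Y) : CF (fun _ : X => y).
Proof. exact (computes_const _ _ (enc y)). Qed.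

Lemma CF_comp {X Y Z : encType} (g : Y -> Z) (f : X -> Y) :
  CF g -> CF f -> CF (fun x => g (f x)).
Proof.
  intros G F. eapply computes_comp; [exact F|exact G|]. intros x _. exists (f x). auto.
Qed.

Lemma CF_pair {X Y Z : encType} (f : X -> Y) (g : X -> Z) :
  CF f -> CF g -> CF (fun x => (f x, g x)).
Proof. exact (computes_pair _ _ _ _). Qed.

Lemma CF_comp2 {X Y Z T : encType} (h : Y -> Z -> T)
    (f : X -> Y) (g : X -> Z) :
  CF (fun p => h (fst p) (snd p)) -> CF f -> CF g -> CF (fun x => h (f x) (g x)).
Proof. intros Hh Hf Hg. exact (CF_comp _ _ Hh (CF_pair _ _ Hf Hg)). Qed.

Lemma CF_fst {X Y Z : encType} (f : X -> Y * Z) :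
  CF f -> CF (fun x => fst (f x)).
Proof. exact (computes_fst _ _ _ (fun x => enc (snd (f x)))). Qed.

Lemma CF_snd {X Y Z : encType} (f : X -> Y * Z) :
  CF f -> CF (fun x => snd (f x)).
Proof. exact (computes_snd _ _ (fun x => enc (fst (f x))) _). Qed.

Lemma CF_if {X Y : encType} (c : X -> bool) (f g : X -> Y) :
  CF c -> CF f -> CF g -> CF (fun x => if c x then f x else g x).
Proof.
  intros C F G. apply computes_if with (c := c); [exact C| |].
  - eapply computes_weaken; [exact F|]. intros y [_ E]. exists y. now rewrite E.
  - eapply computes_weaken; [exact G|]. intros y [_ E]. exists y. now rewrite E.
Qed.

Definition is_node (t : tree) : bool := match t with Lf => false | _ => true end.

Lemma computes_is_node {I} (D : I -> Prop) i o :
  computes m D i o -> computes m D i (fun x => tbool (is_node (o x))).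
Proof.
  intros Ho. eapply computes_comp with (E := fun _ => True) (j := fun t => t)
    (k := fun t => tbool (is_node t)); [exact Ho| |intros x _; now exists (o x)].
  exists (SBind (SPop RM) (SPush RM false)
    (sseq drop (sseq drop (push_all (bits (tbool true)))))), (fun n => 100 * n + 100).
  split; [solve_poly|]. intros t _ io rest. set (S := length io + length rest + _).
  destruct t as [|l r]; simpl tbool.
  - do 2 eexists. split.
    + eapply sx_bind; [eapply sx_pop'; [simpl; reflexivity|simpl; reflexivity|]|].
      * subst S. size.
      * eapply sx_push'; [reflexivity|]. subst S. size.
    + lia.
  - rewrite tsize_Nd in *. 
    destruct (sx_drop S io l (bits r ++ rest)) as (t1 & E1 & T1).
    { subst S. size. }
    destruct (sx_drop S io r rest) as (t2 & E2 & T2).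
    { subst S. size. }
    do 2 eexists. split.
    + eapply sx_bind; [eapply sx_pop'; [simpl; rewrite <- app_assoc; reflexivity|simpl; reflexivity|]|].
      * subst S. size.
      * cbv iota. eapply sx_sseq; [exact E1|]. eapply sx_sseq; [exact E2|].
        apply sx_push_all. subst S. simpl. lia.
    + simpl. lia.
Qed.

Lemma CF_cons {X A : encType} (f : X -> A) (g : X -> list A) :
  CF f -> CF g -> CF (fun x => f x :: g x).
Proof. exact (computes_pair _ _ _ _). Qed.

(** The code of [a :: l] is the code of the pair [(a, l)]; in the nonempty case the list can be
    handed on unchanged as an argument of [g1]. *)
Lemma CF_list_match {X A Y : encType} (f : X -> list A) (g0 : X -> Y)
    (g1 : X -> A -> list A -> Y) :
  CF f -> CF g0 -> CF (fun p => g1 (fst p) (fst (snd p)) (snd (snd p))) ->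
  CF (fun x => match f x with [] => g0 x | a :: l => g1 x a l end).
Proof.
  intros F G0 G1. apply computes_if with (c := fun x => is_node (enc (f x))).
  - now apply computes_is_node.
  - eapply computes_comp; [|exact G1|].
    + apply computes_pair; [apply computes_id|].
      eapply computes_weaken; [exact F|]. intros y _. exists y. split; [exact Logic.I|split; reflexivity].
    + intros x [_ E]. destruct (f x) as [|a l] eqn:Ef; [discriminate|].
      exists (x, (a, l)). auto.
  - eapply computes_weaken; [exact G0|]. intros y [_ E]. exists y.
    destruct (f y); [auto|discriminate].
Qed.

Lemma CF_while {X Y : encType} (c : Y -> bool) (f : Y -> Y) (s : X -> Y)
    (k : X -> nat) (Q N : nat -> nat) :
  CF s -> CF c -> CF f -> poly Q -> poly N ->
  (forall x j, j < k x -> c (Nat.iter j f (s x)) = true) ->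
  (forall x, c (Nat.iter (k x) f (s x)) = false) ->
  (forall x j, j <= k x -> sz (Nat.iter j f (s x)) <= Q (sz x)) ->
  (m = true -> forall x, k x <= N (sz x)) ->
  CF (fun x => Nat.iter (k x) f (s x)).
Proof.
  intros Hs Hc Hf HQ HN H1 H2 H3 H4.
  apply (computes_while (fun _ => True) enc enc c f s k Q N); auto;
    intros; rewrite <- ?sz_enc; auto.
Qed.

Lemma fold_step_iter {X A S} (step : X -> S -> A -> S) x : forall j l s,
  j <= length l ->
  Nat.iter j (fun p => match fst (snd p) with
    | [] => p | a :: t => (fst p, (t, step (fst p) (snd (snd p)) a)) end) (x, (l, s)) =
  (x, (skipn j l, fold_left (step x) (firstn j l) s)).
Proof.
  induction j; intros l s Hj; [reflexivity|].
  rewrite Nat.iter_succ_r. destruct l as [|a l]; [simpl in Hj; lia|]. simpl in *.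
  apply IHj. lia.
Qed.

(** The loop carries the parameter, the rest of the list and the accumulator. There are polynomially
    many rounds because the list is part of a polynomial-size value. The bound ranges over prefixes
    since the intermediate accumulators have to fit as well. *)
Lemma CF_fold {X A S : encType} (step : X -> S -> A -> S)
    (l : X -> list A) (s : X -> S) (Q : nat -> nat) :
  CF (fun p => step (fst p) (fst (snd p)) (snd (snd p))) -> CF l -> CF s -> poly Q ->
  (forall x l1 l2, l x = l1 ++ l2 -> sz (fold_left (step x) l1 (s x)) <= Q (sz x)) ->
  CF (fun x => fold_left (step x) (l x) (s x)).
Proof.
  intros Hstep Hl Hs HQ Bound.
  set (f := fun p : X * (list A * S) => match fst (snd p) with
    | [] => p | a :: t => (fst p, (t, step (fst p) (snd (snd p)) a)) end).
  assert (iterE : forall x j, j <= length (l x) -> Nat.iter j f (x, (l x, s x)) =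
    (x, (skipn j (l x), fold_left (step x) (firstn j (l x)) (s x)))).
  { intros x j Hj. now apply fold_step_iter. }
  destruct (CF_size _ Hl) as (ql & Pl & Ql).
  apply CF_ext with (f := fun x => snd (snd (Nat.iter (length (l x)) f (x, (l x, s x))))).
  { intros x. rewrite (iterE x _ (le_n _)). cbn [fst snd]. now rewrite firstn_all. }
  apply CF_snd, CF_snd.
  apply CF_while with (c := fun p => match fst (snd p) with [] => false | _ => true end)
    (Q := fun n => n + ql n + Q n + 10) (N := ql).
  - apply CF_pair; [apply CF_id|apply CF_pair]; assumption.
  - apply CF_list_match with (g0 := fun _ => false) (g1 := fun _ _ _ => true);
      [apply CF_fst, CF_snd, CF_id| |]; apply CF_const.
  - unfold f. apply CF_list_match with (g0 := fun p => p)
      (g1 := fun p a t => (fst p, (t, step (fst p) (snd (snd p)) a)));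
      [apply CF_fst, CF_snd, CF_id|apply CF_id|].
    apply CF_pair; [apply CF_fst, CF_fst, CF_id|]. apply CF_pair; [apply CF_snd, CF_snd, CF_id|].
    refine (CF_comp (fun p => step (fst p) (fst (snd p)) (snd (snd p)))
      (fun p : (X * (list A * S)) * (A * list A) =>
        (fst (fst p), (snd (snd (fst p)), fst (snd p)))) Hstep _).
    apply CF_pair; [apply CF_fst, CF_fst, CF_id|].
    apply CF_pair; [apply CF_snd, CF_snd, CF_fst, CF_id|apply CF_fst, CF_snd, CF_id].
  - solve_poly.
  - assumption.
  - intros x j Hj. cbn. rewrite iterE by lia. simpl.
    destruct (skipn j (l x)) eqn:E; [|reflexivity].
    apply (f_equal (@length _)) in E. rewrite length_skipn in E. simpl in E. lia.
  - intros x. cbn. rewrite iterE by lia. simpl. now rewrite skipn_all.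
  - intros x j Hj. cbn. rewrite iterE by lia. rewrite !sz_pair.
    pose proof (firstn_skipn j (l x)) as E. symmetry in E. specialize (Bound x _ _ E).
    specialize (Ql x). rewrite E in Ql.
    pose proof (sz_app (firstn j (l x)) (skipn j (l x))). pose proof (sz_pos (firstn j (l x))).
    lia.
  - intros _ x. specialize (Ql x). pose proof (sz_length (l x)). lia.
Qed.

(** The increment depends on the parameter and the current entry, but not on the accumulator. This
    rules out repeated doubling, so the total growth is a polynomial times the number of entries. *)
Lemma CF_fold_add {X A S : encType} (step : X -> S -> A -> S)
    (l : X -> list A) (s : X -> S) (q : nat -> nat) :
  CF (fun p => step (fst p) (fst (snd p)) (snd (snd p))) -> CF l -> CF s -> poly q ->
  (forall x s a, sz (step x s a) <= sz s + q (sz x + sz a)) ->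
  CF (fun x => fold_left (step x) (l x) (s x)).
Proof.
  intros Hstep Hl Hs Hq Add.
  destruct (CF_size _ Hl) as (ql & Pl & Ql). destruct (CF_size _ Hs) as (qs & Ps & Qs).
  apply CF_fold with (Q := fun n => qs n + ql n * q (n + ql n)); auto; [solve_poly|].
  intros x l1 l2 E.
  assert (B : forall l1 s0, (forall a, In a l1 -> sz a <= ql (sz x)) ->
    sz (fold_left (step x) l1 s0) <= sz s0 + length l1 * q (sz x + ql (sz x))).
  { clear - Add Hq. induction l1 as [|a l1 IH]; intros s0 Ha; simpl; [lia|].
    specialize (IH (step x s0 a)). specialize (Add x s0 a).
    pose proof (proj1 Hq (sz x + sz a) (sz x + ql (sz x))).
    specialize (IH ltac:(intros; apply Ha; now right)). specialize (Ha a (or_introl eq_refl)). lia. }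
  specialize (B l1 (s x)). specialize (Qs x). specialize (Ql x). rewrite E in Ql.
  pose proof (sz_app l1 l2). pose proof (sz_pos l2). pose proof (sz_length l1).
  assert (Ha : forall a, In a l1 -> sz a <= sz l1).
  { clear. induction l1 as [|c l1 IH]; intros b Hb; [easy|]. rewrite sz_cons.
    destruct Hb as [->|Hb]; [lia|]. specialize (IH b Hb). lia. }
  etransitivity; [apply B; intros a Hi; specialize (Ha a Hi); lia|].
  apply Nat.add_le_mono; [assumption|]. apply Nat.mul_le_mono_r. lia.
Qed.

Lemma fold_left_cons {A} (l acc : list A) : fold_left (fun acc a => a :: acc) l acc = rev l ++ acc.
Proof.
  revert acc. induction l; intros; simpl; auto. rewrite IHl, <- app_assoc. reflexivity.
Qed.
End Functions.

(** * Lists *)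

#[global] Opaque CF.

Ltac cf_core :=
  lazymatch goal with |- CF _ ?f =>
    lazymatch f with
    | fun x => x => apply CF_id
    | @fst _ _ => apply (CF_fst (fun x => x))
    | @snd _ _ => apply (CF_snd (fun x => x))
    | fun x => (@?f x, @?g x) => apply (CF_pair f g)
    | fun x => fst (@?f x) => apply (CF_fst f)
    | fun x => snd (@?f x) => apply (CF_snd f)
    | fun x => @?f x :: @?g x => apply (CF_cons f g)
    | fun x => match @?f x with [] => @?g x | a :: l => @?h x a l end =>
        apply (CF_list_match f g h)
    | fun x => if @?c x then @?f x else @?g x => apply (CF_if c f g)
    | _ => apply CF_const
    end
  end; cbv beta.

Create HintDb cf.
#[global] Hint Extern 1 (CF _ _) => cf_core : cf.

#[global] Hint Extern 1 (CF _ _) => match goal with H : CF _ ?h |- CF _ (fun x => ?h (@?f x)) =>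
  apply (CF_comp h f H); cbv beta end : cf.

Ltac cf := cbv beta; auto 100 with cf nocore.

Lemma CF_negb {m} {X : encType} (f : X -> bool) : CF m f -> CF m (fun x => negb (f x)).
Proof. intros. apply CF_ext with (f := fun x => if f x then false else true); [auto|cf]. Qed.

Lemma CF_andb {m} {X : encType} (f g : X -> bool) : CF m f -> CF m g -> CF m (fun x => f x && g x).
Proof. intros. apply CF_ext with (f := fun x => if f x then g x else false); [auto|cf]. Qed.

Lemma CF_orb {m} {X : encType} (f g : X -> bool) : CF m f -> CF m g -> CF m (fun x => f x || g x).
Proof. intros. apply CF_ext with (f := fun x => if f x then true else g x); [auto|cf]. Qed.

Lemma CF_xorb {m} {X : encType} (f g : X -> bool) : CF m f -> CF m g -> CF m (fun x => xorb (f x) (g x)).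
Proof.
  intros. apply CF_ext with (f := fun x => if f x then if g x then false else true else g x); [|cf].
  intros x. now destruct (f x), (g x).
Qed.

#[global] Hint Extern 1 (CF _ _) => lazymatch goal with
  | |- CF _ (fun x => negb (@?f x)) => apply (CF_negb f)
  | |- CF _ (fun x => andb (@?f x) (@?g x)) => apply (CF_andb f g)
  | |- CF _ (fun x => orb (@?f x) (@?g x)) => apply (CF_orb f g)
  | |- CF _ (fun x => xorb (@?f x) (@?g x)) => apply (CF_xorb f g)
  end; cbv beta : cf.

Lemma CF_rev_append {m} {X A : encType} (f g : X -> list A) :
  CF m f -> CF m g -> CF m (fun x => rev (f x) ++ g x).
Proof.
  intros F G. apply CF_ext with (f := fun x => fold_left (fun s a => a :: s) (f x) (g x)).
  { intros x. apply fold_left_cons. }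
  apply CF_fold_add with (step := fun _ s a => a :: s) (q := fun n => n + 1); auto; [cf|solve_poly|].
  intros. cbv beta. rewrite sz_cons. lia.
Qed.

Lemma CF_rev {m} {X A : encType} (f : X -> list A) : CF m f -> CF m (fun x => rev (f x)).
Proof.
  intros F. apply CF_ext with (f := fun x => rev (f x) ++ []).
  { intros x. apply app_nil_r. }
  now apply CF_rev_append; [|apply CF_const].
Qed.

Lemma CF_app {m} {X A : encType} (f g : X -> list A) : CF m f -> CF m g -> CF m (fun x => f x ++ g x).
Proof.
  intros F G. apply CF_ext with (f := fun x => rev (rev (f x)) ++ g x).
  { intros x. now rewrite rev_involutive. }
  now apply CF_rev_append; [apply CF_rev|].
Qed.

Lemma CF_flat_map {m} {X A B : encType} (f : X -> A -> list B) (l : X -> list A) :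
  CF m (fun p => f (fst p) (snd p)) -> CF m l -> CF m (fun x => flat_map (f x) (l x)).
Proof.
  intros F L. destruct (CF_size _ F) as (q & Pq & Q).
  apply CF_ext with (f := fun x => fold_left (fun s a => s ++ f x a) (l x) []).
  { intros x. change (flat_map (f x) (l x)) with ([] ++ flat_map (f x) (l x)).
    generalize (@nil B). induction (l x) as [|a t IH]; intros s; simpl.
    - now rewrite app_nil_r.
    - now rewrite IH, app_assoc. }
  apply CF_fold_add with (step := fun x s a => s ++ f x a) (q := fun n => q (n + 1)); auto.
  - apply CF_app; [cf|].
    apply (CF_comp2 f (fun p : X * (list B * A) => fst p) (fun p => snd (snd p))); cf.
  - cf.
  - solve_poly.
  - intros x s a. pose proof (sz_app s (f x a)). pose proof (Q (x, a)) as P. simpl in P.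
    rewrite sz_pair in P. replace (1 + sz x + sz a) with (sz x + sz a + 1) in P by lia. lia.
Qed.

Lemma CF_map {m} {X A B : encType} (f : X -> A -> B) (l : X -> list A) :
  CF m (fun p => f (fst p) (snd p)) -> CF m l -> CF m (fun x => map (f x) (l x)).
Proof.
  intros F L. apply CF_ext with (f := fun x => flat_map (fun a => [f x a]) (l x)).
  { intros x. induction (l x); simpl; congruence. }
  apply (CF_flat_map (fun x a => [f x a])); [cf|exact L].
Qed.

Lemma CF_filter {m} {X A : encType} (f : X -> A -> bool) (l : X -> list A) :
  CF m (fun p => f (fst p) (snd p)) -> CF m l -> CF m (fun x => filter (f x) (l x)).
Proof.
  intros F L. apply CF_ext with (f := fun x => flat_map (fun a => if f x a then [a] else []) (l x)).
  { intros x. induction (l x) as [|a t IH]; simpl; [auto|]. destruct (f x a); simpl; congruence. }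
  apply (CF_flat_map (fun x a => if f x a then [a] else [])); [cf|exact L].
Qed.

Lemma CF_existsb {m} {X A : encType} (f : X -> A -> bool) (l : X -> list A) :
  CF m (fun p => f (fst p) (snd p)) -> CF m l -> CF m (fun x => existsb (f x) (l x)).
Proof.
  intros F L. apply CF_ext with (f := fun x => match filter (f x) (l x) with [] => false | _ :: _ => true end).
  { intros x. induction (l x) as [|a t IH]; simpl; [auto|]. destruct (f x a); simpl; congruence. }
  pose proof (CF_filter f l F L). cf.
Qed.

Lemma CF_forallb {m} {X A : encType} (f : X -> A -> bool) (l : X -> list A) :
  CF m (fun p => f (fst p) (snd p)) -> CF m l -> CF m (fun x => forallb (f x) (l x)).
Proof.
  intros F L. apply CF_ext with (f := fun x => negb (existsb (fun a => negb (f x a)) (l x))).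
  { intros x. induction (l x) as [|a t IH]; simpl; [auto|]. destruct (f x a); simpl; congruence. }
  apply CF_negb, (CF_existsb (fun x a => negb (f x a))); [now apply CF_negb|exact L].
Qed.

#[global] Hint Extern 1 (CF _ _) => lazymatch goal with
  | |- CF _ (fun x => rev (@?f x)) => apply (CF_rev f)
  | |- CF _ (fun x => @?f x ++ @?g x) => apply (CF_app f g)
  | |- CF _ (fun x => flat_map (fun a => @?f x a) (@?l x)) => apply (CF_flat_map f l)
  | |- CF _ (fun x => map (fun a => @?f x a) (@?l x)) => apply (CF_map f l)
  | |- CF _ (fun x => filter (fun a => @?f x a) (@?l x)) => apply (CF_filter f l)
  | |- CF _ (fun x => existsb (fun a => @?f x a) (@?l x)) => apply (CF_existsb f l)
  | |- CF _ (fun x => forallb (fun a => @?f x a) (@?l x)) => apply (CF_forallb f l)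
  end; cbv beta : cf.

Definition beqb_list (l1 l2 : list bool) : bool :=
  let s := fold_left (fun s a => match snd s with
      | [] => (false, [])
      | b :: t => (fst s && negb (xorb a b), t) end) l1 (true, l2) in
  fst s && match snd s with [] => true | _ :: _ => false end.

Lemma beqb_list_eq l1 l2 : beqb_list l1 l2 = true <-> l1 = l2.
Proof.
  unfold beqb_list. set (step := fun s a => _).
  assert (E : forall l1 s, fst (fold_left step l1 s) &&
    match snd (fold_left step l1 s) with [] => true | _ :: _ => false end = true <->
    fst s = true /\ snd s = l1).
  { clear. induction l1 as [|a l1 IH]; intros [ok l2].
    - simpl. destruct ok, l2; simpl; intuition congruence.
    - cbn [fold_left]. rewrite IH. unfold step. destruct l2 as [|b l2]; simpl; [intuition congruence|].
      destruct ok, a, b; simpl; intuition congruence. }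
  rewrite E. simpl. intuition congruence.
Qed.

Lemma CF_beqb_list {m} {X : encType} (f g : X -> list bool) :
  CF m f -> CF m g -> CF m (fun x => beqb_list (f x) (g x)).
Proof.
  intros F G. apply (CF_comp2 beqb_list); auto. unfold beqb_list.
  set (step := fun s a => _).
  assert (S : CF m (fun p : list bool * list bool => fold_left step (fst p) (true, snd p))).
  { apply CF_fold_add with (step := fun _ => step) (q := fun _ => 10); [|cf|cf|solve_poly|].
    - unfold step. cf.
    - intros x [ok [|b l]] a; cbn [step snd fst]; sz_simpl.
      + pose proof (sz_bool false). lia.
      + pose proof (sz_bool (ok && negb (xorb a b))). lia. }
  cf.
Qed.

#[global] Hint Extern 1 (CF _ _) => lazymatch goal with
  | |- CF _ (fun x => beqb_list (@?f x) (@?g x)) => apply (CF_beqb_list f g)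
  end; cbv beta : cf.

(** * Binary numbers *)

(** Least significant digit first, and empty for 0: parity is the head and halving is the tail. *)
Definition nbits (n : nat) : list bool :=
  match N.of_nat n with N0 => [] | Npos p => rev (pos_bits p) end.

Canonical nat_encType := EncType nat (fun n => enc (nbits n)).

Definition dbl (b : bool) (n : nat) : nat := Nat.b2n b + 2 * n.

Lemma nbits_dbl_true n : nbits (dbl true n) = true :: nbits n.
Proof.
  unfold nbits, dbl. simpl Nat.b2n.
  replace (N.of_nat (1 + 2 * n)) with (N.succ_double (N.of_nat n)) by lia.
  destruct (N.of_nat n); simpl; [auto|]. now rewrite rev_app_distr.
Qed.

Lemma nbits_dbl_false n : nbits (dbl false n) = match nbits n with [] => [] | _ => false :: nbits n end.
Proof.
  unfold nbits, dbl. simpl Nat.b2n.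
  replace (N.of_nat (0 + 2 * n)) with (N.double (N.of_nat n)) by lia.
  destruct (N.of_nat n) as [|p]; simpl; [auto|]. rewrite rev_app_distr. simpl.
  assert (rev (pos_bits p) <> []); [|now destruct (rev (pos_bits p))].
  intros E. apply (f_equal (@length _)) in E. rewrite length_rev in E.
  destruct p; simpl in E; rewrite ?length_app in E; simpl in E; lia.
Qed.

Lemma nbits_dbl b n :
  nbits (dbl b n) = if b then b :: nbits n else match nbits n with [] => [] | _ => b :: nbits n end.
Proof. destruct b; [apply nbits_dbl_true|apply nbits_dbl_false]. Qed.

Lemma dbl_odd_div2 n : n = dbl (Nat.odd n) (Nat.div2 n).
Proof. unfold dbl. pose proof (Nat.div2_odd n). lia. Qed.

(** Induction on the binary digits. The condition [0 < dbl b n] excludes [dbl false 0], which adds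
    no digit to [nbits]. *)
Lemma dbl_ind (P : nat -> Prop) :
  P 0 -> (forall b n, 0 < dbl b n -> P n -> P (dbl b n)) -> forall n, P n.
Proof.
  intros P0 PS n. induction n as [n IH] using (well_founded_induction Wf_nat.lt_wf).
  destruct (Nat.eq_dec n 0) as [->|Hn]; [assumption|].
  pose proof (dbl_odd_div2 n) as E. rewrite E. apply PS; [lia|]. apply IH.
  unfold dbl in E. pose proof (Nat.div2_odd n). destruct (Nat.odd n); simpl in *; lia.
Qed.

Lemma div2_dbl b n : Nat.div2 (dbl b n) = n.
Proof.
  unfold dbl. destruct b; simpl Nat.b2n.
  - rewrite Nat.add_1_l. apply Nat.div2_succ_double.
  - apply Nat.div2_double.
Qed.

Lemma odd_dbl b n : Nat.odd (dbl b n) = b.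
Proof.
  unfold dbl. rewrite Nat.odd_add. replace (Nat.odd (2 * n)) with false.
  - destruct b; reflexivity.
  - symmetry. unfold Nat.odd. rewrite Nat.even_mul. reflexivity.
Qed.

Lemma nbits_0 : nbits 0 = [].
Proof. reflexivity. Qed.

Lemma nbits_nil n : nbits n = [] <-> n = 0.
Proof.
  split; [|now intros ->]. intros E. rewrite (dbl_odd_div2 n). rewrite (dbl_odd_div2 n) in E.
  revert E. generalize (Nat.div2 n). generalize (Nat.odd n). clear n.
  intros b n. revert b. induction n as [|c n H IH] using dbl_ind; intros b E.
  - destruct b; [discriminate|reflexivity].
  - exfalso. rewrite nbits_dbl in E. destruct b; [discriminate|].
    destruct (nbits (dbl c n)) eqn:E'; [|discriminate]. apply IH in E'. lia.
Qed.

Lemma nbits_dbl_pos b n : 0 < dbl b n -> nbits (dbl b n) = b :: nbits n.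
Proof.
  intros H. rewrite nbits_dbl. destruct b; [auto|].
  destruct (nbits n) eqn:E; auto. apply nbits_nil in E. subst. now apply Nat.lt_irrefl in H.
Qed.

Definition bl (n : nat) : nat := length (nbits n).

Lemma length_nbits_lt n : n < 2 ^ length (nbits n).
Proof.
  induction n as [|b n H IH] using dbl_ind; [simpl; lia|].
  rewrite nbits_dbl_pos by assumption. cbn [length]. rewrite Nat.pow_succ_r'.
  destruct b; unfold dbl; cbn [Nat.b2n]; lia.
Qed.

Lemma length_nbits_le n : 0 < n -> 2 ^ length (nbits n) <= 2 * n.
Proof.
  induction n as [|b n H IH] using dbl_ind; intros; [lia|].
  rewrite nbits_dbl_pos by assumption. cbn [length]. rewrite Nat.pow_succ_r'.
  destruct (Nat.eq_dec n 0) as [->|]; [|unfold dbl; specialize (IH ltac:(lia)); lia].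
  simpl. unfold dbl in *. destruct b; simpl in *; lia.
Qed.

Lemma bl_mono a b : a <= b -> bl a <= bl b.
Proof.
  unfold bl. intros H. destruct (Nat.eq_dec a 0) as [->|Ha]; [rewrite nbits_0; simpl; lia|].
  destruct (Nat.le_gt_cases (length (nbits a)) (length (nbits b))); [assumption|].
  pose proof (length_nbits_le a ltac:(lia)). pose proof (length_nbits_lt b).
  pose proof (Nat.pow_le_mono_r 2 (S (length (nbits b))) (length (nbits a)) ltac:(lia) ltac:(lia)) as P.
  rewrite Nat.pow_succ_r' in P. lia.
Qed.

Lemma sz_bits (l : list bool) : 1 + 2 * length l <= sz l <= 1 + 4 * length l.
Proof.
  induction l as [|b l IH]; cbn [length]; sz_simpl; [lia|].
  pose proof (sz_bool b). pose proof (sz_pos b). lia.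
Qed.

Lemma sz_nat (n : nat) : sz n = sz (nbits n).
Proof. rewrite !sz_enc. reflexivity. Qed.

Lemma length_nbits_sz (n : nat) : length (nbits n) <= sz n.
Proof. rewrite sz_nat. pose proof (sz_bits (nbits n)). lia. Qed.

Lemma CF_nbits {m} {X : encType} (f : X -> nat) : CF m f -> CF m (fun x => nbits (f x)).
Proof. intros F. exact (CF_coerce f (fun x => nbits (f x)) (fun _ => eq_refl) F). Qed.

#[global] Hint Extern 1 (CF _ _) => lazymatch goal with
  | |- CF _ (fun x => nbits (@?f x)) => apply (CF_nbits f)
  end; cbv beta : cf.

Lemma CF_via_nbits {m} {X : encType} (f : X -> nat) : CF m (fun x => nbits (f x)) -> CF m f.
Proof. intros F. exact (CF_coerce (fun x => nbits (f x)) f (fun _ => eq_refl) F). Qed.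

Lemma CF_is_zero {m} {X : encType} (f : X -> nat) : CF m f -> CF m (fun x => Nat.eqb (f x) 0).
Proof.
  intros F. apply CF_ext with (f := fun x => match nbits (f x) with [] => true | _ :: _ => false end).
  - intros x. destruct (nbits (f x)) eqn:E.
    + apply nbits_nil in E. now rewrite E.
    + destruct (Nat.eqb_spec (f x) 0); [|auto]. apply nbits_nil in e. congruence.
  - cf.
Qed.

Lemma CF_dbl {m} {X : encType} (b : X -> bool) (f : X -> nat) :
  CF m b -> CF m f -> CF m (fun x => dbl (b x) (f x)).
Proof.
  intros B F. apply CF_via_nbits.
  apply CF_ext with (f := fun x => if b x then b x :: nbits (f x)
    else match nbits (f x) with [] => [] | _ :: _ => b x :: nbits (f x) end).
  - intros x. rewrite nbits_dbl. destruct (b x); [auto|]. now destruct (nbits (f x)).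
  - cf.
Qed.

Lemma nbits_div2 n : nbits (Nat.div2 n) = tl (nbits n).
Proof.
  destruct n as [|b n H _] using dbl_ind; [reflexivity|].
  now rewrite div2_dbl, nbits_dbl_pos.
Qed.

Lemma CF_div2 {m} {X : encType} (f : X -> nat) : CF m f -> CF m (fun x => Nat.div2 (f x)).
Proof.
  intros F. apply CF_via_nbits.
  apply CF_ext with (f := fun x => match nbits (f x) with [] => [] | _ :: l => l end); [|cf].
  intros x. rewrite nbits_div2. now destruct (nbits (f x)).
Qed.

Lemma CF_odd {m} {X : encType} (f : X -> nat) : CF m f -> CF m (fun x => Nat.odd (f x)).
Proof.
  intros F. apply CF_ext with (f := fun x => match nbits (f x) with [] => false | b :: _ => b end); [|cf].
  intros x. induction (f x) as [|b n H _] using dbl_ind; [reflexivity|].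
  now rewrite odd_dbl, nbits_dbl_pos.
Qed.

#[global] Hint Extern 1 (CF _ _) => lazymatch goal with
  | |- CF _ (fun x => Nat.eqb (@?f x) 0) => apply (CF_is_zero f)
  | |- CF _ (fun x => dbl (@?b x) (@?f x)) => apply (CF_dbl b f)
  | |- CF _ (fun x => Nat.div2 (@?f x)) => apply (CF_div2 f)
  | |- CF _ (fun x => Nat.odd (@?f x)) => apply (CF_odd f)
  end; cbv beta : cf.

(** Horner's scheme, hence most significant digit first, opposite to [nbits]; leading zeros do no
    harm. *)
Definition of_bits (l : list bool) : nat := fold_left (fun n b => dbl b n) l 0.

Lemma of_bits_snoc l b : of_bits (l ++ [b]) = dbl b (of_bits l).
Proof. unfold of_bits. now rewrite fold_left_app. Qed.

Lemma of_bits_rev_nbits n : of_bits (rev (nbits n)) = n.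
Proof.
  induction n as [|b n H IH] using dbl_ind; [reflexivity|].
  rewrite nbits_dbl_pos by assumption. simpl. now rewrite of_bits_snoc, IH.
Qed.

Lemma of_bits_lt l : of_bits l < 2 ^ length l.
Proof.
  induction l as [|b l IH] using rev_ind; [cbv; lia|].
  rewrite of_bits_snoc, length_app, Nat.add_comm. simpl length.
  replace (1 + length l) with (S (length l)) by lia. rewrite Nat.pow_succ_r'.
  destruct b; unfold dbl; cbn [Nat.b2n]; lia.
Qed.

Lemma bl_le n k : n < 2 ^ k -> bl n <= k.
Proof.
  intros H. destruct (Nat.le_gt_cases (bl n) k); auto.
  destruct (Nat.eq_dec n 0) as [->|Hn]; [unfold bl; rewrite nbits_0; simpl; lia|].
  pose proof (length_nbits_le n ltac:(lia)) as P. fold (bl n) in P.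
  pose proof (Nat.pow_le_mono_r 2 (S k) (bl n) ltac:(lia) ltac:(lia)) as P'.
  rewrite Nat.pow_succ_r' in P'. lia.
Qed.

Lemma bl_dbl b n : bl (dbl b n) <= S (bl n).
Proof.
  unfold bl. rewrite nbits_dbl. destruct b; [simpl; lia|].
  destruct (nbits n); simpl; lia.
Qed.

Lemma bl_sz n : bl n <= sz n <= 1 + 4 * bl n.
Proof. unfold bl. rewrite sz_nat. pose proof (sz_bits (nbits n)). lia. Qed.

Lemma sz_dbl b n : sz (dbl b n) <= sz n + 4.
Proof.
  rewrite !sz_nat, nbits_dbl. pose proof (sz_bool b).
  destruct b; [sz_simpl; lia|]. destruct (nbits n); [lia|]. sz_simpl. lia.
Qed.

Lemma sz_div2 n : sz (Nat.div2 n) <= sz n.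
Proof.
  rewrite !sz_nat, nbits_div2. destruct (nbits n) as [|b l]; simpl tl; [lia|].
  rewrite sz_cons. lia.
Qed.

(* Schoolbook subtraction. The state consists of the digits produced so far (most
   significant first), the borrow, and what is left of both operands. *)
Definition sub_step (s : (list bool * bool) * (nat * nat)) (_ : bool) :=
  let a := fst (snd s) in let b := snd (snd s) in let c := snd (fst s) in
  ((xorb (Nat.odd a) (xorb (Nat.odd b) c) :: fst (fst s),
    if Nat.odd a then Nat.odd b && c else Nat.odd b || c),
   (Nat.div2 a, Nat.div2 b)).

(** The outgoing borrow has the weight [2 ^ length l]. Started without a borrow, it is set exactly
    if [a < b], where truncated subtraction gives 0. *)
Lemma sub_steps l : forall acc c a b, a < 2 ^ length l -> b < 2 ^ length l ->
  exists digits c' ab, fold_left sub_step l ((acc, c), (a, b)) = ((digits ++ acc, c'), ab) /\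
    a + 2 ^ length l * Nat.b2n c' = b + Nat.b2n c + of_bits digits /\ length digits = length l.
Proof.
  induction l as [|x l IH]; intros acc c a b Ha Hb.
  - exists [], c, (a, b). change (of_bits []) with 0. simpl in *. split; [auto|split; [lia|auto]].
  - cbn [fold_left length] in *. rewrite Nat.pow_succ_r' in *.
    unfold sub_step at 2. cbn [fst snd].
    pose proof (Nat.div2_odd a) as Ea. pose proof (Nat.div2_odd b) as Eb.
    destruct (IH (xorb (Nat.odd a) (xorb (Nat.odd b) c) :: acc)
      (if Nat.odd a then Nat.odd b && c else Nat.odd b || c) (Nat.div2 a) (Nat.div2 b))
      as (digits & c' & ab & E & V & L); [lia|lia|].
    exists (digits ++ [xorb (Nat.odd a) (xorb (Nat.odd b) c)]), c', ab. split; [|split].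
    + rewrite E, <- app_assoc. reflexivity.
    + rewrite of_bits_snoc. unfold dbl.
      destruct (Nat.odd a), (Nat.odd b), c; cbn [Nat.b2n xorb andb orb] in *; lia.
    + rewrite length_app, L. simpl. lia.
Qed.

(** The list [nbits a ++ nbits b] only provides enough rounds for both operands. *)
Definition sub_state (a b : nat) :=
  fst (fold_left sub_step (nbits a ++ nbits b) (([], false), (a, b))).

Lemma sub_state_correct a b :
  (if snd (sub_state a b) then 0 else of_bits (fst (sub_state a b))) = a - b.
Proof.
  unfold sub_state.
  destruct (sub_steps (nbits a ++ nbits b) [] false a b) as (d & c & ab & -> & V & L).
  - pose proof (length_nbits_lt a). rewrite length_app, Nat.pow_add_r.
    pose proof (Nat.pow_nonzero 2 (length (nbits b))). nia.
  - pose proof (length_nbits_lt b). rewrite length_app, Nat.pow_add_r.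
    pose proof (Nat.pow_nonzero 2 (length (nbits a))). nia.
  - simpl. rewrite app_nil_r. pose proof (of_bits_lt d) as B. rewrite L in B.
    destruct c; cbn [Nat.b2n] in V; lia.
Qed.

Lemma CF_of_bits {m} {X : encType} (f : X -> list bool) : CF m f -> CF m (fun x => of_bits (f x)).
Proof.
  intros F. unfold of_bits.
  apply CF_fold_add with (step := fun _ n b => dbl b n) (q := fun _ => 4); [cf|cf|cf|solve_poly|].
  intros _ n b. apply sz_dbl.
Qed.

Lemma CF_sub {m} {X : encType} (f g : X -> nat) : CF m f -> CF m g -> CF m (fun x => f x - g x).
Proof.
  intros F G. apply (CF_comp2 Nat.sub); auto. clear F G.
  assert (S : CF m (fun p : nat * nat => sub_state (fst p) (snd p))).
  { apply CF_fst.
    apply CF_fold_add with (step := fun _ => sub_step) (q := fun _ => 10); [|cf|cf|solve_poly|].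
    - unfold sub_step. cf.
    - intros _ [[acc c] [a b]] x. unfold sub_step. cbn [fst snd]. sz_simpl.
      pose proof (sz_div2 a). pose proof (sz_div2 b). pose proof (sz_pos c).
      pose proof (sz_bool (xorb (Nat.odd a) (xorb (Nat.odd b) c))).
      pose proof (sz_bool (if Nat.odd a then Nat.odd b && c else Nat.odd b || c)). lia. }
  apply CF_ext with (f := fun p => if snd (sub_state (fst p) (snd p)) then 0
    else of_bits (fst (sub_state (fst p) (snd p)))).
  - intros [a b]. apply sub_state_correct.
  - apply CF_if; [now apply CF_snd|cf|]. now apply CF_of_bits, CF_fst.
Qed.

#[global] Hint Extern 1 (CF _ _) => lazymatch goal with
  | |- CF _ (fun x => of_bits (@?f x)) => apply (CF_of_bits f)
  | |- CF _ (fun x => @?f x - @?g x) => apply (CF_sub f g)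
  end; cbv beta : cf.

Lemma CF_leb {m} {X : encType} (f g : X -> nat) : CF m f -> CF m g -> CF m (fun x => f x <=? g x).
Proof.
  intros F G. apply CF_ext with (f := fun x => f x - g x =? 0); [|cf].
  intros x. destruct (Nat.leb_spec (f x) (g x)), (Nat.eqb_spec (f x - g x) 0); auto; lia.
Qed.

Lemma CF_eqb {m} {X : encType} (f g : X -> nat) : CF m f -> CF m g -> CF m (fun x => f x =? g x).
Proof.
  intros F G. apply CF_ext with (f := fun x => (f x - g x =? 0) && (g x - f x =? 0)); [|cf].
  intros x. destruct (Nat.eqb_spec (f x) (g x)), (Nat.eqb_spec (f x - g x) 0),
    (Nat.eqb_spec (g x - f x) 0); auto; lia.
Qed.

Lemma of_bits_zeros b l : of_bits (b :: map (fun _ : bool => false) l) = Nat.b2n b * 2 ^ length l.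
Proof.
  induction l as [|x l IH] using rev_ind; [destruct b; reflexivity|].
  rewrite map_app, app_comm_cons. simpl map at 2. rewrite of_bits_snoc, IH, length_app.
  cbn [length]. rewrite (Nat.add_1_r (length l)), Nat.pow_succ_r'.
  unfold dbl. cbn [Nat.b2n]. lia.
Qed.

Lemma of_bits_ones l : of_bits (map (fun _ : bool => true) l) + 1 = 2 ^ length l.
Proof.
  induction l as [|x l IH] using rev_ind; [reflexivity|].
  rewrite map_app. simpl map at 2. rewrite of_bits_snoc, length_app.
  cbn [length]. rewrite (Nat.add_1_r (length l)), Nat.pow_succ_r'.
  unfold dbl. cbn [Nat.b2n]. lia.
Qed.

(* With [P = 2 ^ k > n], [n + 1 = P - ((P - 1) - n)]. *)
Lemma CF_S {m} {X : encType} (f : X -> nat) : CF m f -> CF m (fun x => S (f x)).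
Proof.
  intros F. apply CF_ext with (f := fun x => of_bits (true :: map (fun _ => false) (nbits (f x))) -
    (of_bits (map (fun _ => true) (nbits (f x))) - f x)).
  - intros x. rewrite of_bits_zeros. pose proof (of_bits_ones (nbits (f x))).
    pose proof (length_nbits_lt (f x)). cbn [Nat.b2n]. lia.
  - cf.
Qed.

#[global] Hint Extern 1 (CF _ _) => lazymatch goal with
  | |- CF _ (fun x => @?f x <=? @?g x) => apply (CF_leb f g)
  end; cbv beta : cf.
#[global] Hint Extern 2 (CF _ _) => lazymatch goal with |- CF _ (fun x => @?f x =? @?g x) =>
  apply (CF_eqb f g); cbv beta end : cf.
#[global] Hint Extern 1 (CF _ _) => lazymatch goal with
  | |- CF _ (fun x => S (@?f x)) => apply (CF_S f)
  end; cbv beta : cf.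

(** Long division: the state consists of the quotient and the remainder of the number formed by the
    digits read so far. *)
Definition div_step (d : nat) (s : nat * nat) (b : bool) : nat * nat :=
  if d <=? dbl b (snd s) then (dbl true (fst s), dbl b (snd s) - d)
  else (dbl false (fst s), dbl b (snd s)).

Definition divmod (n d : nat) : nat * nat := fold_left (div_step d) (rev (nbits n)) (0, 0).

Lemma divmod_correct n d : 0 < d -> divmod n d = (n / d, n mod d).
Proof.
  intros Hd. unfold divmod. rewrite <- (of_bits_rev_nbits n) at 2 3.
  assert (E : forall l, let s := fold_left (div_step d) l (0, 0) in
    of_bits l = d * fst s + snd s /\ snd s < d).
  { induction l as [|b l IH] using rev_ind; [change (of_bits []) with 0; simpl; lia|].
    rewrite of_bits_snoc, fold_left_app. cbn [fold_left].
    destruct (fold_left (div_step d) l (0, 0)) as [q r]. unfold div_step. cbn [fst snd] in *.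
    destruct (Nat.leb_spec d (dbl b r)); cbn [fst snd]; unfold dbl in *;
      destruct b; cbn [Nat.b2n] in *; lia. }
  destruct (E (rev (nbits n))) as [E1 E2].
  destruct (fold_left _ _ _) as [q r]. cbn [fst snd] in *. f_equal.
  - now apply Nat.div_unique with r.
  - now apply Nat.mod_unique with q.
Qed.

Lemma CF_divmod {m} {X : encType} (f g : X -> nat) : CF m f -> CF m g -> CF m (fun x => divmod (f x) (g x)).
Proof.
  intros F G. apply (CF_comp2 divmod); auto. clear F G. unfold divmod.
  apply CF_fold with (step := fun p => div_step (snd p)) (Q := fun n => 10 + 10 * n);
    [unfold div_step; cf|cf|cf|solve_poly|].
  intros [n d] l1 l2 E. cbn [fst snd] in *.
  assert (B : forall l, bl (fst (fold_left (div_step d) l (0, 0))) <= length l /\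
    bl (snd (fold_left (div_step d) l (0, 0))) <= length l).
  { induction l as [|b l IH] using rev_ind; [now split|].
    rewrite fold_left_app, length_app. cbn [fold_left]. unfold div_step at 1 3.
    set (s := fold_left _ _ _) in *. simpl length. 
    pose proof (bl_dbl b (snd s)). pose proof (bl_dbl true (fst s)). pose proof (bl_dbl false (fst s)).
    pose proof (bl_mono (dbl b (snd s) - d) (dbl b (snd s)) (Nat.le_sub_l _ _)).
    destruct (d <=? dbl b (snd s)); cbn [fst snd]; lia. }
  specialize (B l1). destruct (fold_left _ _ _) as [q r]. cbn [fst snd] in B.
  apply (f_equal (@length _)) in E. rewrite length_rev, length_app in E. fold (bl n) in E.
  change (@length (carrier bool_encType)) with (@length bool) in *.
  sz_simpl. pose proof (bl_sz n). pose proof (bl_sz q). pose proof (bl_sz r). lia.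
Qed.

#[global] Hint Extern 1 (CF _ _) => lazymatch goal with
  | |- CF _ (fun x => divmod (@?f x) (@?g x)) => apply (CF_divmod f g)
  end; cbv beta : cf.

Lemma CF_div {m} {X : encType} (f g : X -> nat) : CF m f -> CF m g -> CF m (fun x => f x / g x).
Proof.
  intros F G. apply CF_ext with (f := fun x => if g x =? 0 then 0 else fst (divmod (f x) (g x))); [|cf].
  intros x. destruct (Nat.eqb_spec (g x) 0) as [->|]; [reflexivity|].
  rewrite divmod_correct by lia. reflexivity.
Qed.

Lemma CF_mod {m} {X : encType} (f g : X -> nat) : CF m f -> CF m g -> CF m (fun x => f x mod g x).
Proof.
  intros F G. apply CF_ext with (f := fun x => if g x =? 0 then f x else snd (divmod (f x) (g x))); [|cf].
  intros x. destruct (Nat.eqb_spec (g x) 0) as [->|]; [reflexivity|].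
  rewrite divmod_correct by lia. reflexivity.
Qed.

#[global] Hint Extern 1 (CF _ _) => lazymatch goal with
  | |- CF _ (fun x => @?f x / @?g x) => apply (CF_div f g)
  | |- CF _ (fun x => @?f x mod @?g x) => apply (CF_mod f g)
  end; cbv beta : cf.

Definition gcd_step (s : nat * nat) (_ : bool) : nat * nat :=
  if fst s =? 0 then s else (snd s mod fst s, fst s).

(** Two Euclidean steps replace [a] by [a mod (b mod a)], which is less than half of [a], so [2 * k]
    steps suffice for [a < 2 ^ k]. After reaching 0 the state is stationary. *)
Lemma gcd_steps k : forall a b l, a < 2 ^ k -> 2 * k <= length l ->
  snd (fold_left gcd_step l (a, b)) = Nat.gcd a b.
Proof.
  assert (Z : forall l b, fold_left gcd_step l (0, b) = (0, b)).
  { induction l; intros b; [reflexivity|apply IHl]. }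
  induction k; intros a b l Ha Hl.
  - simpl in Ha. replace a with 0 by lia. now rewrite Z.
  - destruct a as [|a]; [now rewrite Z|].
    destruct l as [|x [|y l]]; simpl in Hl; [lia|lia|].
    cbn [fold_left]. unfold gcd_step at 3. cbn [fst snd Nat.eqb].
    rewrite <- Nat.Lcm0.gcd_mod.
    pose proof (Nat.mod_upper_bound b (S a) ltac:(lia)).
    destruct (b mod S a) as [|r] eqn:E.
    + unfold gcd_step at 2. cbn [fst Nat.eqb]. now rewrite Z.
    + unfold gcd_step at 2. cbn [fst snd Nat.eqb]. rewrite IHk; [|rewrite Nat.pow_succ_r' in Ha|lia].
      * now rewrite Nat.Lcm0.gcd_mod.
      * pose proof (Nat.div_mod_eq (S a) (S r)). pose proof (Nat.mod_upper_bound (S a) (S r) ltac:(lia)).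
        (* With a quotient of at least 1, [S a] is at least [S r] plus the new remainder, hence more
           than twice that remainder. *)
        assert (S a / S r <> 0) by (intros E0; apply Nat.div_small_iff in E0; lia). nia.
Qed.

Lemma CF_gcd {m} {X : encType} (f g : X -> nat) : CF m f -> CF m g -> CF m (fun x => Nat.gcd (f x) (g x)).
Proof.
  intros F G. apply (CF_comp2 Nat.gcd); auto. clear F G.
  apply CF_ext with (f := fun p => snd (fold_left gcd_step (nbits (fst p) ++ nbits (fst p)) p)).
  { intros [a b]. apply (gcd_steps (bl a)); [apply length_nbits_lt|].
    rewrite length_app. unfold bl. cbn [fst]. lia. }
  apply CF_snd.
  apply CF_fold with (step := fun _ => gcd_step) (Q := fun n => 10 + 10 * n);
    [unfold gcd_step; cf|cf|cf|solve_poly|].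
  intros [a b] l1 l2 _.
  assert (B : forall l a b, bl (fst (fold_left gcd_step l (a, b))) <= bl a + bl b /\
    bl (snd (fold_left gcd_step l (a, b))) <= bl a + bl b).
  { clear. induction l as [|x l IH]; intros a b; [simpl; lia|].
    cbn [fold_left]. unfold gcd_step at 2 4. cbn [fst snd].
    destruct (Nat.eqb_spec a 0) as [->|Ha]; [apply IH|].
    destruct (IH (b mod a) a). pose proof (bl_mono (b mod a) b (Nat.Div0.mod_le b a)). lia. }
  specialize (B l1 a b). destruct (fold_left _ _ _) as [q r]. cbn [fst snd] in B.
  sz_simpl. pose proof (bl_sz a). pose proof (bl_sz b). pose proof (bl_sz q). pose proof (bl_sz r). lia.
Qed.

Lemma CF_length {m} {X A : encType} (l : X -> list A) : CF m l -> CF m (fun x => length (l x)).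
Proof.
  intros L. apply CF_ext with (f := fun x => fold_left (fun n _ => S n) (l x) 0).
  { intros x. change (length (l x)) with (0 + length (l x)). generalize 0.
    induction (l x) as [|a t IH]; intros n; simpl; [lia|]. rewrite IH. lia. }
  destruct (CF_size _ L) as (q & Pq & Q).
  apply CF_fold with (step := fun _ n _ => S n) (Q := fun n => 1 + 4 * q n); [cf|cf|cf|solve_poly|].
  intros x l1 l2 E. specialize (Q x).
  replace (fold_left _ _ _) with (length l1).
  2: { clear. change (length l1) with (0 + length l1). generalize 0.
    induction l1 as [|a t IH]; intros n; simpl; [lia|]. rewrite <- IH. lia. }
  pose proof (sz_length (l x)). rewrite E, length_app in H.
  pose proof (bl_sz (length l1)) as B. rewrite E in *.
  pose proof (bl_le (length l1) (length l1) (Nat.pow_gt_lin_r 2 _ ltac:(lia))). lia.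
Qed.

#[global] Hint Extern 1 (CF _ _) => lazymatch goal with
  | |- CF _ (fun x => Nat.gcd (@?f x) (@?g x)) => apply (CF_gcd f g)
  | |- CF _ (fun x => length (@?l x)) => apply (CF_length l)
  end; cbv beta : cf.

(** * Circuits *)

Definition enc_op (o : op) : tree := enc (op_code o).
Canonical op_encType := EncType op enc_op.

Definition enc_label {V : encType} (l : label V) : tree :=
  match l with
  | LIn v => enc (0, v)
  | LNeg p => enc (1, p)
  | LBin o p1 p2 => enc (2, (o, (p1, p2)))
  end.

Canonical label_encType (V : encType) := EncType (label V) enc_label.

Lemma CF_op_code {m} {X : encType} (f : X -> op) : CF m f -> CF m (fun x => op_code (f x)).
Proof. intros F. exact (CF_coerce f (fun x => op_code (f x)) (fun _ => eq_refl) F). Qed.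

Lemma CF_op_fun {m} {X Y : encType} (h : op -> Y) (f : X -> op) : CF m f -> CF m (fun x => h (f x)).
Proof.
  intros F. apply CF_op_code in F.
  apply CF_ext with (f := fun x => let c := op_code (f x) in
    if c =? 0 then h OCup else if c =? 1 then h OCap else if c =? 2 then h OCompl
    else if c =? 3 then h OAdd else if c =? 4 then h OSub else if c =? 5 then h OMul else h ODiv).
  - intros x. now destruct (f x).
  - cbv zeta. cf.
Qed.

Lemma CF_LIn {m} {X V : encType} (f : X -> V) : CF m f -> CF m (fun x => LIn (f x)).
Proof.
  intros F. apply (CF_coerce (fun x => (0, f x)) (fun x => LIn (f x))); [reflexivity|cf].
Qed.

Lemma CF_LNeg {m} {X V : encType} (f : X -> nat) : CF m f -> CF m (fun x => @LNeg V (f x)).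
Proof.
  intros F. apply (CF_coerce (fun x => (1, f x)) (fun x => @LNeg V (f x))); [reflexivity|cf].
Qed.

Lemma CF_LBin {m} {X V : encType} (o : X -> op) (f g : X -> nat) :
  CF m o -> CF m f -> CF m g -> CF m (fun x => @LBin V (o x) (f x) (g x)).
Proof.
  intros O F G. apply (CF_coerce (fun x => (2, (o x, (f x, g x)))) (fun x => @LBin V (o x) (f x) (g x)));
    [reflexivity|cf].
Qed.

Definition label_tag {V} (l : label V) : nat :=
  match l with LIn _ => 0 | LNeg _ => 1 | LBin _ _ _ => 2 end.

(** The payload has a different type in each case, so it is handled as a bare tree behind the tag.
    Once the tag has been tested, the payload is the code of the arguments of the right branch. *)
Lemma CF_label_match {m} {X V Y : encType} (f : X -> label V) (g0 : X -> V -> Y)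
    (g1 : X -> nat -> Y) (g2 : X -> op -> nat -> nat -> Y) :
  CF m f -> CF m (fun p => g0 (fst p) (snd p)) -> CF m (fun p => g1 (fst p) (snd p)) ->
  CF m (fun p => g2 (fst p) (fst (snd p)) (fst (snd (snd p))) (snd (snd (snd p)))) ->
  CF m (fun x => match f x with LIn v => g0 x v | LNeg p => g1 x p | LBin o p1 p2 => g2 x o p1 p2 end).
Proof.
  intros F G0 G1 G2.
  set (payload := fun x => match f x with
    | LIn v => enc v | LNeg p => enc p | LBin o p1 p2 => enc (o, (p1, p2)) end).
  assert (P : computes m (fun _ => True) enc (fun x => Nd (enc (label_tag (f x))) (payload x))).
  { eapply computes_weaken; [exact F|]. intros x _. exists x. unfold payload.
    destruct (f x); auto. }
  assert (T : CF m (fun x => label_tag (f x))) by exact (computes_fst _ _ _ _ P).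
  apply computes_snd in P.
  assert (R : forall D : X -> Prop, computes m D enc (fun x => Nd (enc x) (payload x))).
  { intros D. apply computes_pair; [apply computes_id|].
    eapply computes_weaken; [exact P|]. intros x _. now exists x. }
  apply CF_computes in G0, G1, G2. apply CF_computes.
  apply computes_if with (c := fun x => label_tag (f x) =? 0); [exact (CF_is_zero _ T)| |].
  - eapply computes_comp; [apply R|exact G0|].
    intros x [_ E]. unfold payload. destruct (f x) as [v| |]; try discriminate.
    now exists (x, v).
  - apply computes_if with (c := fun x => label_tag (f x) =? 1).
    + eapply computes_weaken; [exact (CF_eqb _ _ T (CF_const 1))|].
      intros x _. now exists x.
    + eapply computes_comp; [apply R|exact G1|].
      intros x [_ E]. unfold payload. destruct (f x) as [|p|]; try discriminate.
      now exists (x, p).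
    + eapply computes_comp; [apply R|exact G2|].
      intros x [[_ E0] E]. unfold payload. destruct (f x) as [| |o p1 p2]; try discriminate.
      now exists (x, (o, (p1, p2))).
Qed.

#[global] Hint Extern 1 (CF _ _) => lazymatch goal with
  | |- CF _ (fun x => op_code (@?f x)) => apply (CF_op_code f)
  | |- CF _ (fun x => LIn (@?f x)) => apply (CF_LIn f)
  | |- CF _ (fun x => LNeg (@?f x)) => apply (CF_LNeg f)
  | |- CF _ (fun x => LBin (@?o x) (@?f x) (@?g x)) => apply (CF_LBin o f g)
  | |- CF _ (fun x => match @?f x with LIn v => @?g0 x v | LNeg p => @?g1 x p
                        | LBin o p1 p2 => @?g2 x o p1 p2 end) =>
      apply (CF_label_match f g0 g1 g2)
  end; cbv beta : cf.

(** * Parsing words *)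

(** [code_nat] doubles every bit and closes with two different bits. The state holds the first bit
    of an unfinished pair, the value of the current number so far, and the numbers completed, latest
    first. *)
Definition token_step (s : (list bool * nat) * list nat) (b : bool) :=
  match fst (fst s) with
  | [] => (([b], snd (fst s)), snd s)
  | c :: _ => if xorb c b then (([], 0), snd (fst s) :: snd s)
              else (([], dbl b (snd (fst s))), snd s)
  end.

(* Only a left inverse of [code_list]: ill-formed input is not detected here. *)
Definition tokens (x : list bool) : list nat :=
  rev (snd (fold_left token_step x (([], 0), []))).

Lemma nat_bits_nbits n : nat_bits n = if n =? 0 then [false] else rev (nbits n).
Proof.
  unfold nat_bits, nbits. destruct n as [|n]; [reflexivity|].
  simpl N.of_nat. cbn [Nat.eqb]. now rewrite rev_involutive.
Qed.

Lemma of_bits_nat_bits n : of_bits (nat_bits n) = n.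
Proof.
  rewrite nat_bits_nbits. destruct (Nat.eqb_spec n 0) as [->|_]; [reflexivity|].
  apply of_bits_rev_nbits.
Qed.

Lemma tokens_code_nat n ts :
  fold_left token_step (code_nat n) (([], 0), ts) = (([], 0), n :: ts).
Proof.
  unfold code_nat. rewrite fold_left_app.
  assert (E : forall l c, fold_left token_step (flat_map (fun b => [b; b]) l) (([], c), ts)
    = (([], fold_left (fun n b => dbl b n) l c), ts)).
  { induction l as [|b l IH]; intros c; [reflexivity|]. cbn [flat_map app fold_left].
    rewrite <- IH. f_equal. now destruct b. }
  rewrite E. fold (of_bits (nat_bits n)). now rewrite of_bits_nat_bits.
Qed.

Lemma tokens_code_list l : tokens (code_list l) = l.
Proof.
  unfold tokens.
  assert (E : forall l ts, fold_left token_step (code_list l) (([], 0), ts) = (([], 0), rev l ++ ts)).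
  { induction l0 as [|n l0 IH]; intros ts; [reflexivity|].
    simpl. rewrite fold_left_app, tokens_code_nat, IH, <- app_assoc. reflexivity. }
  rewrite E. simpl. rewrite app_nil_r. apply rev_involutive.
Qed.

Definition op_of (n : nat) : op :=
  if n =? 0 then OCup else if n =? 1 then OCap else if n =? 2 then OCompl
  else if n =? 3 then OAdd else if n =? 4 then OSub else if n =? 5 then OMul else ODiv.

Lemma op_of_code o : op_of (op_code o) = o.
Proof. now destruct o. Qed.

Definition parse_step (s : list nat * list (nat * label nat)) : list nat * list (nat * label nat) :=
  match fst s with
  | n :: t :: v :: r =>
      if t =? 0 then (r, (n, LIn v) :: snd s)
      else if t =? 1 then (r, (n, LNeg v) :: snd s)
      else match r with
           | p1 :: p2 :: r' => (r', (n, LBin (op_of v) p1 p2) :: snd s)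
           | _ => s
           end
  | _ => s
  end.

(** Every gate takes several tokens, so the list of tokens is ample fuel. On the single token left
    after the last gate, which is the number asked about, a further step changes nothing. *)
Definition parse_all (r : list nat) := fold_left (fun s _ => parse_step s) r (r, []).

(* A left inverse of the map listing the tokens of a circuit and of a number; its
   value is the output gate, the list of gates and the number. *)
Definition parse (ts : list nat) : (nat * list (nat * label nat)) * nat :=
  match ts with
  | o :: _ :: r =>
      ((o, rev (snd (parse_all r))), match fst (parse_all r) with b :: _ => b | [] => 0 end)
  | _ => ((0, []), 0)
  end.

Definition gate_nats {V} (vn : V -> list nat) (g : nat * label V) : list nat :=
  fst g :: label_nats vn (snd g).

Lemma parse_gates gs : forall {A} (fuel : list A) acc b, length gs <= length fuel ->
  fold_left (fun s _ => parse_step s) fuel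
    (flat_map (gate_nats (fun v => [v])) gs ++ [b], acc) = ([b], rev gs ++ acc).
Proof.
  induction gs as [|[n l] gs IH]; intros A fuel acc b H.
  - simpl. clear H. induction fuel; auto.
  - destruct fuel as [|x fuel]; simpl in H; [lia|]. cbn [fold_left flat_map rev].
    replace (parse_step _) with (flat_map (gate_nats (fun v : nat => [v])) gs ++ [b], (n, l) :: acc).
    + rewrite IH by lia. now rewrite <- app_assoc.
    + destruct l as [v|p|o p1 p2]; try reflexivity. unfold parse_step. simpl. now rewrite op_of_code.
Qed.

Lemma parse_circ_nats C b :
  parse (circ_nats (fun v => [v]) C ++ [b]) = ((outg C, gates C), b).
Proof.
  unfold circ_nats, parse, parse_all. cbn [app]. fold (gate_nats (fun v : nat => [v])).
  rewrite parse_gates.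
  - cbn [fst snd]. rewrite app_nil_r. now rewrite rev_involutive.
  - rewrite length_app. etransitivity; [|apply Nat.le_add_r].
    induction (gates C) as [|g gs IH]; simpl; [lia|]. rewrite length_app. lia.
Qed.

Lemma parse_encN C b : parse (tokens (encN C b)) = ((outg C, gates C), b).
Proof. unfold encN. rewrite tokens_code_list. apply parse_circ_nats. Qed.

Lemma sz_op (o : op) : sz o <= 20.
Proof. destruct o; rewrite sz_enc; cbv; lia. Qed.

Lemma sz_LIn {V : encType} (v : V) : sz (LIn v) = sz (0, v).
Proof. now rewrite !sz_enc. Qed.

Lemma sz_LNeg {V : encType} p : sz (@LNeg V p) = sz (1, p).
Proof. now rewrite !sz_enc. Qed.

Lemma sz_LBin {V : encType} o p1 p2 : sz (@LBin V o p1 p2) = sz (2, (o, (p1, p2))).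
Proof. now rewrite !sz_enc. Qed.

Lemma CF_tokens {m} {X : encType} (f : X -> list bool) : CF m f -> CF m (fun x => tokens (f x)).
Proof.
  intros F. unfold tokens. apply CF_rev, CF_snd.
  apply CF_fold_add with (step := fun _ => token_step) (q := fun _ => 20);
    [unfold token_step; cf|cf|cf|solve_poly|].
  intros _ [[[|c p] n] ts] b; unfold token_step; cbn [fst snd].
  - sz_simpl. pose proof (sz_bool b). lia.
  - destruct (xorb c b); sz_simpl.
    + assert (sz 0 = 1) by reflexivity. pose proof (sz_pos c). pose proof (sz_pos p). lia.
    + pose proof (sz_dbl b n). pose proof (sz_pos c). pose proof (sz_pos p). lia.
Qed.

Lemma CF_parse {m} {X : encType} (f : X -> list nat) : CF m f -> CF m (fun x => parse (f x)).
Proof.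
  intros F. apply (CF_comp parse); [|exact F]. clear F.
  assert (S : CF m parse_all).
  { apply CF_fold_add with (step := fun _ s _ => parse_step s) (q := fun _ => 100);
      [|cf|cf|solve_poly|].
    - apply (CF_comp parse_step); [|cf]. unfold parse_step, op_of. cf.
    - intros _ [r acc] _. unfold parse_step. cbn [fst snd].
      destruct r as [|n [|t [|v r]]]; try lia.
      assert (sz 0 = 1) by reflexivity. assert (sz 1 = 5) by reflexivity.
      assert (sz 2 = 7) by reflexivity.
      destruct (t =? 0); [|destruct (t =? 1); [|destruct r as [|p1 [|p2 r]]; try lia]]; sz_simpl;
        rewrite ?sz_LIn, ?sz_LNeg, ?sz_LBin; sz_simpl; pose proof (sz_op (op_of v)); lia. }
  unfold parse. cf.
Qed.

(** * Exponent vectors and the reduction on words *)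

Definition val_step (q : nat) (s : nat * nat) : nat * nat :=
  if (2 <=? q) && negb (fst s =? 0) && (fst s mod q =? 0) then (fst s / q, S (snd s)) else s.

(** The digits of [n] serve as fuel: a factor of at least 2 can be divided out at most that
    often. *)
Definition valuation (q n : nat) : nat := snd (fold_left (fun s (_ : bool) => val_step q s) (nbits n) (n, 0)).

Lemma valuation_correct q e r : 2 <= q -> 0 < r -> ~ Nat.divide q r -> valuation q (q ^ e * r) = e.
Proof.
  intros Hq Hr Hd. unfold valuation.
  assert (E : forall l e k, e <= length l ->
    fold_left (fun s (_ : bool) => val_step q s) l (q ^ e * r, k) = (r, k + e)).
  { clear e. induction l as [|x l IH]; intros e k He.
    - simpl in He. replace e with 0 by lia. simpl. now rewrite !Nat.add_0_r.
    - cbn [fold_left]. unfold val_step at 2. cbn [fst snd].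
      assert (Hq2 : (2 <=? q) = true) by (apply Nat.leb_le; lia). rewrite Hq2.
      destruct (Nat.eqb_spec (q ^ e * r) 0) as [Z|_].
      { pose proof (Nat.pow_nonzero q e). nia. }
      cbn [andb negb]. destruct e as [|e].
      + destruct (Nat.eqb_spec ((q ^ 0 * r) mod q) 0) as [Z|_].
        * rewrite Nat.pow_0_r, Nat.mul_1_l in Z. apply Nat.Lcm0.mod_divide in Z. contradiction.
        * apply (IH 0 k). lia.
      + rewrite Nat.pow_succ_r', <- Nat.mul_assoc, (Nat.mul_comm q).
        rewrite Nat.Div0.mod_mul, Nat.div_mul by lia. cbn [Nat.eqb].
        rewrite IH by (simpl in He; lia). f_equal. lia. }
  rewrite E; [reflexivity|].
  assert (P : 2 ^ e <= q ^ e * r) by (pose proof (Nat.pow_le_mono_l 2 q e Hq); nia).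
  pose proof (length_nbits_lt (q ^ e * r)) as P'.
  apply (Nat.pow_le_mono_r_iff 2); lia.
Qed.

(* The last coordinate counts the remaining prime factors; the numbers labelling the
   gates have none. *)
Definition vec (B : list nat) (n : nat) : elt :=
  if n =? 0 then None else Some (map (fun q => valuation q n) B ++ [0]).

(* A permutation of the operations, so that ill-formed circuits stay ill-formed. *)
Definition additive_op (o : op) : op :=
  match o with
  | OCup => OCup | OCap => OCap | OCompl => OCompl
  | OAdd => OMul | OSub => ODiv | OMul => OAdd | ODiv => OSub
  end.

Definition additive_label (B : list nat) (l : label nat) : label elt :=
  match l with
  | LIn v => LIn (vec B v)
  | LNeg p => LNeg p
  | LBin o p1 p2 => LBin (additive_op o) p1 p2
  end.

Definition additive (B : list nat) (C : circuit nat) : circuit elt :=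
  Circuit (map (fun g => (fst g, additive_label B (snd g))) (gates C)) (outg C).

Definition inputs {V} (gs : list (nat * label V)) : list V :=
  flat_map (fun g => match snd g with LIn v => [v] | _ => [] end) gs.

Definition reduce (basis : list nat -> list nat) (C : circuit nat) (b : nat) : list bool :=
  let B := basis (b :: inputs (gates C)) in encS (S (length B)) (additive B C) (vec B b).

(* Ill-formed input is detected by encoding the result of parsing again; it is sent to
   the empty word, which encodes nothing. *)
Definition reduction (basis : list nat -> list nat) (x : list bool) : list bool :=
  let p := parse (tokens x) in
  let C := Circuit (snd (fst p)) (fst (fst p)) in
  if beqb_list (encN C (snd p)) x then reduce basis C (snd p) else [].

Lemma reduction_encN basis C b : reduction basis (encN C b) = reduce basis C b.
Proof.
  unfold reduction. rewrite parse_encN. cbn [fst snd]. destruct C as [gs o]. cbn [gates outg].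
  now rewrite (proj2 (beqb_list_eq _ _) eq_refl).
Qed.

Lemma CF_valuation {m} {X : encType} (f g : X -> nat) :
  CF m f -> CF m g -> CF m (fun x => valuation (f x) (g x)).
Proof.
  intros F G. apply (CF_comp2 valuation); auto. clear F G. unfold valuation. apply CF_snd.
  apply CF_fold with (step := fun p s _ => val_step (fst p) s) (Q := fun n => 10 + 10 * n);
    [unfold val_step; cf|cf|cf|solve_poly|].
  intros [q n] l1 l2 E. cbn [fst snd] in *. change nat in q. change nat in n.
  change (@length (carrier bool_encType)) with (@length bool) in *.
  assert (B : forall l : list bool, bl (fst (fold_left (fun s _ => val_step q s) l (n, 0))) <= bl n /\
    snd (fold_left (fun s _ => val_step q s) l (n, 0)) <= length l).
  { induction l as [|b l IH] using rev_ind; [now split|].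
    rewrite fold_left_app, length_app. cbn [fold_left length]. unfold val_step at 1 3.
    set (s := fold_left _ _ _) in *.
    destruct (Nat.leb_spec 2 q); cbn [andb]; [|lia].
    destruct (negb (fst s =? 0) && (fst s mod q =? 0)); [|lia]. cbn [fst snd].
    pose proof (bl_mono (fst s / q) (fst s) (Nat.Div0.div_le_upper_bound (fst s) q (fst s) ltac:(nia))). lia. }
  specialize (B l1). destruct (fold_left _ _ _) as [n' e]. cbn [fst snd] in B.
  apply (f_equal (@length _)) in E. rewrite length_app in E.
  change (@length (carrier bool_encType)) with (@length bool) in *. fold (bl n) in E.
  pose proof (bl_le e e (Nat.pow_gt_lin_r 2 _ ltac:(lia))).
  sz_simpl. pose proof (bl_sz n). pose proof (bl_sz n'). pose proof (bl_sz e). lia.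
Qed.

Lemma CF_code_list {m} {X : encType} (f : X -> list nat) : CF m f -> CF m (fun x => code_list (f x)).
Proof.
  intros F. unfold code_list, code_nat.
  apply CF_ext with (f := fun x => flat_map (fun n => flat_map (fun b => [b; b])
    (if n =? 0 then [false] else rev (nbits n)) ++ [false; true]) (f x)).
  - intros x. apply flat_map_ext. intros n. now rewrite nat_bits_nbits.
  - cf.
Qed.

Lemma CF_op_nats {m} {X : encType} (f : X -> label nat) (g : X -> nat -> list nat) (h : op -> op) :
  CF m f -> CF m (fun p => g (fst p) (snd p)) ->
  CF m (fun x => match f x with LIn v => 0 :: g x v | LNeg p => [1; p]
                 | LBin o p1 p2 => [2; op_code (h o); p1; p2] end).
Proof.
  intros F G. pose proof (fun X f => @CF_op_fun m X _ h f) as H.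
  apply (CF_label_match f (fun x v => 0 :: g x v) (fun _ p => [1; p])
    (fun _ o p1 p2 => [2; op_code (h o); p1; p2])); [exact F|cf|cf|].
  apply CF_cons; [cf|]. apply CF_cons; [apply CF_op_code, H; cf|cf].
Qed.

#[global] Hint Extern 1 (CF _ _) => lazymatch goal with
  | |- CF _ (fun x => valuation (@?f x) (@?g x)) => apply (CF_valuation f g)
  | |- CF _ (fun x => code_list (@?f x)) => apply (CF_code_list f)
  | |- CF _ (fun x => tokens (@?f x)) => apply (CF_tokens f)
  | |- CF _ (fun x => parse (@?f x)) => apply (CF_parse f)
  end; cbv beta : cf.

Lemma CF_elt_nats_vec {m} {X : encType} (B : X -> list nat) (n : X -> nat) :
  CF m B -> CF m n -> CF m (fun x => elt_nats (vec (B x) (n x))).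
Proof.
  intros HB Hn. apply CF_ext with (f := fun x => if n x =? 0 then [0]
    else 1 :: map (fun q => valuation q (n x)) (B x) ++ [0]); [|cf].
  intros x. unfold vec. now destruct (n x =? 0).
Qed.

#[global] Hint Extern 1 (CF _ _) => lazymatch goal with
  | |- CF _ (fun x => elt_nats (vec (@?f x) (@?g x))) => apply (CF_elt_nats_vec f g)
  end; cbv beta : cf.

(** The tokens of the image are produced directly from the gates of the given circuit, so vectors
    need no tree encoding of their own. The gate list has the same form as in the code of the given
    circuit, and one lemma on labels covers both. *)
Lemma circ_nats_additive B C :
  circ_nats elt_nats (additive B C) = outg C :: length (gates C) ::
    flat_map (fun g => fst g :: match snd g with
      | LIn v => 0 :: elt_nats (vec B v) | LNeg p => [1; p]
      | LBin o p1 p2 => [2; op_code (additive_op o); p1; p2] end) (gates C).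
Proof.
  unfold circ_nats. cbn [additive gates outg]. rewrite length_map. do 2 f_equal.
  induction (gates C) as [|[n l] gs IH]; simpl; [reflexivity|]. rewrite IH. now destruct l.
Qed.

Lemma CF_reduction {m} basis : CF m basis -> CF m (reduction basis).
Proof.
  intros HB. set (P := fun x => parse (tokens x)). assert (HP : CF m P) by (unfold P; cf).
  set (I := fun x => basis (snd (P x) :: inputs (snd (fst (P x))))).
  assert (HI : CF m I) by (unfold I, inputs; cf).
  apply CF_ext with (f := fun x =>
    if beqb_list (code_list ((fst (fst (P x)) :: length (snd (fst (P x))) ::
        flat_map (fun g => fst g :: match snd g with LIn v => 0 :: [v] | LNeg p => [1; p]
          | LBin o p1 p2 => [2; op_code o; p1; p2] end) (snd (fst (P x)))) ++ [snd (P x)])) x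
    then code_list (S (length (I x)) :: (fst (fst (P x)) :: length (snd (fst (P x))) ::
        flat_map (fun g => fst g :: match snd g with LIn v => 0 :: elt_nats (vec (I x) v)
          | LNeg p => [1; p] | LBin o p1 p2 => [2; op_code (additive_op o); p1; p2] end)
        (snd (fst (P x)))) ++ elt_nats (vec (I x) (snd (P x)))) else []).
  { intros x. unfold reduction, reduce, encS. now rewrite circ_nats_additive. }
  assert (HG : forall (g : list bool -> nat -> list nat) (h : op -> op),
    CF m (fun p : list bool * nat => g (fst p) (snd p)) ->
    CF m (fun x => flat_map (fun g' => fst g' :: match snd g' with LIn v => 0 :: g x v
      | LNeg p => [1; p] | LBin o p1 p2 => [2; op_code (h o); p1; p2] end) (snd (fst (P x))))).
  { intros g h G. apply (CF_flat_map (fun x g' => fst g' :: match snd g' with LIn v => 0 :: g x v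
      | LNeg p => [1; p] | LBin o p1 p2 => [2; op_code (h o); p1; p2] end)); [|cf].
    apply CF_cons; [cf|].
    apply (CF_op_nats (fun p : list bool * (nat * label nat) => snd (snd p)) (fun p => g (fst p)));
      [cf|]. apply (CF_comp2 g (fun p : list bool * (nat * label nat) * nat => fst (fst p)) snd); cf. }
  pose proof (HG (fun _ v => [v]) (fun o => o) ltac:(cf)).
  pose proof (HG (fun x v => elt_nats (vec (I x) v)) additive_op ltac:(cf)).
  cf.
Qed.

(** * Coprime bases *)

Inductive gen (L : list nat) : nat -> Prop :=
| gen_1 : gen L 1
| gen_mul q n : In q L -> gen L n -> gen L (q * n).

Lemma gen_in L q : In q L -> gen L q.
Proof. intros H. rewrite <- (Nat.mul_1_r q). apply gen_mul; [exact H|apply gen_1]. Qed.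

Lemma gen_product L a b : gen L a -> gen L b -> gen L (a * b).
Proof.
  intros Ha Hb. induction Ha as [|q n Hq _ IH]; [now rewrite Nat.mul_1_l|].
  rewrite <- Nat.mul_assoc. now apply gen_mul.
Qed.

(** A nonzero product has no factor 0, so a generator 0, which may stem from the given numbers, need
    not be expressed over [L']. *)
Lemma gen_incl L L' n :
  (forall q, In q L -> q <> 0 -> gen L' q) -> n <> 0 -> gen L n -> gen L' n.
Proof.
  intros H Hn G. induction G as [|q n Hq _ IH]; [apply gen_1|].
  apply gen_product; [apply H; auto|apply IH]; intros ->; apply Hn; lia.
Qed.

Fixpoint coprimes (l : list nat) : Prop :=
  match l with [] => True | a :: l => (forall b, In b l -> Nat.gcd a b = 1) /\ coprimes l end.

Lemma coprimes_filter f l : coprimes l -> coprimes (filter f l).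
Proof.
  induction l as [|a l IH]; simpl; auto. intros [H C].
  destruct (f a); simpl; auto. split; auto. intros b Hb. apply filter_In in Hb. apply H, Hb.
Qed.

(* [fst s] are the numbers still to be decomposed, [snd s] the coprime ones. *)
Definition refine_step (s : list nat * list nat) : list nat * list nat :=
  match fst s with
  | [] => s
  | a :: t =>
      if a <=? 1 then (t, snd s)
      else match filter (fun b => negb (Nat.gcd a b =? 1)) (snd s) with
           | [] => (t, a :: snd s)
           | b :: _ => (Nat.gcd a b :: a / Nat.gcd a b :: b / Nat.gcd a b :: t,
                        filter (fun c => negb (c =? b)) (snd s))
           end
  end.

Definition refine_inv (s : list nat * list nat) : Prop :=
  (forall q, In q (snd s) -> 2 <= q) /\ coprimes (snd s).

(* Case analysis of a step, with [g] the common factor that is split off. *)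
Lemma refine_step_cases (P : list nat * list nat -> list nat * list nat -> Prop) :
  (forall D, P ([], D) ([], D)) ->
  (forall a t D, a <= 1 -> P (a :: t, D) (t, D)) ->
  (forall a t D, 2 <= a -> (forall b, In b D -> Nat.gcd a b = 1) -> P (a :: t, D) (t, a :: D)) ->
  (forall g a b t D, In (g * b) D -> (2 <= g * b -> 2 <= g) -> 1 <= g -> 2 <= g * a ->
     P (g * a :: t, D) (g :: a :: b :: t, filter (fun c => negb (c =? g * b)) D)) ->
  forall s, P s (refine_step s).
Proof.
  intros H0 H1 H2 H3 [[|a t] D]; unfold refine_step; cbn [fst snd]; [apply H0|].
  destruct (Nat.leb_spec a 1); [now apply H1|].
  destruct (filter _ D) as [|b l] eqn:E.
  - apply H2; [lia|]. intros b Hb. destruct (Nat.eqb_spec (Nat.gcd a b) 1); [assumption|].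
    assert (In b []) as []. rewrite <- E. apply filter_In. split; [assumption|].
    now apply negb_true_iff, Nat.eqb_neq.
  - assert (Hb : In b (b :: l)) by now left. rewrite <- E in Hb. apply filter_In in Hb.
    destruct Hb as [Hb Hg]. apply negb_true_iff, Nat.eqb_neq in Hg.
    destruct (Nat.gcd_divide_l a b) as [a' Ea], (Nat.gcd_divide_r a b) as [b' Eb].
    set (g := Nat.gcd a b) in *. rewrite Nat.mul_comm in Ea, Eb.
    assert (G : g <> 0) by (intros Z; rewrite Z in Ea; lia).
    assert (Ea' : a / g = a') by (rewrite Ea, Nat.mul_comm; now apply Nat.div_mul).
    assert (Eb' : b / g = b') by (rewrite Eb, Nat.mul_comm; now apply Nat.div_mul).
    rewrite Ea', Eb'. clearbody g. subst a b. apply H3; auto; lia.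
Qed.

Lemma refine_step_inv s : refine_inv s -> refine_inv (refine_step s).
Proof.
  apply (refine_step_cases (fun s s' => refine_inv s -> refine_inv s')); unfold refine_inv; cbn [fst snd].
  - auto.
  - auto.
  - intros a t D Ha Hg [I1 I2]. split; [|simpl; auto]. intros q [<-|Hq]; auto.
  - intros g a b t D Hb Hg Hg1 Ha [I1 I2]. split; [|now apply coprimes_filter].
    intros q Hq. apply filter_In in Hq. now apply I1.
Qed.

Definition weight (l : list nat) : nat := list_sum (map Nat.log2 l).

(** Splitting [g * a] and [g * b] into [g], [a], [b] lowers the sum of the logarithms by at least
    [Nat.log2 g], hence by at least 1, while the list of pending numbers grows by two; the factor 3
    outweighs this. Every other step removes a pending number without increasing the weights. *)
Definition potential (s : list nat * list nat) : nat :=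
  3 * (weight (fst s) + weight (snd s)) + length (fst s).

Lemma weight_filter f l : weight (filter f l) <= weight l.
Proof.
  induction l as [|a l IH]; unfold weight in *; simpl; [lia|]. destruct (f a); simpl; lia.
Qed.

Lemma weight_remove b l :
  In b l -> weight (filter (fun c => negb (c =? b)) l) + Nat.log2 b <= weight l.
Proof.
  induction l as [|a l IH]; intros H; [easy|]. simpl filter.
  destruct (Nat.eqb_spec a b) as [->|N].
  - simpl. pose proof (weight_filter (fun c => negb (c =? b)) l). unfold weight in *. simpl. lia.
  - destruct H as [->|H]; [congruence|]. specialize (IH H). unfold weight in *. simpl. lia.
Qed.

Lemma refine_step_potential s :
  refine_inv s -> fst s <> [] -> potential (refine_step s) < potential s.
Proof.
  apply (refine_step_cases (fun s s' => refine_inv s -> fst s <> [] -> potential s' < potential s));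
    unfold potential, refine_inv; cbn [fst snd].
  - intros D _ H. congruence.
  - intros a t D Ha _ _. unfold weight. simpl. lia.
  - intros a t D Ha _ _ _. unfold weight. simpl. lia.
  - intros g a b t D Hb Hg Hg1 Ha [I _] _. specialize (I _ Hb). specialize (Hg I).
    pose proof (weight_remove _ _ Hb).
    pose proof (Nat.log2_mul_below g a ltac:(lia) ltac:(lia)).
    pose proof (Nat.log2_mul_below g b ltac:(lia) ltac:(lia)).
    pose proof (Nat.log2_le_mono 2 g Hg) as L. change (Nat.log2 2) with 1 in L.
    unfold weight in *. simpl. lia.
Qed.

Lemma refine_step_gen s n :
  n <> 0 -> gen (fst s ++ snd s) n -> gen (fst (refine_step s) ++ snd (refine_step s)) n.
Proof.
  intros Hn. apply (refine_step_cases (fun s s' => gen (fst s ++ snd s) n -> gen (fst s' ++ snd s') n));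
    cbn [fst snd].
  - auto.
  - intros a t D Ha. apply gen_incl; [|exact Hn]. intros q [->|Hq] Hq0.
    + replace q with 1 by lia. apply gen_1.
    + now apply gen_in.
  - intros a t D _ _. apply gen_incl; [|exact Hn]. intros q Hq _. apply gen_in.
    rewrite in_app_iff in *. simpl in *. tauto.
  - intros g a b t D _ _ _ _. apply gen_incl; [|exact Hn]. intros q Hq _.
    set (L := _ ++ filter _ _).
    assert (Ig : gen L g) by (apply gen_in; now left).
    assert (Ia : gen L a) by (apply gen_in; right; now left).
    assert (Ib : gen L b) by (apply gen_in; right; right; now left).
    destruct Hq as [<-|Hq]; [now apply gen_product|].
    destruct (Nat.eq_dec q (g * b)) as [->|Hb]; [now apply gen_product|].
    apply gen_in. unfold L. rewrite in_app_iff in *. simpl. destruct Hq as [Hq|Hq]; [tauto|].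
    right. apply filter_In. split; [assumption|]. now apply negb_true_iff, Nat.eqb_neq.
Qed.

(** Its length dominates the initial potential: three copies of all digits for three times the
    weight, and one bit for each pending number. *)
Definition refine_fuel (l : list nat) : list bool :=
  let b := flat_map (fun n => nbits n) l in b ++ b ++ b ++ map (fun _ => true) l.

Definition coprime_basis (l : list nat) : list nat :=
  snd (fold_left (fun s (_ : bool) => refine_step s) (refine_fuel l) (l, [])).

Lemma log2_le_bl n : Nat.log2 n <= bl n.
Proof.
  destruct (Nat.eq_dec n 0) as [->|]; [apply le_n|].
  apply Nat.lt_le_incl, Nat.log2_lt_pow2; [lia|apply length_nbits_lt].
Qed.

Lemma weight_le l : weight l <= length (flat_map (fun n => nbits n) l).
Proof.
  induction l as [|a l IH]; unfold weight in *; simpl; [lia|].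
  rewrite length_app. pose proof (log2_le_bl a). unfold bl in *. lia.
Qed.

Lemma refine_steps fuel : forall s, refine_inv s -> (fst s <> [] -> potential s <= length fuel) ->
  let s' := fold_left (fun s (_ : bool) => refine_step s) fuel s in
  fst s' = [] /\ refine_inv s' /\
  forall n, n <> 0 -> gen (fst s ++ snd s) n -> gen (snd s') n.
Proof.
  induction fuel as [|x fuel IH]; intros s I P.
  - destruct s as [[|a t] D]; [simpl; auto|].
    specialize (P ltac:(discriminate)). unfold potential in P. simpl in P. lia.
  - cbn [fold_left]. destruct (IH (refine_step s)) as (F & I' & G).
    + now apply refine_step_inv.
    + intros H. assert (H' : fst s <> []).
      { intros E. apply H. unfold refine_step. now rewrite E. }
      specialize (P H'). pose proof (refine_step_potential s I H'). simpl length in P. lia.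
    + split; [exact F|split; [exact I'|]]. intros n Hn Gn. apply G; [exact Hn|].
      now apply refine_step_gen.
Qed.

Lemma coprime_basis_spec l :
  (forall q, In q (coprime_basis l) -> 2 <= q) /\ coprimes (coprime_basis l) /\
  forall n, In n l -> n <> 0 -> gen (coprime_basis l) n.
Proof.
  destruct (refine_steps (refine_fuel l) (l, [])) as (_ & [I1 I2] & G).
  - split; simpl; [easy|auto].
  - intros _. unfold potential, refine_fuel. cbn [fst snd]. rewrite !length_app, length_map.
    pose proof (weight_le l). unfold weight at 2. simpl. lia.
  - split; [exact I1|split; [exact I2|]]. intros n Hn H0. apply G; [exact H0|].
    apply gen_in, in_or_app. now left.
Qed.

Lemma refine_step_length s :
  length (fst (refine_step s)) + length (snd (refine_step s)) <= length (fst s) + length (snd s) + 2.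
Proof.
  apply (refine_step_cases (fun s s' => length (fst s') + length (snd s') <= length (fst s) + length (snd s) + 2));
    intros; cbn [fst snd length]; try lia.
  pose proof (filter_length_le (fun c => negb (c =? g * b)) D). lia.
Qed.

(** The numbers put in by a split divide numbers already present, so no number becomes longer. As a
    step also adds at most two entries, the state stays of polynomial size. *)
Lemma refine_step_bl K s :
  (forall n, In n (fst s ++ snd s) -> bl n <= K) ->
  forall n, In n (fst (refine_step s) ++ snd (refine_step s)) -> bl n <= K.
Proof.
  apply (refine_step_cases (fun s s' => (forall n, In n (fst s ++ snd s) -> bl n <= K) ->
    forall n, In n (fst s' ++ snd s') -> bl n <= K)); cbn [fst snd].
  - auto.
  - intros a t D _ H n Hn. apply H. now right.
  - intros a t D _ _ H n Hn. apply H. rewrite in_app_iff in *. simpl in *. tauto.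
  - intros g a b t D Hb _ Hg1 Ha H n Hn.
    pose proof (H (g * a) (or_introl eq_refl)) as Ka.
    pose proof (H (g * b) ltac:(apply in_or_app; now right)) as Kb.
    destruct Hn as [<-|[<-|[<-|Hn]]].
    + etransitivity; [apply bl_mono|exact Ka]. destruct a; [lia|]. rewrite Nat.mul_succ_r. lia.
    + etransitivity; [apply bl_mono|exact Ka]. nia.
    + etransitivity; [apply bl_mono|exact Kb]. nia.
    + apply H. right. rewrite in_app_iff in *. destruct Hn as [Hn|Hn]; [now left|right].
      now apply filter_In in Hn.
Qed.

Lemma refine_steps_size K (fuel : list bool) : forall s,
  (forall n, In n (fst s ++ snd s) -> bl n <= K) ->
  let s' := fold_left (fun s _ => refine_step s) fuel s in
  (forall n, In n (fst s' ++ snd s') -> bl n <= K) /\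
  length (fst s') + length (snd s') <= length (fst s) + length (snd s) + 2 * length fuel.
Proof.
  induction fuel as [|x fuel IH]; intros s H; cbn [fold_left]; [simpl; split; [exact H|lia]|].
  destruct (IH (refine_step s) (refine_step_bl _ _ H)) as [IH1 IH2]. split; [exact IH1|].
  pose proof (refine_step_length s). simpl length. lia.
Qed.

Lemma sz_nats K (l : list nat) : (forall n, In n l -> bl n <= K) -> sz l <= 1 + length l * (2 + 4 * K).
Proof.
  induction l as [|a l IH]; intros H; sz_simpl; [lia|].
  pose proof (bl_sz a). specialize (H a (or_introl eq_refl)) as Ha.
  specialize (IH (fun n Hn => H n (or_intror Hn))). simpl length. lia.
Qed.

Lemma sz_in {X : encType} (x : X) l : In x l -> sz x <= sz l.
Proof.
  induction l as [|y l IH]; intros H; [easy|]. rewrite sz_cons.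
  destruct H as [->|H]; [lia|]. specialize (IH H). lia.
Qed.

Lemma CF_coprime_basis m : CF m coprime_basis.
Proof.
  unfold coprime_basis. apply CF_snd.
  assert (F : CF m refine_fuel) by (unfold refine_fuel; cbv zeta; cf).
  destruct (CF_size _ F) as (q & Pq & Q).
  apply CF_fold with (step := fun _ s _ => refine_step s)
    (Q := fun n => 10 + 4 * (n + 2 * q n) * (2 + 4 * n)); [|cf|cf|solve_poly|].
  - apply (CF_comp refine_step); [unfold refine_step; cf|cf].
  - intros l l1 l2 E. specialize (Q l). pose proof (sz_length (refine_fuel l)) as HL.
    rewrite E, length_app in HL. rewrite E in Q. change (list nat) in l.
    pose proof (sz_length l : length l <= _).
    change (list bool) in l1. change (list bool) in l2.
    change (@length (carrier bool_encType)) with (@length bool) in *.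
    assert (G : forall s', (forall n, In n (fst s' ++ snd s') -> bl n <= sz l) ->
      length (fst s') + length (snd s') <= length l + 0 + 2 * length l1 ->
      sz s' <= 10 + 4 * (sz l + 2 * q (sz l)) * (2 + 4 * sz l)).
    { intros [s1 s2] B1 B2. cbn [fst snd] in *.
      pose proof (sz_nats (sz l) s1 ltac:(intros; apply B1, in_or_app; now left)).
      pose proof (sz_nats (sz l) s2 ltac:(intros; apply B1, in_or_app; now right)).
      pose proof (Nat.mul_le_mono_r (length s1 + length s2) (sz l + 2 * q (sz l)) (2 + 4 * sz l)
        ltac:(lia)).
      sz_simpl. lia. }
    destruct (refine_steps_size (sz l) l1 (l, [])) as [B1 B2]; [|exact (G _ B1 B2)].
    cbn [fst snd]. rewrite app_nil_r. intros n Hn. pose proof (bl_sz n).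
    pose proof (sz_in n l Hn). lia.
Qed.

(** * Prime bases *)

Definition prime (p : nat) : Prop := 2 <= p /\ forall d, Nat.divide d p -> d = 1 \/ d = p.

Definition least_factor (n : nat) : option nat := find (fun d => n mod d =? 0) (seq 2 (n - 1)).

Lemma find_seq_least f a k d : find f (seq a k) = Some d ->
  a <= d /\ f d = true /\ forall e, a <= e < d -> f e = false.
Proof.
  revert a. induction k as [|k IH]; intros a; simpl; [discriminate|].
  destruct (f a) eqn:E.
  - intros [= <-]. split; [lia|split; [assumption|lia]].
  - intros F. destruct (IH _ F) as (H1 & H2 & H3). split; [lia|split; [assumption|]].
    intros e He. destruct (Nat.eq_dec e a) as [->|]; [assumption|]. apply H3. lia.
Qed.

Lemma least_factor_spec n : 2 <= n -> exists p, least_factor n = Some p /\ prime p /\ Nat.divide p n.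
Proof.
  intros Hn. unfold least_factor. destruct (find _ _) as [d|] eqn:E.
  - apply find_seq_least in E. destruct E as (H1 & H2 & H3).
    apply Nat.eqb_eq, Nat.Lcm0.mod_divide in H2. exists d. split; [reflexivity|split; [|assumption]].
    split; [assumption|]. intros e He. destruct (Nat.eq_dec e 1), (Nat.eq_dec e d); auto. exfalso.
    pose proof (Nat.divide_pos_le e d ltac:(lia) He).
    assert (e <> 0) by (intros ->; destruct He; lia).
    specialize (H3 e ltac:(lia)). apply Nat.eqb_neq in H3. apply H3.
    apply Nat.Lcm0.mod_divide. now apply Nat.divide_trans with d.
  - exfalso. pose proof (find_none _ _ E n) as F. cbv beta in F. rewrite Nat.Div0.mod_same in F.
    specialize (F ltac:(apply in_seq; lia)). discriminate.
Qed.

Lemma prime_divisor n : 2 <= n -> exists p, prime p /\ Nat.divide p n.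
Proof. intros H. destruct (least_factor_spec n H) as (p & _ & Hp). now exists p. Qed.

Lemma prime_gcd p n : prime p -> Nat.gcd p n = 1 \/ Nat.divide p n.
Proof.
  intros [_ H]. destruct (H _ (Nat.gcd_divide_l p n)) as [E|E]; [now left|right].
  rewrite <- E. apply Nat.gcd_divide_r.
Qed.

Lemma gcd_mul_1 a b c : Nat.gcd a b = 1 -> Nat.gcd a c = 1 -> Nat.gcd a (b * c) = 1.
Proof.
  intros Hb Hc. set (g := Nat.gcd a (b * c)).
  assert (Ga : Nat.divide g a) by apply Nat.gcd_divide_l.
  assert (Gbc : Nat.divide g (b * c)) by apply Nat.gcd_divide_r.
  assert (Gb : Nat.gcd g b = 1).
  { apply Nat.divide_1_r. rewrite <- Hb. apply Nat.gcd_greatest; [|apply Nat.gcd_divide_r].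
    apply Nat.divide_trans with g; [apply Nat.gcd_divide_l|assumption]. }
  apply Nat.divide_1_r. rewrite <- Hc. apply Nat.gcd_greatest; [assumption|].
  now apply Nat.gauss with b.
Qed.

(** Suppose the candidate divides a nonzero entry of [ns]. A smaller prime factor of it divides the
    same entry and has therefore been kept before. So division by the primes kept decides whether
    the candidate is prime. *)
Definition prime_step (ns : list nat) (s : nat * list nat) : nat * list nat :=
  (S (fst s),
   if existsb (fun n => negb (n =? 0) && (n mod fst s =? 0)) ns
      && forallb (fun q => negb (fst s mod q =? 0)) (snd s)
   then fst s :: snd s else snd s).

(** [list_max ns - 1] rounds try the candidates from 2 to [list_max ns]. *)
Definition prime_basis (ns : list nat) : list nat :=
  snd (Nat.iter (list_max ns - 1) (prime_step ns) (2, [])).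

Lemma prime_steps ns j :
  let s := Nat.iter j (prime_step ns) (2, []) in
  fst s = 2 + j /\ coprimes (snd s) /\
  forall p, In p (snd s) <->
    prime p /\ p < 2 + j /\ exists n, In n ns /\ n <> 0 /\ Nat.divide p n.
Proof.
  induction j as [|j IH].
  - simpl. split; [reflexivity|split; [exact Logic.I|]]. intros p. split; [easy|].
    intros ([H _] & H' & _). lia.
  - rewrite Nat.iter_succ. cbv zeta in IH. destruct (Nat.iter j (prime_step ns) (2, [])) as [d B].
    cbn [fst snd] in IH. destruct IH as (-> & C & HB). unfold prime_step. cbn [fst snd].
    set (c := existsb _ ns && _).
    assert (K : c = true <-> prime (2 + j) /\ exists n, In n ns /\ n <> 0 /\ Nat.divide (2 + j) n).
    { unfold c. rewrite andb_true_iff, existsb_exists, forallb_forall.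
      setoid_rewrite andb_true_iff. setoid_rewrite negb_true_iff. setoid_rewrite Nat.eqb_neq.
      setoid_rewrite Nat.eqb_eq. setoid_rewrite Nat.Lcm0.mod_divide. split.
      - intros [(n & Hn & H0 & D) F]. split; [|eauto]. split; [lia|]. intros e He.
        destruct (Nat.eq_dec e 1), (Nat.eq_dec e (2 + j)); auto. exfalso.
        pose proof (Nat.divide_pos_le e (2 + j) ltac:(lia) He).
        assert (2 <= e) by (destruct e as [|[|e]]; [destruct He; lia|lia|lia]).
        destruct (prime_divisor e) as (p & Pp & Dp); [assumption|].
        pose proof (Nat.divide_pos_le p e ltac:(lia) Dp).
        pose proof (Nat.divide_trans _ _ _ Dp He) as Dpj.
        apply (F p); [|exact Dpj]. apply HB. split; [exact Pp|split; [lia|]].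
        exists n. split; [exact Hn|split; [exact H0|now apply Nat.divide_trans with (2 + j)]].
      - intros [P H]. split; [exact H|]. intros q Hq Dq. apply HB in Hq.
        destruct Hq as ([Hq _] & Hqj & _). apply P in Dq. lia. }
    clearbody c. split; [reflexivity|split].
    + destruct c; [|exact C]. split; [|exact C]. intros q Hq. apply HB in Hq.
      destruct Hq as (Pq & Hqj & _). destruct (proj1 K eq_refl) as [P _].
      destruct (prime_gcd (2 + j) q P) as [G|G]; [exact G|].
      apply Pq in G. lia.
    + intros p. replace (2 + S j) with (S (2 + j)) by lia. rewrite Nat.lt_succ_r, Nat.le_lteq.
      assert (E : In p (if c then 2 + j :: B else B) <-> (p = 2 + j /\ c = true) \/ In p B).
      { destruct c; simpl; intuition congruence. }
      rewrite E, HB, K. split.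
      * intros [[-> [P H]]|(P & L & H)]; auto.
      * intros (P & [L| ->] & H); auto.
Qed.

Lemma prime_basis_spec ns :
  (forall q, In q (prime_basis ns) -> prime q) /\ coprimes (prime_basis ns) /\
  forall p n, prime p -> In n ns -> n <> 0 -> Nat.divide p n -> In p (prime_basis ns).
Proof.
  unfold prime_basis. destruct (prime_steps ns (list_max ns - 1)) as (_ & C & H).
  split; [intros q Hq; now apply H in Hq|split; [exact C|]].
  intros p n Hp Hn H0 Hd. apply H. split; [assumption|split; [|eauto]].
  pose proof (Nat.divide_pos_le p n ltac:(lia) Hd). destruct Hp as [Hp _].
  pose proof (proj1 (list_max_le ns (list_max ns)) (le_n _)) as M. rewrite Forall_forall in M.
  specialize (M n Hn). lia.
Qed.

Definition nat_prod (l : list nat) : nat := fold_right Nat.mul 1 l.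

Lemma coprimes_prod_divide l N :
  coprimes l -> (forall q, In q l -> Nat.divide q N) -> Nat.divide (nat_prod l) N.
Proof.
  induction l as [|a l IH]; intros C H; simpl; [apply Nat.divide_1_l|].
  destruct C as [Ca C]. destruct (H a (or_introl eq_refl)) as [k Hk].
  destruct (IH C (fun q Hq => H q (or_intror Hq))) as [k' Hk'].
  assert (G : Nat.gcd a (nat_prod l) = 1).
  { clear - Ca. induction l as [|b l IH]; simpl; [apply Nat.divide_1_r, Nat.gcd_divide_r|].
    apply gcd_mul_1; [now apply Ca; left|]. apply IH. intros c Hc. apply Ca. now right. }
  assert (D : Nat.divide (nat_prod l) k).
  { apply Nat.gauss with a; [|now rewrite Nat.gcd_comm]. exists k'. rewrite <- Hk', Hk. lia. }
  destruct D as [c ->]. exists c. rewrite Hk. lia.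
Qed.

(** The product of [l] is at least [2 ^ length l] and, by coprimality, divides the product of the
    nonzero entries of [ns], which is bounded by 2 to the total number of their digits. This keeps
    the list of primes short during trial division. *)
Lemma coprimes_length l (ns : list nat) :
  coprimes l -> (forall q, In q l -> 2 <= q) ->
  (forall q, In q l -> exists n, In n ns /\ n <> 0 /\ Nat.divide q n) ->
  length l <= length (flat_map (fun n => nbits n) ns).
Proof.
  (* Entries 0 are replaced by 1, lest [N] be 0 and the divisibility give no bound. *)
  intros C H2 H. set (N := nat_prod (map (fun n => if n =? 0 then 1 else n) ns)).
  assert (P1 : 2 ^ length l <= nat_prod l).
  { clear - H2. induction l as [|a l IH]; [simpl; lia|]. cbn [length]. rewrite Nat.pow_succ_r'. simpl.
    pose proof (H2 a (or_introl eq_refl)). specialize (IH (fun q Hq => H2 q (or_intror Hq))). nia. }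
  assert (P2 : Nat.divide (nat_prod l) N).
  { apply coprimes_prod_divide; [exact C|]. intros q Hq. destruct (H q Hq) as (n & Hn & H0 & D).
    subst N. clear - Hn H0 D. induction ns as [|m ns IH]; [easy|]. simpl. destruct Hn as [->|Hn].
    - destruct (Nat.eqb_spec n 0); [congruence|]. now apply Nat.divide_mul_l.
    - apply Nat.divide_mul_r. auto. }
  assert (P3 : 0 < N <= 2 ^ length (flat_map (fun n => nbits n) ns)).
  { subst N. clear. induction ns as [|m ns IH]; [simpl; lia|]. simpl.
    rewrite length_app, Nat.pow_add_r. pose proof (length_nbits_lt m).
    destruct (Nat.eqb_spec m 0); nia. }
  apply Nat.divide_pos_le in P2; [|lia]. apply (Nat.pow_le_mono_r_iff 2); lia.
Qed.

Lemma length_flat_map_nbits (ns : list nat) : length (flat_map (fun n => nbits n) ns) <= sz ns.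
Proof.
  induction ns as [|n ns IH]; sz_simpl; [simpl; lia|]. simpl. rewrite length_app.
  pose proof (length_nbits_sz n). lia.
Qed.

Lemma list_max_lt_pow (ns : list nat) : list_max ns < 2 ^ sz ns.
Proof.
  pose proof (sz_pos ns). pose proof (Nat.pow_nonzero 2 (sz ns)).
  enough (list_max ns <= 2 ^ sz ns - 1) by lia. apply list_max_le, Forall_forall. intros n Hn.
  pose proof (length_nbits_lt n). pose proof (length_nbits_sz n). pose proof (sz_in n ns Hn).
  pose proof (Nat.pow_le_mono_r 2 (length (nbits n)) (sz ns) ltac:(lia) ltac:(lia)). lia.
Qed.

(** The candidate runs through exponentially many values but has polynomially many digits; together
    with the short list of primes found, it fits into polynomial space. *)
Lemma CF_prime_basis : CF false prime_basis.
Proof.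
  set (f := fun p : list nat * (nat * list nat) => (fst p, prime_step (fst p) (snd p))).
  assert (IT : forall ns j, Nat.iter j f (ns, (2, [])) = (ns, Nat.iter j (prime_step ns) (2, []))).
  { intros ns j. induction j as [|j IH]; [reflexivity|]. rewrite !Nat.iter_succ, IH. reflexivity. }
  apply CF_ext with (f := fun ns => snd (snd (Nat.iter (list_max ns - 1) f (ns, (2, []))))).
  { intros ns. rewrite IT. reflexivity. }
  apply CF_snd, CF_snd.
  (* The loop runs as long as some entry is at least the candidate, which avoids computing
     [list_max]. For [m = false] the bound on the number of rounds by [N] is vacuous. *)
  apply CF_while with (c := fun p => existsb (fun n => fst (snd p) <=? n) (fst p))
    (Q := fun n => 30 + 30 * n + n * (2 + 4 * (n + 2))) (N := fun n => n);
    [cf|cf|unfold f, prime_step; cf|solve_poly|solve_poly| | | |discriminate].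
  - intros ns j Hj. cbn. rewrite IT. cbn [fst snd]. rewrite (proj1 (prime_steps ns j)).
    apply not_false_is_true. intros E.
    assert (M : list_max ns <= 1 + j); [|lia].
    apply list_max_le, Forall_forall. intros n Hn. destruct (Nat.le_gt_cases n (1 + j)); auto.
    assert (T : existsb (fun n => 2 + j <=? n) ns = true); [|congruence].
    apply existsb_exists. exists n. split; [assumption|]. apply Nat.leb_le. lia.
  - intros ns. cbn. rewrite IT. cbn [fst snd]. rewrite (proj1 (prime_steps ns _)).
    apply not_true_is_false. intros E. apply existsb_exists in E. destruct E as (n & Hn & E).
    apply Nat.leb_le in E.
    pose proof (proj1 (list_max_le ns (list_max ns)) (le_n _)) as M. rewrite Forall_forall in M.
    specialize (M n Hn). lia.
  - intros ns j Hj. cbn. rewrite IT. change (list nat) in ns.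
    destruct (prime_steps ns j) as (E & C & H).
    assert (B : 2 + j < 2 ^ (sz ns + 2)).
    { pose proof (list_max_lt_pow ns). rewrite Nat.pow_add_r. simpl (2 ^ 2). lia. }
    assert (L : length (snd (Nat.iter j (prime_step ns) (2, []))) <= sz ns).
    { etransitivity; [apply coprimes_length with (ns := ns)|apply length_flat_map_nbits].
      - exact C.
      - intros q Hq. apply H in Hq. apply Hq.
      - intros q Hq. apply H in Hq. apply Hq. }
    pose proof (sz_nats (sz ns + 2) (snd (Nat.iter j (prime_step ns) (2, [])))) as Z.
    destruct (Nat.iter j (prime_step ns) (2, [])) as [d acc]. cbn [fst snd] in *. subst d.
    specialize (Z ltac:(intros q Hq; apply bl_le; apply H in Hq; lia)).
    pose proof (bl_le _ _ B). pose proof (bl_sz (2 + j)).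
    pose proof (Nat.mul_le_mono_r (length acc) (sz ns) (2 + 4 * (sz ns + 2)) L).
    sz_simpl. lia.
Qed.

(** * From functions on trees to Turing machines *)

(** The top of [IO] is the last letter, so the code of the list can be written from its end: a
    letter [b] puts [true :: bits (tbool b)] in front, pushed in reverse order. *)
Definition load : sp :=
  sseq (SPush RM false)
    (SLoop (SBind (STst IO) (SRet false)
      (SBind (SPop IO)
        (sseq (SPush RM false) (sseq (SPush RM true) (SRet true)))
        (sseq (SPush RM false) (sseq (SPush RM false) (sseq (SPush RM true)
          (sseq (SPush RM true) (SRet true)))))))).

(** The leading bit distinguishes a further entry from the end of the list; the next one is the
    letter, followed by two more bits if the letter is [true]. *)
Definition store : sp :=
  SLoop (SBind (SPop RM) (SRet false)
    (SBind (SPop RM)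
      (sseq (SPush IO false) (SRet true))
      (sseq (SPop RM) (sseq (SPop RM) (sseq (SPush IO true) (SRet true)))))).

Lemma sx_load S (l : list bool) :
  5 * length l + 10 <= S ->
  exists t, sx S load (values l []) (values [] (bits (enc (rev l)))) false t /\ t <= 10 * length l + 10.
Proof.
  intros HS.
  assert (L : forall l m : list bool, length l + length (bits (enc m)) + 4 * length l + 5 <= S -> exists t,
    sx S (SLoop (SBind (STst IO) (SRet false)
      (SBind (SPop IO)
        (sseq (SPush RM false) (sseq (SPush RM true) (SRet true)))
        (sseq (SPush RM false) (sseq (SPush RM false) (sseq (SPush RM true)
          (sseq (SPush RM true) (SRet true))))))))
      (values l (bits (enc m))) (values [] (bits (enc (rev l ++ m)))) false t /\ t <= 10 * length l + 5).
  { clear. induction l as [|b l IH]; intros m HS.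
    - exists 2. split; [|simpl; lia]. unfold values. sx_done.
    - destruct (IH (b :: m)) as (t & E & T).
      { destruct b; simpl in *; lia. }
      simpl rev. rewrite <- app_assoc. simpl app.
      destruct b; eexists; (split; [eapply sx_loop; [|exact E]|]).
      + unfold values. sx_branch. sx_branch. sx_then. sx_then. sx_then. sx_then. sx_prim.
      + simpl. lia.
      + unfold values. sx_branch. sx_branch. sx_then. sx_then. sx_prim.
      + simpl. lia. }
  destruct (L l []) as (t & E & T); [simpl; lia|].
  exists (1 + t). split; [|lia]. rewrite app_nil_r in E.
  eapply sx_sseq; [|exact E]. unfold values. sx_prim.
Qed.

Lemma sx_store S (l : list bool) : forall io,
  length io + length l + sz l + 5 <= S ->
  exists t, sx S store (values io (bits (enc l))) (values (rev l ++ io) []) false t /\ t <= 10 * length l + 5.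
Proof.
  induction l as [|b l IH]; intros io HS.
  - exists 2. split; [|simpl; lia]. revert HS. sz_simpl. intros HS. unfold values, store. simpl.
    apply sx_stop. change 2 with (1 + 1). eapply sx_bind; [sx_prim|]. sx_prim.
  - destruct (IH (b :: io)) as (t & E & T).
    { revert HS. sz_simpl. pose proof (sz_pos b). simpl. lia. }
    rewrite sz_cons in HS. pose proof (sz_pos b).
    pose proof (sz_enc l : sz l = length (bits (enc_list l))) as W.
    simpl rev. rewrite <- app_assoc. simpl app.
    destruct b; eexists; (split; [eapply sx_loop; [|exact E]|]).
    + unfold values. sx_branch. sx_branch. sx_then. sx_then. sx_then. sx_prim.
    + simpl. lia.
    + unfold values. sx_branch. sx_branch. sx_then. sx_prim.
    + simpl. lia.
Qed.

Lemma CF_TM m (f : list bool -> list bool) :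
  CF m f -> exists p T S, poly T /\ poly S /\ forall x,
    exists t, (m = true -> t <= T (length x)) /\
      halted (prog_TM p) (run (prog_TM p) t x) /\ output (run (prog_TM p) t x) = f x /\
      tape_len (run (prog_TM p) t x) <= S (length x).
Proof.
  intros F. apply CF_computes in F. destruct (computes_size _ _ _ F) as (r & Pr & R).
  destruct F as (p & q & Pq & H).
  (* A word of length [n] has a code of at most [4 * n + 1] bits; [q] bounds the work on it and [r]
     the size of the result. *)
  set (S := fun n => 10 * n + 20 + q (4 * n + 1) + 2 * r (4 * n + 1)).
  exists (tape_prog (sseq load (sseq p store))),
    (fun n => (10 * n + 10 + q (4 * n + 1) + 10 * r (4 * n + 1) + 5) * (40 * (S n + 2))),
    (fun n => 5 * S n + 10).
  assert (PS : poly S).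
  { unfold S. pose proof (poly_comp q (fun n => 4 * n + 1) Pq).
    pose proof (poly_comp r (fun n => 4 * n + 1) Pr). solve_poly. }
  split; [|split; [solve_poly|]].
  { pose proof (poly_comp q (fun n => 4 * n + 1) Pq).
    pose proof (poly_comp r (fun n => 4 * n + 1) Pr). solve_poly. }
  intros x. specialize (R x Logic.I). destruct (H x Logic.I [] []) as (t & b & E & Ht).
  pose proof (proj2 (sz_bits x)) as Hx. rewrite Nat.add_comm, sz_enc in Hx.
  pose proof (proj1 Pq _ _ Hx). pose proof (proj1 Pr _ _ Hx).
  pose proof (sz_length (f x) : length (f x) <= _) as Hf. rewrite sz_enc in Hf.
  set (n := length x) in *.
  destruct (sx_load (S n) (rev x)) as (t1 & E1 & T1).
  { rewrite length_rev. unfold S. fold n. lia. }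
  destruct (sx_store (S n) (f x) []) as (t2 & E2 & T2).
  { rewrite sz_enc. unfold S. cbn [length]. lia. }
  rewrite rev_involutive in E1. rewrite length_rev in T1. fold n in T1.
  rewrite !app_nil_r in E. rewrite app_nil_r in E2. cbn [length Nat.add] in E.
  assert (E' : sx (S n) (sseq load (sseq p store)) (Stacks (rev x) [] [] [] [])
    (values (rev (f x)) []) false (t1 + (t + t2))).
  { eapply sx_sseq; [exact E1|]. eapply sx_sseq; [|exact E2].
    eapply sx_mono; [exact E|]. unfold S. lia. }
  destruct (stacks_TM_correct _ x _ _ _ (S n) ltac:(unfold S; fold n; lia) E') as (t' & Ht' & C1 & C2 & C3).
  exists t'. split; [|split; [exact C1|split; [|exact C3]]].
  - intros Hm. specialize (Ht Hm). etransitivity; [exact Ht'|]. apply Nat.mul_le_mono_r. lia.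
  - rewrite C2. simpl. apply rev_involutive.
Qed.

Lemma CF_poly_time f : CF true f -> poly_time_computable f.
Proof.
  intros F. destruct (CF_TM _ _ F) as (p & T & S & PT & _ & H).
  destruct (poly_bound _ PT) as (a & d & Had).
  exists (prog_TM p), a, d. split; [apply prog_TM_wf|]. intros x.
  destruct (H x) as (t & Ht & H1 & H2 & _). exists t. split; [|now split].
  specialize (Ht eq_refl). specialize (Had (length x)). lia.
Qed.

Lemma CF_poly_space f : CF false f -> poly_space_computable f.
Proof.
  intros F. destruct (CF_TM _ _ F) as (p & T & S & _ & PS & H).
  destruct (poly_bound _ PS) as (a & d & Had).
  exists (prog_TM p), a, d. split; [apply prog_TM_wf|]. intros x.
  destruct (H x) as (t & _ & H1 & H2 & H3). exists t. split; [|split]; auto.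
  specialize (Had (length x)). lia.
Qed.

(** * Coordinates *)

Fixpoint power_product (B e : list nat) : nat :=
  match B, e with q :: B, k :: e => q ^ k * power_product B e | _, _ => 1 end.

Definition vadd (e f : list nat) : list nat := map (fun p => fst p + snd p) (combine e f).
Definition vsub (e f : list nat) : list nat := map (fun p => fst p - snd p) (combine e f).
Definition vle (e f : list nat) : bool := forallb (fun p => fst p <=? snd p) (combine e f).

Lemma length_vadd e f : length e = length f -> length (vadd e f) = length e.
Proof. intros H. unfold vadd. rewrite length_map, length_combine. lia. Qed.

Lemma power_product_vadd B : forall e f, length e = length B -> length f = length B ->
  power_product B (vadd e f) = power_product B e * power_product B f.
Proof.
  induction B as [|q B IH]; intros [|k e] [|l f]; simpl; try lia.
  intros He Hf. unfold vadd in *. simpl. rewrite IH, Nat.pow_add_r by lia. lia.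
Qed.

Lemma power_product_zeros B : power_product B (map (fun _ => 0) B) = 1.
Proof. induction B as [|q B IH]; simpl; auto. now rewrite IH. Qed.

Lemma power_product_in B q : In q B -> exists e, length e = length B /\ power_product B e = q.
Proof.
  induction B as [|p B IH]; intros H; [easy|]. destruct H as [->|H].
  - exists (1 :: map (fun _ => 0) B). simpl. rewrite length_map, power_product_zeros. lia.
  - destruct (IH H) as (e & He & E). exists (0 :: e). simpl. lia.
Qed.

Lemma gen_power_product B n : gen B n -> exists e, length e = length B /\ power_product B e = n.
Proof.
  intros G. induction G as [|q n Hq _ (f & Hf & <-)].
  - exists (map (fun _ => 0) B). rewrite length_map. split; [reflexivity|apply power_product_zeros].
  - destruct (power_product_in B q Hq) as (e & He & <-). exists (vadd e f).
    rewrite length_vadd by lia. split; [exact He|now apply power_product_vadd].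
Qed.

Lemma gcd_pow_1 a q k : Nat.gcd a q = 1 -> Nat.gcd a (q ^ k) = 1.
Proof.
  intros H. induction k; simpl; [apply Nat.divide_1_r, Nat.gcd_divide_r|]. now apply gcd_mul_1.
Qed.

Lemma gcd_power_product a B : (forall q, In q B -> Nat.gcd a q = 1) ->
  forall e, Nat.gcd a (power_product B e) = 1.
Proof.
  induction B as [|q B IH]; intros H e; destruct e as [|k e]; simpl;
    try apply Nat.divide_1_r, Nat.gcd_divide_r.
  apply gcd_mul_1; [apply gcd_pow_1, H; now left|apply IH; intros p Hp; apply H; now right].
Qed.

Lemma pow_divide q k m k' m' :
  2 <= q -> Nat.gcd q m = 1 -> Nat.gcd q m' = 1 ->
  Nat.divide (q ^ k * m) (q ^ k' * m') -> k <= k' /\ Nat.divide m m'.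
Proof.
  intros Hq Hm Hm' D. split.
  - destruct (Nat.le_gt_cases k k') as [|L]; auto. exfalso.
    assert (E : Nat.divide (q ^ k' * q) (q ^ k' * m')).
    { eapply Nat.divide_trans; [|exact D]. apply Nat.divide_mul_l.
      exists (q ^ (k - k' - 1)). replace (q ^ k' * q) with (q ^ (k' + 1)).
      - rewrite <- Nat.pow_add_r. f_equal. lia.
      - now rewrite Nat.pow_add_r, Nat.pow_1_r. }
    apply Nat.mul_divide_cancel_l in E; [|apply Nat.pow_nonzero; lia].
    assert (Nat.divide q (Nat.gcd q m')) by (apply Nat.gcd_greatest; [apply Nat.divide_refl|exact E]).
    rewrite Hm' in H. apply Nat.divide_1_r in H. lia.
  - apply Nat.gauss with (q ^ k').
    + eapply Nat.divide_trans; [|exact D]. apply Nat.divide_factor_r.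
    + apply gcd_pow_1. now rewrite Nat.gcd_comm.
Qed.

(* For (i), [R] contains only 1; for (ii), [R] consists of all positive numbers prime to [B]
   and [w] counts prime factors. *)
Record cofactors (B : list nat) (R : nat -> Prop) (w : nat -> nat) : Prop := {
  basis_ge_2 : forall q, In q B -> 2 <= q;
  basis_coprimes : coprimes B;
  cofactor_1 : R 1;
  cofactor_mul : forall r s, R (r * s) <-> R r /\ R s;
  cofactor_prime_to : forall r, R r -> 0 < r /\ forall q, In q B -> Nat.gcd q r = 1;
  w_mul : forall r s, R r -> R s -> w (r * s) = w r + w s;
  w_split : forall r s t, R r -> R s -> R t -> w r = w s + w t ->
    exists s' t', R s' /\ R t' /\ w s' = w s /\ w t' = w t /\ r = s' * t';
  w_sub : forall s t, R s -> R t -> w t <= w s -> exists r, R r /\ w r = w s - w t;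
  w_zero : forall r, R r -> w r = 0 -> r = 1
}.

Section Coordinates.
Context (B : list nat) (R : nat -> Prop) (w : nat -> nat) (HB : cofactors B R w).

(** A relation, because in (i) a number outside the monoid generated by [B] has no coordinates.
    Infinity stands for 0, and the last entry keeps of the cofactor nothing but its weight. *)
Definition coord (x : nat) (u : elt) : Prop :=
  (x = 0 /\ u = None) \/
  exists e r, length e = length B /\ R r /\ x = power_product B e * r /\ u = Some (e ++ [w r]).

Lemma w_1 : w 1 = 0.
Proof.
  pose proof (w_mul _ _ _ HB 1 1 (cofactor_1 _ _ _ HB) (cofactor_1 _ _ _ HB)) as H.
  rewrite Nat.mul_1_l in H. lia.
Qed.

Lemma power_product_pos e : 0 < power_product B e.
Proof.
  pose proof (basis_ge_2 _ _ _ HB) as H. clear HB. revert e.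
  induction B as [|q B' IH]; intros [|k e]; simpl; try lia.
  pose proof (Nat.pow_nonzero q k). specialize (H q (or_introl eq_refl)) as Hq.
  specialize (IH (fun p Hp => H p (or_intror Hp)) e). nia.
Qed.

(** Each basis element is prime to the rest of the product, so [pow_divide] peels off one of them at
    a time. Here divisibility turns into the componentwise order; the uniqueness of coordinates and
    the treatment of division rest on it. *)
Lemma power_product_divide : forall e r f s,
  length e = length B -> length f = length B -> R r -> R s ->
  Nat.divide (power_product B e * r) (power_product B f * s) -> vle e f = true /\ Nat.divide r s.
Proof.
  intros e r f s He Hf Hr Hs.
  assert (Gr : forall q, In q B -> Nat.gcd q r = 1) by apply (cofactor_prime_to _ _ _ HB r Hr).
  assert (Gs : forall q, In q B -> Nat.gcd q s = 1) by apply (cofactor_prime_to _ _ _ HB s Hs).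
  pose proof (basis_ge_2 _ _ _ HB) as H2. pose proof (basis_coprimes _ _ _ HB) as HC.
  clear HB Hr Hs. revert e f He Hf.
  induction B as [|q B' IH]; intros [|k e] [|l f]; simpl; try lia.
  - rewrite !Nat.add_0_r. auto.
  - intros He Hf D. rewrite <- !Nat.mul_assoc in D. destruct HC as [Hq HC].
    apply pow_divide in D.
    + destruct D as [Hkl D]. destruct (IH (fun p Hp => Gr p (or_intror Hp))
        (fun p Hp => Gs p (or_intror Hp)) (fun p Hp => H2 p (or_intror Hp)) HC e f) as [V Drs];
        [lia|lia|exact D|]. split; [|exact Drs]. unfold vle in *. simpl. rewrite V.
      apply andb_true_iff. split; [now apply Nat.leb_le|reflexivity].
    + apply H2. now left.
    + apply gcd_mul_1; [now apply gcd_power_product|apply Gr; now left].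
    + apply gcd_mul_1; [now apply gcd_power_product|apply Gs; now left].
Qed.

Lemma vle_antisym : forall e f, length e = length f -> vle e f = true -> vle f e = true -> e = f.
Proof.
  induction e as [|k e IH]; intros [|l f] L; simpl in L; try lia; auto. unfold vle in *. simpl.
  rewrite !andb_true_iff, !Nat.leb_le. intros [H1 H2] [H3 H4]. f_equal; [lia|]. apply IH; auto.
Qed.

Lemma power_product_inj e r f s :
  length e = length B -> length f = length B -> R r -> R s ->
  power_product B e * r = power_product B f * s -> e = f /\ r = s.
Proof.
  intros He Hf Hr Hs E.
  destruct (power_product_divide e r f s) as [V D]; auto; [rewrite E; apply Nat.divide_refl|].
  destruct (power_product_divide f s e r) as [V' D']; auto; [rewrite E; apply Nat.divide_refl|].
  split; [apply vle_antisym; auto; lia|now apply Nat.divide_antisym].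
Qed.

Lemma cofactor_pos r : R r -> 0 < r.
Proof. intros H. now apply (cofactor_prime_to _ _ _ HB). Qed.

Lemma coord_zero u : coord 0 u -> u = None.
Proof.
  intros [[_ H]|(e & r & _ & Hr & E & _)]; auto.
  pose proof (power_product_pos e). pose proof (cofactor_pos r Hr). nia.
Qed.

Lemma coord_None x : coord x None -> x = 0.
Proof. intros [[H _]|(e & r & _ & _ & _ & E)]; [auto|discriminate]. Qed.

Lemma coord_functional x u v : coord x u -> coord x v -> u = v.
Proof.
  intros Hu Hv. destruct (Nat.eq_dec x 0) as [->|H0].
  { now rewrite (coord_zero _ Hu), (coord_zero _ Hv). }
  destruct Hu as [[]|(e & r & He & Hr & -> & ->)]; [contradiction|].
  destruct Hv as [[]|(f & s & Hf & Hs & E & ->)]; [contradiction|].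
  apply power_product_inj in E; auto. now destruct E as [-> ->].
Qed.

Lemma coord_dim x u : coord x u -> dim (S (length B)) u.
Proof.
  intros [[_ ->]|(e & r & He & _ & _ & ->)]; simpl; [exact I|].
  rewrite length_app. simpl. lia.
Qed.

Lemma combine_snoc (e f : list nat) i j : length e = length f ->
  combine (e ++ [i]) (f ++ [j]) = combine e f ++ [(i, j)].
Proof.
  revert f. induction e as [|k e IH]; intros [|l f] H; simpl in *; try lia; auto.
  f_equal. apply IH. lia.
Qed.

Lemma addE_snoc e f i j : length e = length f ->
  addE (Some (e ++ [i])) (Some (f ++ [j])) = Some (vadd e f ++ [i + j]).
Proof. intros H. simpl. rewrite combine_snoc, map_app by assumption. reflexivity. Qed.

Lemma length_vsub e f : length e = length f -> length (vsub e f) = length e.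
Proof. intros H. unfold vsub. rewrite length_map, length_combine. lia. Qed.

Lemma coord_mul a b u v : coord a u -> coord b v -> coord (a * b) (addE u v).
Proof.
  intros [[-> ->]|(e & r & He & Hr & -> & ->)]; [intros _; now left|].
  intros [[-> ->]|(f & s & Hf & Hs & -> & ->)]; [left; split; [lia|reflexivity]|].
  right. exists (vadd e f), (r * s). split; [rewrite length_vadd; lia|].
  split; [now apply (cofactor_mul _ _ _ HB)|]. split.
  - rewrite power_product_vadd by assumption. lia.
  - rewrite addE_snoc by lia. now rewrite (w_mul _ _ _ HB).
Qed.

(** The given [a] and [b] only witness that [u] and [v] are attained; their product may differ from
    [x], since the last coordinate forgets which primes occur. The factors of [x] are found by
    distributing its own cofactor with [w_split]. *)
Lemma coord_factor x a b u v : coord a u -> coord b v -> coord x (addE u v) ->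
  exists a' b', coord a' u /\ coord b' v /\ x = a' * b'.
Proof.
  intros Ha Hb Hx.
  destruct Ha as [[-> ->]|(e & r & He & Hr & -> & ->)].
  { apply coord_None in Hx. exists 0, b. split; [now left|auto]. }
  destruct Hb as [[-> ->]|(f & s & Hf & Hs & -> & ->)].
  { apply coord_None in Hx. exists (power_product B e * r), 0.
    split; [right; now exists e, r|split; [now left|lia]]. }
  rewrite addE_snoc in Hx by lia.
  destruct Hx as [[_ Hx]|(g & t & Hg & Ht & -> & Hx)]; [discriminate|].
  injection Hx as Hx. apply app_inj_tail in Hx. destruct Hx as [<- Hw].
  destruct (w_split _ _ _ HB t r s Ht Hr Hs (eq_sym Hw)) as (r' & s' & Hr' & Hs' & Wr & Ws & ->).
  exists (power_product B e * r'), (power_product B f * s'). split; [|split].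
  - right. exists e, r'. now rewrite Wr.
  - right. exists f, s'. now rewrite Ws.
  - rewrite power_product_vadd by assumption. lia.
Qed.

Lemma subE_snoc e f i j : length e = length f ->
  subE (Some (e ++ [i])) (Some (f ++ [j])) =
  if vle f e && (j <=? i) then Some (Some (vsub e f ++ [i - j])) else None.
Proof.
  intros H. simpl. rewrite combine_snoc, forallb_app, map_app by assumption.
  simpl. rewrite andb_true_r.
  replace (forallb (fun p => snd p <=? fst p) (combine e f)) with (vle f e); [reflexivity|].
  clear. revert f. induction e as [|k e IH]; intros [|l f]; unfold vle in *; simpl; auto.
  now rewrite IH.
Qed.

Lemma vadd_vsub e f : length e = length f -> vle f e = true -> vadd (vsub e f) f = e.
Proof.
  revert f. induction e as [|k e IH]; intros [|l f] H; simpl in H; try lia; auto.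
  unfold vle, vadd, vsub in *. simpl. rewrite andb_true_iff, Nat.leb_le. intros [H1 H2].
  f_equal; [lia|]. apply IH; auto.
Qed.

(** Since [b] divides [a], both the exponents and the cofactors compare, so the difference is
    defined. The condition [b <> 0] excludes infinity as a subtrahend. *)
Lemma coord_div a b u v x : coord a u -> coord b v -> b <> 0 -> a = x * b ->
  exists z, coord x z /\ subE u v = Some z.
Proof.
  intros Ha [[-> _]|(f & s & Hf & Hs & -> & ->)] H0 E; [contradiction|].
  destruct Ha as [[-> ->]|(e & r & He & Hr & -> & ->)].
  { exists None. split; [left; split; [nia|reflexivity]|reflexivity]. }
  destruct (power_product_divide f s e r) as [V [t Ht]]; auto; [exists x; lia|].
  subst r. apply (cofactor_mul _ _ _ HB) in Hr. destruct Hr as [Rt _].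
  exists (Some (vsub e f ++ [w t])). split.
  - right. exists (vsub e f), t. split; [rewrite length_vsub; lia|split; [exact Rt|split; [|reflexivity]]].
    rewrite <- (vadd_vsub e f) in E by (auto; lia).
    rewrite power_product_vadd in E by (rewrite ?length_vsub; lia).
    apply (Nat.mul_cancel_r _ _ (power_product B f * s)); [assumption|]. lia.
  - rewrite subE_snoc by lia. rewrite V, (w_mul _ _ _ HB) by assumption.
    rewrite (proj2 (Nat.leb_le _ _)) by lia. simpl. do 4 f_equal. lia.
Qed.

(** A defined difference does not make [a] divisible by [b], as their cofactors may involve
    different primes. But the fibre of [u] contains multiples of [b], namely [x * b] for every [x]
    in the fibre of [z], and that fibre is nonempty by [w_sub]. *)
Lemma coord_sub a b u v z : coord a u -> coord b v -> subE u v = Some z ->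
  (exists x, coord x z) /\ b <> 0 /\ forall x, coord x z -> coord (x * b) u.
Proof.
  intros Ha Hb E.
  destruct v as [v|]; [|destruct u; discriminate].
  assert (B0 : b <> 0) by (intros ->; apply coord_zero in Hb; discriminate).
  destruct Ha as [[-> ->]|(e & r & He & Hr & -> & ->)].
  { injection E as <-. split; [exists 0; now left|split; [exact B0|]].
    intros x Hx. apply coord_None in Hx. subst x. now left. }
  pose proof Hb as Hb'.
  destruct Hb as [[]|(f & s & Hf & Hs & -> & Ev)]; [contradiction|]. injection Ev as ->.
  rewrite subE_snoc in E by lia.
  destruct (vle f e) eqn:V; [|discriminate]. destruct (Nat.leb_spec (w s) (w r)) as [W|]; [|discriminate].
  injection E as <-. split; [|split; [exact B0|]].
  - destruct (w_sub _ _ _ HB r s Hr Hs W) as (t & Rt & Wt).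
    exists (power_product B (vsub e f) * t). right. exists (vsub e f), t.
    rewrite Wt. split; [rewrite length_vsub; lia|auto].
  - intros x Hx. pose proof (coord_mul _ _ _ _ Hx Hb') as M.
    rewrite addE_snoc, vadd_vsub in M by (rewrite ?length_vsub; auto; lia).
    replace (w r - w s + w s) with (w r) in M by lia. exact M.
Qed.

(** The factor [c] collects the powers of the basis elements that the induction has passed. *)
Lemma valuations : forall e c, 0 < c -> (forall q, In q B -> Nat.gcd q c = 1) ->
  length e = length B -> map (fun q => valuation q (c * power_product B e)) B = e.
Proof.
  pose proof (basis_ge_2 _ _ _ HB) as H2. pose proof (basis_coprimes _ _ _ HB) as HC. clear HB.
  induction B as [|q B' IH]; intros [|k e] c Hc G L; simpl in L; try lia; [reflexivity|].
  simpl. destruct HC as [Hq HC].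
  specialize (H2 q (or_introl eq_refl)) as Hq2. f_equal.
  - replace (c * (q ^ k * power_product B' e)) with (q ^ k * (c * power_product B' e)) by lia.
    assert (G' : Nat.gcd q (c * power_product B' e) = 1).
    { apply gcd_mul_1; [apply G; now left|]. now apply gcd_power_product. }
    apply valuation_correct; [exact Hq2| |].
    + destruct (Nat.eq_dec (c * power_product B' e) 0) as [Z|]; [|lia].
      rewrite Z, Nat.gcd_0_r in G'. lia.
    + intros D. assert (D' : Nat.divide q 1).
      { rewrite <- G'. apply Nat.gcd_greatest; [apply Nat.divide_refl|exact D]. }
      apply Nat.divide_1_r in D'. lia.
  - rewrite Nat.mul_assoc. apply IH; [intros; apply H2; now right|exact HC| | |lia].
    + pose proof (Nat.pow_nonzero q k). nia.
    + intros p Hp. apply gcd_mul_1; [apply G; now right|]. apply gcd_pow_1.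
      rewrite Nat.gcd_comm. now apply Hq.
Qed.

Lemma coord_vec n : (n <> 0 -> gen B n) -> coord n (vec B n).
Proof.
  intros G. unfold vec. destruct (Nat.eqb_spec n 0) as [->|H0]; [now left|].
  destruct (gen_power_product B n (G H0)) as (e & He & <-). right. exists e, 1.
  rewrite w_1. split; [exact He|split; [apply (cofactor_1 _ _ _ HB)|split; [lia|]]].
  pose proof (valuations e 1 ltac:(lia)) as V. setoid_rewrite Nat.mul_1_l in V.
  rewrite V; auto. intros q _. apply Nat.divide_1_r, Nat.gcd_divide_r.
Qed.

(** The last coordinate 0 forces the cofactor 1 by [w_zero], so the fibre of [vec B n] is a single
    number. Hence input gates denote singletons on both sides. *)
Lemma coord_vec_inj n x : (n <> 0 -> gen B n) -> coord x (vec B n) -> x = n.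
Proof.
  intros G Hx. pose proof (coord_vec n G) as Hn.
  destruct (Nat.eq_dec n 0) as [->|H0].
  { rewrite (coord_zero _ Hn) in Hx. now apply coord_None in Hx. }
  destruct (gen_power_product B n (G H0)) as (e & He & <-).
  assert (Hn' : coord (power_product B e) (Some (e ++ [0]))).
  { right. exists e, 1. rewrite w_1.
    split; [exact He|split; [apply (cofactor_1 _ _ _ HB)|split; [lia|reflexivity]]]. }
  rewrite (coord_functional _ _ _ Hn Hn') in Hx.
  destruct Hx as [[_ Hx]|(f & r & Hf & Hr & -> & Hx)]; [discriminate|].
  injection Hx as Hx. apply app_inj_tail in Hx. destruct Hx as [-> Hw].
  rewrite (w_zero _ _ _ HB r Hr (eq_sym Hw)). lia.
Qed.

(** What complements require of the coordinates. In (i) this fails, because finite vectors with a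
    nonzero last entry are not attained. *)
Definition total : Prop :=
  (forall x, exists u, coord x u) /\ (forall u, dim (S (length B)) u -> exists x, coord x u).

(** [A] is the full preimage of [A'], hence a union of fibres, and every element of [A'] is
    attained. The second clause supplies representatives when operands of sums and differences are
    taken from [A']. *)
Definition corresponds (A : nat -> Prop) (A' : elt -> Prop) : Prop :=
  (forall x, A x <-> exists u, coord x u /\ A' u) /\ (forall u, A' u -> exists x, coord x u).

Lemma corresponds_bin o A A' D D' : corresponds A A' -> corresponds D D' ->
  corresponds (binN o A D) (binS (additive_op o) A' D').
Proof.
  intros [A1 A2] [D1 D2]. destruct o; simpl additive_op; unfold binN, binS.
  - split; [|intros u [H|H]; auto]. intros x. rewrite A1, D1. split.
    + intros [(u & Hu & Au)|(u & Hu & Du)]; exists u; auto.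
    + intros (u & Hu & [Au|Du]); [left|right]; eauto.
  - split; [|intros u [H _]; auto]. intros x. rewrite A1, D1. split.
    + intros [(u & Hu & Au) (v & Hv & Dv)]. rewrite (coord_functional _ _ _ Hv Hu) in Dv.
      exists u. auto.
    + intros (u & Hu & Au & Du). split; exists u; auto.
  (* The cases [OCompl], [OAdd] and [OSub], in which [binN] and, after [additive_op], also [binS]
     take their default, the empty set. *)
  - split; [|easy]. intros x. split; [easy|intros (u & _ & [])].
  - split; [|easy]. intros x. split; [easy|intros (u & _ & [])].
  - split; [|easy]. intros x. split; [easy|intros (u & _ & [])].
  - split.
    + intros x. split.
      * intros (a & b & Ha & Hb & ->). apply A1 in Ha. apply D1 in Hb.
        destruct Ha as (u & Hu & Au), Hb as (v & Hv & Dv). exists (addE u v).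
        split; [now apply coord_mul|eauto].
      * intros (z & Hz & u & v & Au & Dv & ->). destruct (A2 u Au) as [a Ha], (D2 v Dv) as [b Hb].
        destruct (coord_factor x a b u v Ha Hb Hz) as (a' & b' & Ha' & Hb' & ->).
        exists a', b'. rewrite A1, D1. split; [now exists u|split; [now exists v|reflexivity]].
    + intros z (u & v & Au & Dv & ->). destruct (A2 u Au) as [a Ha], (D2 v Dv) as [b Hb].
      exists (a * b). now apply coord_mul.
  - split.
    + intros x. split.
      * intros (a & b & Ha & Hb & H0 & E). apply A1 in Ha. apply D1 in Hb.
        destruct Ha as (u & Hu & Au), Hb as (v & Hv & Dv).
        destruct (coord_div a b u v x Hu Hv H0 E) as (z & Hz & Ez).
        exists z. split; [exact Hz|]. now exists u, v.
      * intros (z & Hz & u & v & Au & Dv & E). destruct (A2 u Au) as [a Ha], (D2 v Dv) as [b Hb].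
        destruct (coord_sub a b u v z Ha Hb E) as (_ & H0 & M).
        exists (x * b), b. rewrite A1, D1.
        split; [exists u; auto|split; [now exists v|split; [exact H0|reflexivity]]].
    + intros z (u & v & Au & Dv & E). destruct (A2 u Au) as [a Ha], (D2 v Dv) as [b Hb].
      now destruct (coord_sub a b u v z Ha Hb E).
Qed.

Lemma corresponds_compl A A' : total -> corresponds A A' ->
  corresponds (fun x => ~ A x) (fun u => dim (S (length B)) u /\ ~ A' u).
Proof.
  intros [T1 T2] [A1 _]. split; [|intros u [H _]; auto]. intros x. rewrite A1. split.
  - intros N. destruct (T1 x) as [u Hu]. exists u. split; [exact Hu|split; [now apply coord_dim with x|]].
    intros H. eauto.
  - intros (u & Hu & _ & N) (v & Hv & Av). rewrite (coord_functional _ _ _ Hv Hu) in Av. contradiction.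
Qed.

Lemma corresponds_input v : (v <> 0 -> gen B v) ->
  corresponds (fun x => x = v) (fun u => u = vec B v).
Proof.
  intros G. split.
  - intros x. split; [intros ->; exists (vec B v); split; [now apply coord_vec|reflexivity]|].
    intros (u & Hu & ->). now apply coord_vec_inj.
  - intros u ->. exists v. now apply coord_vec.
Qed.

(** Gate numbers are kept, so [min] and [max] select the operands of a quotient and of the
    corresponding difference in the same order. Totality is demanded only if a complement gate
    occurs. *)
Lemma corresponds_sem gs :
  (forall v, In v (inputs gs) -> v <> 0 -> gen B v) ->
  (forall n p, In (n, LNeg p) gs -> total) ->
  forall g, corresponds
    (sem nat nat (fun v x => x = v) (fun A x => ~ A x) binN gs g)
    (sem elt elt (fun v x => x = v) (fun A x => dim (S (length B)) x /\ ~ A x) binS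
      (map (fun g => (fst g, additive_label B (snd g))) gs) g).
Proof.
  induction gs as [|[n l] gs IH]; intros HI HN g.
  { split; [intros x; split; [easy|intros (u & _ & [])]|intros u []]. }
  assert (IH' := IH (fun v Hv => HI v ltac:(apply in_or_app; now right))
    (fun m p Hp => HN m p (or_intror Hp))). clear IH.
  simpl. destruct (Nat.eqb g n); [|apply IH'].
  destruct l as [v|p|o p1 p2]; simpl.
  - apply corresponds_input. apply HI. simpl. now left.
  - apply corresponds_compl; [|apply IH']. apply (HN n p). now left.
  - apply corresponds_bin; apply IH'.
Qed.

Lemma semS_additive C b :
  (forall v, In v (b :: inputs (gates C)) -> v <> 0 -> gen B v) ->
  (forall n p, In (n, LNeg p) (gates C) -> total) ->
  semN C b <-> semS (S (length B)) (additive B C) (vec B b).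
Proof.
  intros HI HN.
  destruct (corresponds_sem (gates C) (fun v Hv => HI v (or_intror Hv)) HN (outg C)) as [H _].
  unfold semN, semS. cbn [additive gates outg]. rewrite H.
  pose proof (coord_vec b (HI b (or_introl eq_refl))) as Hb. split; [|eauto].
  intros (u & Hu & Au). now rewrite (coord_functional _ _ _ Hb Hu).
Qed.
End Coordinates.

(** * Prime factors *)

Lemma cofactors_one B : (forall q, In q B -> 2 <= q) -> coprimes B ->
  cofactors B (fun r => r = 1) (fun _ => 0).
Proof.
  intros H2 HC. constructor; auto.
  - intros r s. rewrite Nat.eq_mul_1. reflexivity.
  - intros r ->. split; [lia|]. intros q _. apply Nat.divide_1_r, Nat.gcd_divide_r.
  - intros r s t -> -> -> _. exists 1, 1. auto.
  - intros s t _ _ _. exists 1. auto.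
Qed.

(** Counts prime factors with multiplicity by splitting off the least factor above 1, which is
    prime. The quotient is smaller than [n], so [n] itself is enough fuel. *)
Fixpoint omega_fuel (fuel n : nat) : nat :=
  match fuel with
  | 0 => 0
  | S fuel => match least_factor n with None => 0 | Some p => S (omega_fuel fuel (n / p)) end
  end.

Definition Omega (n : nat) : nat := omega_fuel n n.

Lemma omega_fuel_factors fuel : forall n, 0 < n <= fuel ->
  exists l, Forall prime l /\ nat_prod l = n /\ length l = omega_fuel fuel n.
Proof.
  induction fuel as [|fuel IH]; intros n Hn; [lia|].
  destruct (Nat.eq_dec n 1) as [->|H1].
  - exists []. simpl. auto.
  - destruct (least_factor_spec n) as (p & E & Pp & [m Em]); [lia|]. simpl. rewrite E.
    pose proof (proj1 Pp) as P2.
    assert (Em' : n / p = m) by (rewrite Em; apply Nat.div_mul; lia). rewrite Em'.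
    destruct (IH m) as (l & Hl & Pl & Ll); [nia|]. exists (p :: l). simpl. rewrite Pl, Ll.
    split; [now constructor|split; [lia|reflexivity]].
Qed.

Lemma Omega_factors n : 0 < n -> exists l, Forall prime l /\ nat_prod l = n /\ length l = Omega n.
Proof. intros H. now apply omega_fuel_factors. Qed.

Lemma prime_mul_divide p a b : prime p -> Nat.divide p (a * b) -> Nat.divide p a \/ Nat.divide p b.
Proof.
  intros Hp D. destruct (prime_gcd p a Hp) as [G|G]; [right|now left].
  now apply Nat.gauss with a.
Qed.

Lemma prime_divide_prod p l : prime p -> Forall prime l -> Nat.divide p (nat_prod l) -> In p l.
Proof.
  intros Hp Hl. induction Hl as [|q l Hq Hl IH]; simpl; intros D.
  - apply Nat.divide_1_r in D. destruct Hp. lia.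
  - apply prime_mul_divide in D; [|exact Hp]. destruct D as [D|D]; [left|right; auto].
    apply Hq in D. destruct Hp. destruct D; lia.
Qed.

Lemma nat_prod_app l1 l2 : nat_prod (l1 ++ l2) = nat_prod l1 * nat_prod l2.
Proof. induction l1 as [|a l1 IH]; simpl; [lia|]. rewrite IH. lia. Qed.

Lemma nat_prod_pos l : Forall prime l -> 0 < nat_prod l.
Proof. induction 1 as [|p l [Hp _] _ IH]; simpl; [lia|]. nia. Qed.

(** The part of unique factorization that concerns the number of factors: by Euclid's lemma each
    prime of [l1] occurs in [l2], and both occurrences are cancelled. *)
Lemma prime_factors_length l1 : forall l2, Forall prime l1 -> Forall prime l2 ->
  nat_prod l1 = nat_prod l2 -> length l1 = length l2.
Proof.
  induction l1 as [|p l1 IH]; intros l2 H1 H2 E.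
  - destruct l2 as [|q l2]; [reflexivity|]. simpl in E. inversion_clear H2 as [|? ? [Hq _] _].
    symmetry in E. apply Nat.eq_mul_1 in E. lia.
  - inversion_clear H1 as [|? ? Hp H1'].
    assert (Ip : In p l2).
    { apply prime_divide_prod; auto. rewrite <- E. simpl. apply Nat.divide_factor_l. }
    apply in_split in Ip. destruct Ip as (k1 & k2 & ->).
    apply Forall_app in H2. destruct H2 as [Hk1 Hk2]. inversion_clear Hk2 as [|? ? _ Hk2'].
    rewrite length_app. simpl. rewrite (IH (k1 ++ k2)), length_app; auto.
    + apply Forall_app. auto.
    + rewrite nat_prod_app in *. simpl in E. pose proof (proj1 Hp).
      apply (Nat.mul_cancel_l _ _ p); lia.
Qed.

Lemma Omega_prod l : Forall prime l -> Omega (nat_prod l) = length l.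
Proof.
  intros H. destruct (Omega_factors (nat_prod l) (nat_prod_pos l H)) as (l' & H' & E & <-).
  now apply prime_factors_length.
Qed.

Lemma Omega_mul r s : 0 < r -> 0 < s -> Omega (r * s) = Omega r + Omega s.
Proof.
  intros Hr Hs. destruct (Omega_factors r Hr) as (l & Pl & <- & <-).
  destruct (Omega_factors s Hs) as (k & Pk & <- & <-).
  rewrite <- nat_prod_app, Omega_prod; [apply length_app|]. now apply Forall_app.
Qed.

Definition prime_to (B : list nat) (r : nat) : Prop := 0 < r /\ forall q, In q B -> Nat.gcd q r = 1.

Lemma prime_to_mul B r s : prime_to B (r * s) <-> prime_to B r /\ prime_to B s.
Proof.
  unfold prime_to. split.
  - intros [H G].
    assert (D : forall a b q, Nat.gcd q (a * b) = 1 -> Nat.gcd q a = 1).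
    { intros a b q E. apply Nat.divide_1_r. rewrite <- E. apply Nat.gcd_greatest.
      - apply Nat.gcd_divide_l.
      - apply Nat.divide_mul_l, Nat.gcd_divide_r. }
    split; (split; [nia|]); intros q Hq; specialize (G q Hq).
    + now apply D with s.
    + apply D with r. now rewrite Nat.mul_comm.
  - intros [[Hr Gr] [Hs Gs]]. split; [nia|]. intros q Hq. apply gcd_mul_1; auto.
Qed.

(** Euclid's argument, applied to the product of [B] plus 1. *)
Lemma new_prime B : (forall q, In q B -> prime q) -> exists p, prime p /\ ~ In p B.
Proof.
  intros HB. assert (P : Forall prime B) by now apply Forall_forall.
  pose proof (nat_prod_pos B P). destruct (prime_divisor (nat_prod B + 1)) as (p & Pp & D); [lia|].
  exists p. split; [exact Pp|]. intros Hp.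
  assert (D' : Nat.divide p (nat_prod B)).
  { apply in_split in Hp. destruct Hp as (k1 & k2 & ->). rewrite nat_prod_app. simpl.
    apply Nat.divide_mul_r, Nat.divide_factor_l. }
  apply (Nat.divide_add_cancel_r _ _ _ D') in D. apply Nat.divide_1_r in D. destruct Pp. lia.
Qed.

(** The powers of one prime outside [B] attain every count. *)
Lemma Omega_onto B k : (forall q, In q B -> prime q) -> exists r, prime_to B r /\ Omega r = k.
Proof.
  intros HB. destruct (new_prime B HB) as (p & Pp & Hp). exists (nat_prod (repeat p k)).
  assert (P : Forall prime (repeat p k)).
  { apply Forall_forall. intros x Hx. now apply repeat_spec in Hx as ->. }
  split; [|now rewrite Omega_prod, repeat_length].
  split; [now apply nat_prod_pos|]. intros q Hq. destruct (prime_gcd q (nat_prod (repeat p k)) (HB q Hq)); auto.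
  apply prime_divide_prod in H; auto. apply repeat_spec in H. congruence.
Qed.

Lemma cofactors_Omega B : (forall q, In q B -> prime q) -> coprimes B ->
  cofactors B (prime_to B) Omega.
Proof.
  intros HB HC. constructor.
  - intros q Hq. apply HB, Hq.
  - exact HC.
  - split; [lia|]. intros q _. apply Nat.divide_1_r, Nat.gcd_divide_r.
  - apply prime_to_mul.
  - auto.
  - intros r s [Hr _] [Hs _]. now apply Omega_mul.
  (* A list of prime factors of [r] is cut after [Omega s] entries; both parts are prime to [B]
     because [r] is. *)
  - intros r s t Rr _ _ W. destruct (Omega_factors r (proj1 Rr)) as (l & Pl & <- & L).
    rewrite <- (firstn_skipn (Omega s) l) in *. rewrite nat_prod_app in *.
    apply Forall_app in Pl. destruct Pl as [P1 P2]. apply prime_to_mul in Rr. destruct Rr as [R1 R2].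
    exists (nat_prod (firstn (Omega s) l)), (nat_prod (skipn (Omega s) l)).
    rewrite !Omega_prod by assumption. rewrite <- L, firstn_skipn in W.
    rewrite length_firstn, length_skipn. repeat split; auto; try apply R1; try apply R2; lia.
  - intros s t _ _ _. apply Omega_onto, HB.
  - intros r [Hr _] W. destruct (Omega_factors r Hr) as (l & _ & <- & L).
    rewrite W in L. destruct l; [reflexivity|discriminate].
Qed.

(** Prime factors in [B] go into the exponents, all others into the cofactor. A prime outside [B] is
    prime to [B] because [B] consists of primes. *)
Lemma prime_decomposition B : (forall q, In q B -> prime q) -> forall x, 0 < x ->
  exists e r, length e = length B /\ prime_to B r /\ x = power_product B e * r.
Proof.
  intros HB x Hx. destruct (Omega_factors x Hx) as (l & Pl & <- & _). clear Hx.
  induction Pl as [|p l Hp _ (e & r & He & Hr & E)]; simpl.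
  - exists (map (fun _ => 0) B), 1. rewrite length_map, power_product_zeros.
    split; [reflexivity|split; [|reflexivity]]. split; [lia|]. intros q _.
    apply Nat.divide_1_r, Nat.gcd_divide_r.
  - rewrite E. destruct (in_dec Nat.eq_dec p B) as [I|N].
    + destruct (power_product_in B p I) as (f & Hf & F). exists (vadd f e), r.
      rewrite length_vadd, power_product_vadd, F by lia. split; [lia|split; [exact Hr|lia]].
    + exists e, (p * r). split; [exact He|split; [|lia]]. apply prime_to_mul. split; [|exact Hr].
      split; [destruct Hp; lia|]. intros q Hq.
      destruct (prime_gcd q p (HB q Hq)) as [G|G]; [exact G|].
      apply Hp in G. destruct (HB q Hq). destruct G; [lia|congruence].
Qed.

Lemma total_primes B : (forall q, In q B -> prime q) -> total B (prime_to B) Omega.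
Proof.
  intros HB. split.
  - intros x. destruct (Nat.eq_dec x 0) as [->|Hx]; [exists None; now left|].
    destruct (prime_decomposition B HB x ltac:(lia)) as (e & r & He & Hr & E).
    exists (Some (e ++ [Omega r])). right. now exists e, r.
  - intros [l|] Hl; [|exists 0; now left]. simpl in Hl.
    destruct (exists_last (l := l)) as (e & k & ->); [intros ->; discriminate|].
    rewrite length_app in Hl. simpl in Hl.
    destruct (Omega_onto B k HB) as (r & Hr & <-). exists (power_product B e * r).
    right. exists e, r. split; [lia|auto].
Qed.

Lemma gen_primes B n : n <> 0 -> (forall p, prime p -> Nat.divide p n -> In p B) -> gen B n.
Proof.
  intros H0 H. destruct (Omega_factors n ltac:(lia)) as (l & Pl & <- & _). clear H0.
  induction Pl as [|p l Hp Pl IH]; simpl in *; [apply gen_1|].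
  apply gen_mul; [apply H; [exact Hp|apply Nat.divide_factor_l]|].
  apply IH. intros q Hq D. apply H; [exact Hq|now apply Nat.divide_mul_r].
Qed.

(** * Injectivity of the encoding and correctness of the reductions *)

Section Codes.
Context (k : nat).

(** The code of a vector does not contain its length, so it can be delimited only with the dimension
    [k] known; in [encS] this is the leading token. *)
Lemma elt_nats_inj u v (t t' : list nat) : dim k u -> dim k v ->
  elt_nats u ++ t = elt_nats v ++ t' -> u = v /\ t = t'.
Proof.
  destruct u as [l|], v as [l'|]; simpl; intros Hu Hv; intros [= E]; auto.
  assert (L : length l = length l') by lia. clear Hu Hv. revert l' L E.
  induction l as [|a l IH]; intros [|a' l'] L E; simpl in *; try lia; auto.
  injection E as -> E. destruct (IH l' ltac:(lia) E) as [[= ->] ->]. auto.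
Qed.

Lemma op_code_inj o o' : op_code o = op_code o' -> o = o'.
Proof. intros E. rewrite <- (op_of_code o), E. apply op_of_code. Qed.

Lemma gate_nats_inj (g g' : nat * label elt) t t' :
  (forall v, snd g = LIn v -> dim k v) -> (forall v, snd g' = LIn v -> dim k v) ->
  gate_nats elt_nats g ++ t = gate_nats elt_nats g' ++ t' -> g = g' /\ t = t'.
Proof.
  destruct g as [n [u|p|o p1 p2]], g' as [n' [u'|p'|o' p1' p2']]; cbn [snd]; intros H H' E;
    try discriminate.
  - injection E as -> E. apply elt_nats_inj in E; [destruct E as [-> ->]; auto|now apply H|now apply H'].
  - injection E as -> -> ->. auto.
  - injection E as -> E -> -> ->. now apply op_code_inj in E as ->.
Qed.

Lemma gates_inj (gs gs' : list (nat * label elt)) t t' :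
  length gs = length gs' ->
  (forall v, In v (inputs gs) -> dim k v) -> (forall v, In v (inputs gs') -> dim k v) ->
  flat_map (gate_nats elt_nats) gs ++ t = flat_map (gate_nats elt_nats) gs' ++ t' ->
  gs = gs' /\ t = t'.
Proof.
  revert gs'. induction gs as [|g gs IH]; intros [|g' gs'] L H H' E; try discriminate; auto.
  cbn [flat_map] in E. rewrite <- !app_assoc in E. apply gate_nats_inj in E.
  - destruct E as [-> E]. apply IH in E.
    + now destruct E as [-> ->].
    + now injection L.
    + intros v Hv. apply H, in_or_app. now right.
    + intros v Hv. apply H', in_or_app. now right.
  - intros v Hv. apply H, in_or_app. left. rewrite Hv. now left.
  - intros v Hv. apply H', in_or_app. left. rewrite Hv. now left.
Qed.
End Codes.

(** [MCstar] provides some circuit and element having the given code; injectivity identifies them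
    with the ones constructed by the reduction. *)
Lemma encS_inj k (C : circuit elt) b k' C' b' :
  (forall v, In v (inputs (gates C)) -> dim k v) -> dim k b ->
  (forall v, In v (inputs (gates C')) -> dim k' v) -> dim k' b' ->
  encS k C b = encS k' C' b' -> k = k' /\ C = C' /\ b = b'.
Proof.
  intros HC Hb HC' Hb' E. unfold encS in E. apply (f_equal tokens) in E.
  rewrite !tokens_code_list in E. destruct C as [gs o], C' as [gs' o'].
  unfold circ_nats in E. cbn [gates outg] in *. injection E as <- <- L E.
  fold (gate_nats elt_nats) in E. rewrite <- (app_nil_r (elt_nats b)), <- (app_nil_r (elt_nats b')) in E.
  apply (gates_inj k) in E; auto. destruct E as [-> E].
  apply (elt_nats_inj k) in E; auto. now destruct E as [-> _].
Qed.

Lemma gates_ok_inputs {V} O (okv : V -> Prop) gs :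
  gates_ok O okv gs -> forall v, In v (inputs gs) -> okv v.
Proof.
  induction gs as [|[n l] gs IH]; [easy|]. intros (_ & Hl & H) v Hv.
  apply in_app_or in Hv. destruct Hv as [Hv|Hv]; [|auto].
  destruct l; simpl in *; [|easy|easy]. now destruct Hv as [<-|[]].
Qed.

Lemma gates_ok_LNeg {V} O (okv : V -> Prop) gs n p :
  gates_ok O okv gs -> In (n, LNeg p) gs -> O OCompl.
Proof.
  induction gs as [|[n' l] gs IH]; [easy|]. intros (_ & Hl & H) [E|Hn]; [|auto].
  injection E as -> ->. apply Hl.
Qed.

Lemma dim_vec B n : dim (S (length B)) (vec B n).
Proof.
  unfold vec. destruct (n =? 0); simpl; [exact I|]. rewrite length_app, length_map. simpl. lia.
Qed.

Lemma circuit_ok_additive (O O' : op -> Prop) B C :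
  (forall o, O o <-> O' (additive_op o)) ->
  circuit_ok O (fun _ => True) C <-> circuit_ok O' (dim (S (length B))) (additive B C).
Proof.
  intros HO. unfold circuit_ok. destruct C as [gs o]. cbn [additive gates outg].
  assert (F : forall gs, map fst (map (fun g : nat * label nat => (fst g, additive_label B (snd g))) gs)
    = map fst gs) by (intros; rewrite map_map; reflexivity).
  rewrite F. enough (G : gates_ok O (fun _ => True) gs <-> gates_ok O' (dim (S (length B)))
    (map (fun g => (fst g, additive_label B (snd g))) gs)) by (rewrite G; reflexivity).
  clear o. induction gs as [|[n l] gs IH]; [reflexivity|]. cbn [map gates_ok fst snd].
  rewrite F, IH. enough (L : label_ok O (fun _ => True) l gs <-> label_ok O' (dim (S (length B)))
    (additive_label B l) (map (fun g => (fst g, additive_label B (snd g))) gs)) by (rewrite L; reflexivity).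
  destruct l as [v|p|o p1 p2]; cbn [additive_label label_ok]; rewrite ?F.
  - split; [intros _; apply dim_vec|auto].
  - now rewrite (HO OCompl).
  - rewrite (HO o). enough (N : o <> OCompl <-> additive_op o <> OCompl) by (rewrite N; reflexivity).
    now destruct o.
Qed.

(** Covers both parts: the cofactors and their weight may depend on the given numbers, and totality
    is asked for only if complements are allowed. *)
Lemma reduction_correct (O O' : op -> Prop) basis :
  (forall o, O o <-> O' (additive_op o)) ->
  (forall ns, exists R w, cofactors (basis ns) R w /\ (O OCompl -> total (basis ns) R w) /\
    forall n, In n ns -> n <> 0 -> gen (basis ns) n) ->
  forall x, MC O x <-> MCstar O' (reduction basis x).
Proof.
  intros HO HB.
  assert (SEM : forall C b, circuit_ok O (fun _ => True) C ->
    let B := basis (b :: inputs (gates C)) in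
    semN C b <-> semS (S (length B)) (additive B C) (vec B b)).
  { intros C b [HC _] B. destruct (HB (b :: inputs (gates C))) as (R & w & HR & T & G).
    apply (semS_additive B R w HR); [exact G|].
    intros n p Hn. apply T. now apply (gates_ok_LNeg _ _ _ _ _ HC Hn). }
  assert (IN : forall B C v, In v (inputs (gates (additive B C))) -> dim (S (length B)) v).
  { intros B C v Hv. unfold inputs, additive in Hv. cbn [gates] in Hv. apply in_flat_map in Hv.
    destruct Hv as (g & Hg & Hv). apply in_map_iff in Hg. destruct Hg as ([n l] & <- & _).
    simpl in Hv. destruct l; simpl in Hv; [|easy|easy]. destruct Hv as [<-|[]]. apply dim_vec. }
  intros x. split.
  - intros (C & b & -> & HC & Hb). rewrite reduction_encN. unfold reduce.
    set (B := basis (b :: inputs (gates C))).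
    exists (S (length B)), (additive B C), (vec B b).
    split; [lia|split; [reflexivity|split; [now apply (circuit_ok_additive O)|split; [apply dim_vec|]]]].
    now apply SEM.
  - intros (k & C' & b' & Hk & E & HC' & Hb' & HS). unfold reduction in E.
    destruct (beqb_list _ x) eqn:X.
    (* The empty word has no tokens, whereas every code in [MCstar] begins with the dimension. *)
    2: { apply (f_equal tokens) in E. unfold encS in E. rewrite tokens_code_list in E. discriminate. } apply beqb_list_eq in X.
    set (b := snd (parse (tokens x))) in *. set (C := Circuit _ _) in *.
    exists C, b. unfold reduce in E. set (B := basis (b :: inputs (gates C))) in *.
    apply encS_inj in E; [|apply IN|apply dim_vec|exact (gates_ok_inputs _ _ _ (proj1 HC'))|exact Hb'].
    destruct E as (<- & <- & <-). apply (circuit_ok_additive O) in HC'; [|exact HO].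
    split; [now symmetry|split; [exact HC'|]]. now apply SEM.
Qed.

Theorem theorem4 :
  forall O : op -> Prop,
    (exists o, O o) ->
    (forall o, O o -> o = OCup \/ o = OCap) ->
    red_P (MC (fun o => O o \/ o = OMul \/ o = ODiv))
          (MCstar (fun o => O o \/ o = OAdd \/ o = OSub)) /\
    red_PSPACE (MC (fun o => O o \/ o = OCompl \/ o = OMul \/ o = ODiv))
               (MCstar (fun o => O o \/ o = OCompl \/ o = OAdd \/ o = OSub)).
Proof.
  intros O _ HO. split.
  - exists (reduction coprime_basis). split; [apply CF_poly_time, CF_reduction, CF_coprime_basis|].
    apply reduction_correct.
    + intros o. destruct o; simpl; intuition (try discriminate);
        match goal with H : O _ |- _ => apply HO in H; destruct H; discriminate end.
    + intros ns. destruct (coprime_basis_spec ns) as (H2 & HC & HG).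
      exists (fun r => r = 1), (fun _ => 0). split; [now apply cofactors_one|split; [|exact HG]].
      intros [H|[H|H]]; [apply HO in H; destruct H; discriminate|discriminate|discriminate].
  - exists (reduction prime_basis). split; [apply CF_poly_space, CF_reduction, CF_prime_basis|].
    apply reduction_correct.
    + intros o. destruct o; simpl; intuition (try discriminate);
        match goal with H : O _ |- _ => apply HO in H; destruct H; discriminate end.
    + intros ns. destruct (prime_basis_spec ns) as (HP & HC & HG).
      exists (prime_to (prime_basis ns)), Omega. split; [now apply cofactors_Omega|].
      split; [intros _; now apply total_primes|]. intros n Hn H0. apply gen_primes; [exact H0|].
      intros p Hp D. now apply HG with n.
Qed.
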